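(* Let $g$ be a totally positive function of finite type $m\ge 2$ and let $a,K,M\in\mathbb{N}$ with $K/a\in\mathbb{N}$ and $K/M\in\mathbb{N}$. Let $P_KSg\in\mathbb{C}^K$ be the vector $(P_KSg)(n)=\sum_{k\in\mathbb{Z}}g(n-kK)$, $n=0,\ldots,K-1$. If $a/M<1$, then the Gabor family $\mathcal{G}(P_KSg,a,1/M)=\{M_{l/M}T_{ka}P_KSg: k=0,\ldots,K/a-1,\ l=0,\ldots,M-1\}$ is a frame for $\mathbb{C}^K$. Furthermore, if $\gamma$ is the dual window of $\mathcal{G}(g,a,1/M)$ in $L^2(\mathbb{R})$ produced by the algorithm described below (with $\alpha=a$, $\beta=1/M$ and any $L\in\mathbb{N}_0$), then $P_KS\gamma$, i.e. $(\sum_{k\in\mathbb{Z}}\gamma(n-kK))_{n=0}^{K-1}$, is a dual window of $\mathcal{G}(P_KSg,a,1/M)$.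
   Context: $j$ is the imaginary unit, $\hat g(\xi)=\int g(x)e^{-2\pi jx\xi}dx$. $g\in L^1(\mathbb{R})$ is totally positive of finite type $m$ if $\hat g(\xi)=C\prod_{k=1}^m(1+2\pi j\delta_k\xi)^{-1}$ with $C>0$ and nonzero real $\delta_k$; let $p$ (resp. $q$) be the number of positive (resp. negative) $\delta_k$. On $\mathbb{C}^K$ (indices mod $K$), $M_\xi T_kf(n)=f((n-k)\bmod K)e^{2\pi j\xi n}$ for $\xi\in\frac1K\mathbb{Z}$. On $L^2(\mathbb{R})$, $M_\xi T_xf(t)=f(t-x)e^{2\pi j\xi t}$. Frame: $A\|f\|^2\le\sum|\langle f,e_i\rangle|^2\le B\|f\|^2$ for all $f$, $A,B>0$. A dual window of a Gabor frame $\mathcal{G}(\phi,\alpha,\beta)$ is $\psi$ with $\mathcal{G}(\psi,\alpha,\beta)$ a frame and $f=\sum\langle f,M_{l\beta}T_{k\alpha}\phi\rangle M_{l\beta}T_{k\alpha}\psi$ for all $f$ (sum over the index set of the family). Algorithm (input $g$, $\alpha,\beta>0$ with $\alpha\beta<1$, $L\in\mathbb{N}_0$): for each $x\in[0,\alpha)$ set $r=\lfloor 1/(1-\alpha\beta)\rfloor$, $k_1=-(r+1)p-L$, $k_2=(r+1)q+L$, $i_1=\lfloor (k_1+p-1)/(\alpha\beta)-x/\alpha\rfloor+1$, $i_2=\lceil (k_2-q+1)/(\alpha\beta)-x/\alpha\rceil-1$; form $P=(g(x+\alpha i-k/\beta))_{i_1\le i\le i_2,\,k_1\le k\le k_2}$,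 let $P^\dagger=(q_{k,i})$ be its Moore–Penrose pseudoinverse, and set $\gamma(x+\alpha i)=\beta q_{0,i}$ for $i_1\le i\le i_2$, $\gamma(x+\alpha i)=0$ otherwise. *)

(* Defs.v *)
From HB Require Import structures.
From mathcomp Require Import all_boot all_order all_algebra.
From mathcomp Require Import all_classical all_reals all_analysis.
From mathcomp Require Import complex.
Set Implicit Arguments. Unset Strict Implicit. Unset Printing Implicit Defensive.
Import Order.TTheory GRing.Theory Num.Theory.
Local Open Scope ring_scope.

Section Defs.
Variable R : realType.
Local Notation C := R[i].

Definition L1 (g : R -> R) : Prop :=
  (@lebesgue_measure R).-integrable setT (fun x => (g x)%:E).

(* \hat g(xi) = \int g(x) e^{-2 pi j x xi} dx, written out through its real and
   imaginary parts (g is real-valued). *)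
Definition fourier (g : R -> R) (xi : R) : C :=
  Complex (Rintegral (@lebesgue_measure R) setT (fun x => g x * cos (2 * pi * x * xi)))
          (- Rintegral (@lebesgue_measure R) setT (fun x => g x * sin (2 * pi * x * xi))).

Definition totally_positive_finite_type (g : R -> R) (m : nat) (C0 : R)
    (delta : 'I_m -> R) : Prop :=
  L1 g /\ 0 < C0 /\ (forall k, delta k != 0) /\
  forall xi : R,
    fourier g xi = C0%:C%C * \prod_(k < m) (1 + Complex 0 (2 * pi * delta k * xi))^-1.

Definition npos m (delta : 'I_m -> R) : nat := #|[pred k | 0 < delta k]|.
Definition nneg m (delta : 'I_m -> R) : nat := #|[pred k | delta k < 0]|.

(* (P_K S f)(n) = \sum_{k in Z} f(n - kK), as the limit of the symmetric partial
   sums \sum_{-N <= k < N}. *)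
Definition PKS (K : nat) (f : R -> R) (n : 'I_K) : C :=
  (limn (fun N : nat => \sum_(k < N)
          (f (n%:R - (k%:R * K%:R)) + f (n%:R + ((k.+1)%:R * K%:R)))))%:C%C.

Definition inner (K : nat) (f e : 'I_K -> C) : C := \sum_(n < K) f n * (e n)^*%C.
Definition sqnorm (K : nat) (f : 'I_K -> C) : R := \sum_(n < K) ComplexField.Normc.normc (f n) ^+ 2.

Definition is_frame (K : nat) (I : finType) (e : I -> 'I_K -> C) : Prop :=
  exists A B : R, 0 < A /\ 0 < B /\
    forall f : 'I_K -> C,
      A * sqnorm f <= \sum_(i : I) ComplexField.Normc.normc (inner f (e i)) ^+ 2 <= B * sqnorm f.

Lemma ord_pos (K : nat) (n : 'I_K) : (0 < K)%N.
Proof. exact: leq_ltn_trans (leq0n n) (ltn_ord n). Qed.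

Definition transl (K : nat) (k : nat) (f : 'I_K -> C) : 'I_K -> C :=
  fun n => f (Ordinal (ltn_pmod (n + K - k %% K) (ord_pos n))).

Definition modul (K : nat) (M l : nat) (f : 'I_K -> C) : 'I_K -> C :=
  fun n => f n * Complex (cos (2 * pi * (l%:R / M%:R) * n%:R))
                         (sin (2 * pi * (l%:R / M%:R) * n%:R)).

Definition gabor (K a M : nat) (phi : 'I_K -> C) :
    'I_(K %/ a) * 'I_M -> 'I_K -> C :=
  fun kl => modul M kl.2 (transl (kl.1 * a) phi).

Definition is_dual_window (K a M : nat) (phi psi : 'I_K -> C) : Prop :=
  is_frame (@gabor K a M psi) /\
  forall f : 'I_K -> C,
    f = (fun n => \sum_(kl : 'I_(K %/ a) * 'I_M)
                   inner f (@gabor K a M phi kl) * @gabor K a M psi kl n).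

Definition is_MP_pinv (r c : nat) (P : 'M[R]_(r, c)) (Q : 'M[R]_(c, r)) : Prop :=
  [/\ P *m Q *m P = P, Q *m P *m Q = Q, (P *m Q)^T = P *m Q & (Q *m P)^T = Q *m P].

Section Algorithm.
Variables (g : R -> R) (p q : nat) (alpha beta : R) (L : nat).

Definition alg_r : int := Num.floor (1 / (1 - alpha * beta)).
Definition alg_k1 : int := - ((alg_r + 1) * p%:Z) - L%:Z.
Definition alg_k2 : int := (alg_r + 1) * q%:Z + L%:Z.
Definition alg_i1 (x : R) : int :=
  Num.floor ((alg_k1 + p%:Z - 1)%:~R / (alpha * beta) - x / alpha) + 1.
Definition alg_i2 (x : R) : int :=
  Num.ceil ((alg_k2 - q%:Z + 1)%:~R / (alpha * beta) - x / alpha) - 1.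

Definition alg_nI (x : R) : nat := absz (alg_i2 x - alg_i1 x + 1).
Definition alg_nK : nat := (absz (alg_k2 - alg_k1)).+1.

(* P = (g(x + alpha i - k/beta))_{i1<=i<=i2, k1<=k<=k2}; row index i - i1,
   column index k - k1 *)
Definition alg_P (x : R) : 'M[R]_(alg_nI x, alg_nK) :=
  \matrix_(i, k) g (x + alpha * (alg_i1 x + i%:Z)%:~R - (alg_k1 + k%:Z)%:~R / beta).

(* row index of k = 0 in P^dagger, i.e. 0 - k1 *)
Definition alg_k0 : 'I_alg_nK := inord (absz (- alg_k1)).

Definition algorithm_output (gamma : R -> R) : Prop :=
  forall x : R, 0 <= x < alpha ->
    exists Q : 'M[R]_(alg_nK, alg_nI x),
      is_MP_pinv (alg_P x) Q /\
      (forall i : 'I_(alg_nI x),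
          gamma (x + alpha * (alg_i1 x + i%:Z)%:~R) = beta * Q alg_k0 i) /\
      (forall i : int, (i < alg_i1 x) || (alg_i2 x < i) ->
          gamma (x + alpha * i%:~R) = 0).

End Algorithm.
End Defs.
Arguments gabor {R K} a M phi _ _.
Arguments is_dual_window {R K} a M phi psi.
Arguments PKS {R} K f n.

(* Main.v *)
Require Import Defs.
From HB Require Import structures.
From mathcomp Require Import all_boot all_order all_algebra.
From mathcomp Require Import all_classical all_reals all_analysis measurable_realfun.
From mathcomp Require Import complex ring lra zify.
Set Implicit Arguments. Unset Strict Implicit. Unset Printing Implicit Defensive.
Import Order.TTheory GRing.Theory Num.Theory numFieldNormedType.Exports.
Local Open Scope classical_set_scope.
Local Open Scope ring_scope.

(* By Fourier uniqueness the window is C0 times the fundamental solution of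
   prod_k (1 + delta_k D): an exponential polynomial with the p positive rates
   on the right half-line, one with the q negative rates on the left.

   The matrix P of the algorithm has full column rank. A vector in its kernel is
   the coefficient vector of an exponential spline vanishing at all sampling
   points of the window. Applying the factors 1 + delta_k D one after the other
   loses no sign change (Rolle), and gains one whenever the spline vanishes on
   the half-line where the homogeneous solution grows, so the number of zeros is
   bounded by the number of knots; since alpha beta < 1 there are too many
   sampling points, unless the spline vanishes between two knots, and then it
   splits into shorter splines with the same property.

   Hence the row of P^dagger with index 0 is biorthogonal to the shifts k1..k2
   of g, and to all other shifts because outside the window only one of the two
   exponential polynomials is seen, which has at most p - 1 (resp. q - 1) zeros.
   Periodizing this relation gives the duality of the two finite Gabor systems,
   and dual systems in finite dimension are frames. *)

(** The transform determines [g] only almost everywhere, while the algorithm and the periodization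
    read point values. Uniqueness is therefore proved for continuous functions, and [m >= 2] makes
    the fundamental solution continuous at 0. No inversion formula is involved: indicators of rays
    are bounded pointwise limits of trigonometric polynomials, so a function with zero transform has
    zero integral over every ray. The obstacle in the rank argument is that a spline may vanish on
    intervals. Only zeros separated by nonzero values are counted, and the ends where the spline
    vanishes are recorded by booleans; vanishing on the right lowers the admissible number of zeros
    by [p], on the left by [q]. The constant [r] satisfies [(r + 1) a < r M]. This is what places
    [k2 - k1 + 2] sampling points strictly inside the window, one more than there are unknown
    coefficients. Duality rests on the identity [Q P = 1], so the frame claim is obtained from a
    window built with an arbitrary left inverse for [L = 0], and the claim on [gamma] from the
    pseudoinverse. *)

(** * Kernels of products of operators [1 + d D]: zeros, intersections, decay *)

Section OdeKernel.
Variable R : realType.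
Implicit Types (A B f : R -> R) (ds : seq R) (c d t x : R).

(** The kernel of the product of the operators [1 + d D], as a chain: the derivative condition says
    that [A1] is [A + d A'], and [A1] is killed by the remaining factors. Higher derivatives are
    thereby avoided. *)
Fixpoint Ker ds A : Prop :=
  match ds with
  | [::] => forall x, A x = 0
  | d :: ds' => exists2 A1, (forall x, is_derive x 1 A ((A1 x - A x) / d)) & Ker ds' A1
  end.

Lemma is_derive_affine A c x y df : is_derive (c * x + y) 1 A df ->
  is_derive x 1 (fun t => A (c * t + y)) (c * df).
Proof.
move=> h.
have h1 : is_derive x 1 (fun t : R => c * t + y) c.
  apply: is_derive_eq; rewrite !(scaler0, add0r, addr0) /GRing.scale/=.
  by rewrite mulr1.
have := @is_derive1_comp R A (fun t : R => c * t + y) x df c.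
rewrite /comp => h2; apply: is_derive_eq (h2 h h1) _.
exact: mulrC.
Qed.

Lemma is_derive_lin A B a b x dA dB : is_derive x 1 A dA -> is_derive x 1 B dB ->
  is_derive x 1 (fun t => a * A t + b * B t) (a * dA + b * dB).
Proof. by move=> hA hB; apply: is_derive_eq. Qed.

Lemma is_derive_continuous A x dA : is_derive x 1 A dA -> {for x, continuous A}.
Proof. by move=> h; apply/differentiable_continuous/derivable1_diffP. Qed.

Lemma is_derive_expM c x : is_derive x 1 (fun t => expR (c * t)) (c * expR (c * x)).
Proof.
have := @is_derive_affine expR c x 0 (expR (c * x)).
rewrite addr0 => /(_ (is_derive_expR _)).
by under eq_fun do rewrite addr0.
Qed.

Lemma is_derive_expMA A a c x dA : is_derive x 1 A dA ->
  is_derive x 1 (fun t => a * (expR (c * t) * A t))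
    (a * (expR (c * x) * (dA + c * A x))).
Proof.
move=> hA; have hE := is_derive_expM c x.
by apply: is_derive_eq; rewrite /GRing.scale/=; ring.
Qed.

Lemma Ker_eq ds A B : A =1 B -> Ker ds A -> Ker ds B.
Proof. by move=> /funext ->. Qed.

Lemma Ker_lin ds A B a b : Ker ds A -> Ker ds B -> Ker ds (fun x => a * A x + b * B x).
Proof.
elim: ds A B => [|d ds ih] A B /=.
  by move=> hA hB x; rewrite hA hB !mulr0 addr0.
move=> [A1 dA kA] [B1 dB kB]; exists (fun x => a * A1 x + b * B1 x); last exact: ih.
move=> x; apply: is_derive_eq (is_derive_lin a b (dA x) (dB x)) _.
ring.
Qed.

Lemma Ker0 ds : Ker ds (fun=> 0).
Proof.
elim: ds => [//|d ds ih] /=; exists (fun=> 0) => // x.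
by rewrite subrr mul0r; exact: is_derive_cst.
Qed.

Lemma KerZ ds A a : Ker ds A -> Ker ds (fun x => a * A x).
Proof.
move=> kA; apply: Ker_eq (Ker_lin a 0 kA (Ker0 ds)) => x.
by rewrite mul0r addr0.
Qed.

Lemma KerB ds A B : Ker ds A -> Ker ds B -> Ker ds (fun x => A x - B x).
Proof.
by move=> kA kB; apply: Ker_eq (Ker_lin 1 (-1) kA kB) => x; rewrite mul1r mulN1r.
Qed.

Lemma Ker_sum (I : Type) (r : seq I) (P : pred I) (F : I -> R -> R) ds :
  (forall i, P i -> Ker ds (F i)) -> Ker ds (fun x => \sum_(i <- r | P i) F i x).
Proof.
move=> h; elim: r => [|i r ih].
  by apply: Ker_eq (Ker0 ds) => x; rewrite big_nil.
case Pi: (P i); last by apply: Ker_eq ih => x; rewrite big_cons Pi.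
apply: Ker_eq (Ker_lin 1 1 (h _ Pi) ih) => x.
by rewrite big_cons Pi !mul1r.
Qed.

(** The operators commute: [A + d A'] is a combination of [A] and [A + e A'], hence stays in the
    kernel it came from. *)
Lemma Ker_cons ds A d : all (fun e => e != 0) ds -> d != 0 -> Ker ds A -> Ker (d :: ds) A.
Proof.
elim: ds A d => [|e ds ih] A d /=.
  move=> _ _ hA; exists (fun=> 0) => // x.
  by rewrite (_ : A = fun=> 0) ?subr0 ?mul0r; [exact: is_derive_cst|apply/funext].
move=> /andP[e0 nz] d0 [A1 dA kA1].
exists (fun x => (1 - d / e) * A x + (d / e) * A1 x).
  by move=> x; apply: is_derive_eq (dA x) _; field; rewrite d0 e0.
apply: (@Ker_lin (e :: ds)); first by exists A1.
exact: ih.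
Qed.

Lemma Ker_catl ds1 ds2 A : all (fun e => e != 0) ds2 -> Ker ds1 A -> Ker (ds1 ++ ds2) A.
Proof.
move=> nz; elim: ds1 A => [|d ds ih] A /=; last first.
  by move=> [A1 dA kA]; exists A1 => //; exact: ih.
move=> A0; have {A0}-> : A = fun=> 0 by exact/funext.
exact: Ker0.
Qed.

Lemma Ker_catr ds1 ds2 A : all (fun e => e != 0) ds1 -> all (fun e => e != 0) ds2 ->
  Ker ds2 A -> Ker (ds1 ++ ds2) A.
Proof.
elim: ds1 A => [//|d ds ih] A /= /andP[d0 nz1] nz2 kA.
by apply: Ker_cons => //; [rewrite all_cat nz1|exact: ih].
Qed.

Lemma Ker_affine ds A c y : c != 0 -> Ker ds A ->
  Ker [seq d / c | d <- ds] (fun x => A (c * x + y)).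
Proof.
move=> c0; elim: ds A => [|d ds ih] A /=; first by move=> hA x; rewrite hA.
move=> [A1 dA kA]; exists (fun x => A1 (c * x + y)); last exact: ih.
move=> x; apply: is_derive_eq (is_derive_affine (dA _)) _.
have [->|d0] := eqVneq d 0; first by rewrite mul0r invr0 !mulr0.
by field; rewrite c0 d0.
Qed.

Lemma Ker_shift ds A y : Ker ds A -> Ker ds (fun x => A (x - y)).
Proof.
move=> kA; have := Ker_affine (- y) (oner_neq0 R) kA.
rewrite (eq_map (g := id)) ?map_id; last by move=> d; rewrite divr1.
by apply: Ker_eq => x; rewrite mul1r.
Qed.

Lemma Ker_flip ds A y : Ker ds A -> Ker [seq - d | d <- ds] (fun x => A (y - x)).
Proof.
move=> kA; have N10 : (-1 : R) != 0 by rewrite oppr_eq0 oner_eq0.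
have := Ker_affine y N10 kA.
rewrite (eq_map (g := -%R)); last by move=> d; rewrite invrN1 mulrN1.
by apply: Ker_eq => x; rewrite mulN1r addrC.
Qed.

Lemma Ker_derivable d ds A : Ker (d :: ds) A -> continuous A.
Proof. by move=> [A1 dA _] x; exact: is_derive_continuous (dA x). Qed.

Lemma Ker_continuous ds A : Ker ds A -> continuous A.
Proof.
case: ds => [/= A0|d ds]; last exact: Ker_derivable.
by rewrite (_ : A = fun=> 0); [move=> x; exact: cvg_cst|exact/funext].
Qed.

Lemma deriv0_cst A : (forall x, is_derive x 1 A 0) -> forall x y, A x = A y.
Proof. by move=> h x y; exact: is_derive_0_is_cst. Qed.

Lemma ode_hom A d : d != 0 -> (forall x, is_derive x 1 A (- A x / d)) ->
  forall x, A x = A 0 * expR (- (x / d)).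
Proof.
move=> d0 hA x.
have h (y : R) : is_derive y 1 (fun t => 1 * (expR (d^-1 * t) * A t)) 0.
  apply: is_derive_eq (is_derive_expMA 1 d^-1 (hA y)) _.
  by field.
have := deriv0_cst h x 0; rewrite !mul1r mulr0 expR0 mul1r => <-.
by rewrite mulrAC -expRD mulrC [x / d]mulrC subrr expR0 mulr1.
Qed.

(* Rolle, applied to [expR (x / d) * A x]. *)
Lemma Ker_zeros ds A (z : nat -> R) : all (fun e => e != 0) ds -> Ker ds A ->
  (forall i, (i.+1 < size ds)%N -> z i < z i.+1) ->
  (forall i, (i < size ds)%N -> A (z i) = 0) -> forall x, A x = 0.
Proof.
elim: ds A z => [//|d ds ih] A z /= /andP[d0 nz] [A1 dA kA1] zinc zA.
pose u t := 1 * (expR (d^-1 * t) * A t).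
have du (t : R) : is_derive t 1 u (expR (d^-1 * t) * (A1 t / d)).
  by apply: is_derive_eq (is_derive_expMA 1 d^-1 (dA t)) _; field.
have uz i : (i <= size ds)%N -> u (z i) = 0 by move=> ?; rewrite /u zA// !mulr0.
have hw i : exists w, (i.+1 <= size ds)%N -> [/\ z i < w, w < z i.+1 & A1 w = 0].
  have [ile|] := leqP i.+1 (size ds); last by exists 0; lia.
  have zi := zinc _ ile.
  have [|w wi ] := @MVT R u _ _ _ zi (fun t _ => du t).
    by apply: derivable_within_continuous => t _; exact: (@ex_derive _ _ _ _ _ _ _ (du t)).
  rewrite !uz//; last exact: ltnW.
  rewrite subrr => /esym/eqP; rewrite mulf_eq0 subr_eq0 (gt_eqF zi) orbF.
  rewrite mulf_eq0 gt_eqF ?expR_gt0//= mulf_eq0 invr_eq0 (negPf d0) orbF => /eqP A1w.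
  by exists w => _; move: wi; rewrite in_itv/= => /andP[].
have [w hw'] := choice hw.
have A10 : forall x, A1 x = 0.
  apply: (ih A1 w) => // i isz.
    have [_ h1 _] := hw' i (ltnW isz); have [h2 _ _] := hw' i.+1 isz.
    exact: lt_trans h1 h2.
  by have [] := hw' i isz.
have dA' (x : R) : is_derive x 1 A (- A x / d).
  by have := dA x; rewrite A10 sub0r.
move=> x; rewrite (ode_hom d0 dA').
have := zA 0 isT; rewrite (ode_hom d0 dA') => /eqP.
by rewrite mulf_eq0 [expR _ == 0]gt_eqF ?expR_gt0// orbF => /eqP ->; rewrite mul0r.
Qed.

(** Any interval offers [size ds] distinct zeros, which is all that [Ker_zeros] asks for. *)
Lemma Ker_zero_itv ds A l r : all (fun e => e != 0) ds -> Ker ds A -> l < r ->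
  (forall x, l < x < r -> A x = 0) -> forall x, A x = 0.
Proof.
move=> nz kA lr hA; pose n : R := (size ds).+1%:R.
have n0 : 0 < n by rewrite ltr0n.
have rl : 0 < r - l by rewrite subr_gt0.
apply: (@Ker_zeros ds A (fun i => l + (r - l) * (i.+1%:R / n))) => //.
  by move=> i _; rewrite ltrD2l ltr_pM2l// ltr_pM2r ?invr_gt0// ltr_nat.
move=> i isz; apply: hA.
rewrite ltrDl mulr_gt0 ?divr_gt0 ?ltr0n//=.
rewrite -ltrBrDl -[ltRHS]mulr1 ltr_pM2l// ltr_pdivrMr// mul1r ltr_nat.
by rewrite ltnS.
Qed.

(** Induction on [ds1]: [A + d A'] lies in both kernels again, so it is zero and [A] solves
    [A' = - A / d]. *)
Lemma Ker_disjoint ds1 ds2 A : all (fun e => e != 0) ds1 -> all (fun e => e != 0) ds2 ->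
  (forall d, d \in ds1 -> d \notin ds2) -> Ker ds1 A -> Ker ds2 A -> forall x, A x = 0.
Proof.
move=> nz1 nz2 dis k1 k2.
elim: ds1 A nz1 dis k1 k2 => [//|d ds1 ih] A /= /andP[d0 nz1] dis [A1 dA k1] k2.
have A10 : forall x, A1 x = 0.
  apply: (ih _ nz1 _ k1).
    by move=> e he; apply: dis; rewrite inE he orbT.
  case: ds2 {ih dis} nz2 k2 => [|e ds2]; rewrite /=.
    move=> _ hA x; have := dA x.
    have -> : A = fun=> 0 by exact/funext.
    move=> h; have := @derive_val _ _ _ _ _ _ _ h.
    rewrite derive_cst subr0 => /esym/eqP.
    by rewrite mulf_eq0 invr_eq0 (negPf d0) orbF => /eqP.
  move=> /andP[e0 nz2] [A2 dA2 k2].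
  have -> : A1 = fun x => (1 - d / e) * A x + (d / e) * A2 x.
    apply/funext => x.
    have := @derive_val _ _ _ _ _ _ _ (dA x).
    rewrite (@derive_val _ _ _ _ _ _ _ (dA2 x)) => /(congr1 (fun y => y * d)).
    rewrite mulfVK// => h; rewrite -[A1 x](subrK (A x)) -h; field.
    by rewrite e0.
  by apply: (@Ker_lin (e :: ds2)); [exists A2|exact: Ker_cons].
have dA' (x : R) : is_derive x 1 A (- A x / d).
  by have := dA x; rewrite A10 sub0r.
have dnot : d \notin ds2 by apply: dis; rewrite inE eqxx.
(* On a solution of [A' = - A / d] each factor [1 + e D] acts as the scalar [1 - e / d], nonzero
   since [e] differs from [d]; the factors of [ds2] are stripped one by one. *)
clear -nz2 dnot k2 dA' d0.
elim: ds2 nz2 dnot k2 => [//|e ds2 ih] /= /andP[e0 nz2].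
rewrite inE negb_or => /andP[de dnot] [A2 dA2 k2].
have E : A2 = fun x => (1 - e / d) * A x.
  apply/funext => x.
  have := @derive_val _ _ _ _ _ _ _ (dA2 x).
  rewrite (@derive_val _ _ _ _ _ _ _ (dA' x)) => /(congr1 (fun y => y * e)).
  rewrite mulfVK// => h; rewrite -[A2 x](subrK (A x)) -h; field.
  by rewrite d0.
have c0 : 1 - e / d != 0.
  rewrite subr_eq0; apply: contra_neqN de => /eqP h.
  by rewrite -[d]mul1r h mulfVK.
apply: ih => //.
apply: Ker_eq (KerZ ((1 - e / d)^-1) k2) => x.
by rewrite E mulKf.
Qed.

Lemma Ker_agree ds1 ds2 A B l r : all (fun e => e != 0) ds1 -> all (fun e => e != 0) ds2 ->
  (forall d, d \in ds1 -> d \notin ds2) -> Ker ds1 A -> Ker ds2 B -> l < r ->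
  (forall x, l < x < r -> A x = B x) -> (forall x, A x = 0) /\ (forall x, B x = 0).
Proof.
move=> nz1 nz2 dis kA kB lr AB.
have E x : A x = B x.
  apply/eqP; rewrite -subr_eq0; apply/eqP; move: x.
  apply: (@Ker_zero_itv (ds1 ++ ds2) _ l r) => //.
  - by rewrite all_cat nz1.
  - by apply: KerB; [exact: Ker_catl|exact: Ker_catr].
  - by move=> x /AB ->; rewrite subrr.
have A0 : forall x, A x = 0.
  by apply: (Ker_disjoint nz1 nz2) => //; apply: Ker_eq kB => x; rewrite E.
by split=> // x; rewrite -E.
Qed.

(** Each factor is a relaxation equation [A' = (A1 - A) / d] with [d > 0], through which decay of
    [A1] is inherited at any rate below [1 / d]. *)
Lemma Ker_decay ds A : all (fun d => 0 < d) ds -> Ker ds A ->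
  exists c C : R, [/\ 0 < c, 0 < C & forall t, 0 <= t -> `|A t| <= C * expR (- (c * t))].
Proof.
elim: ds A => [|d ds ih] A /=.
  move=> _ A0; exists 1, 1; split => // t _; rewrite A0 normr0.
  by rewrite mulr_ge0// expR_ge0.
move=> /andP[d0 ds0] [A1 dA kA].
have [c1 [C1 [c10 C10 hA1]]] := ih _ ds0 kA.
(* Half the resonant rate [1 / d], so that [1 - c d] stays positive. *)
pose c : R := Num.min c1 (2 * d)^-1.
have c0 : 0 < c by rewrite lt_min c10 invr_gt0 mulr_gt0.
have cd : c * d <= 2^-1.
  rewrite -ler_pdivlMr// /c ge_min; apply/orP; right.
  by rewrite invfM.
pose K : R := `|A 0| + C1 / (1 - c * d).
have cd1 : 0 < 1 - c * d by lra.
have K0 : 0 < K by rewrite /K ltr_wpDl ?normr_ge0// divr_gt0.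
exists c, K; split => //.

(* One-sided comparison, used for [A] and for [- A]. Since [K (1 - c d) >= C1], the function
   [K e^(-c t)] is a supersolution, and [phi], which is [e^(x/d)] times [B - K e^(-c x)], does not
   increase. *)
have up B B1 : (forall x, is_derive x 1 B ((B1 x - B x) / d)) ->
    B 0 <= K -> (forall t, 0 <= t -> B1 t <= C1 * expR (- (c1 * t))) ->
    forall t, 0 <= t -> B t <= K * expR (- (c * t)).
  move=> dB B0 hB1 t t0.
  pose phi x := 1 * (1 * (expR (d^-1 * x) * B x)) + (- K) * expR ((d^-1 - c) * x).
  have dphi (x : R) : is_derive x 1 phi (1 * (1 * (expR (d^-1 * x) * ((B1 x - B x) / d + d^-1 * B x)))
      + (- K) * ((d^-1 - c) * expR ((d^-1 - c) * x))).
    apply: is_derive_lin; last exact: is_derive_expM.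
    exact: is_derive_expMA.
  have cphi : {within `[0, t], continuous phi}%classic.
    by apply: derivable_within_continuous => x _; exact: (@ex_derive _ _ _ _ _ _ _ (dphi x)).
  have : phi t <= phi 0.
    apply: (@ler0_derive1_nincr R phi 0 t) => //.
    - move=> x; rewrite in_itv/= => /andP[/ltW x0 _].
      rewrite derive1E (@derive_val _ _ _ _ _ _ _ (dphi x)) !mul1r.
      have -> : (B1 x - B x) / d + d^-1 * B x = B1 x / d by field; rewrite gt_eqF.
      have h1 : B1 x <= C1 * expR (- (c * x)).
        apply: le_trans (hB1 _ x0) _; rewrite ler_pM2l// ler_expR lerN2.
        by rewrite ler_wpM2r// ge_min lexx.
      have -> : expR ((d^-1 - c) * x) = expR (d^-1 * x) * expR (- (c * x)).
        by rewrite -expRD mulrBl.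
      have e1 := expR_gt0 (d^-1 * x); have e2 := expR_gt0 (- (c * x)).
      rewrite [_ + _](_ : _ = (expR (d^-1 * x) / d) *
          (B1 x - K * (1 - c * d) * expR (- (c * x)))); last by field; rewrite gt_eqF.
      rewrite pmulr_rle0 ?divr_gt0// subr_le0 (le_trans h1)// ler_pM2r//.
      by rewrite /K mulrDl mulfVK ?gt_eqF// lerDr mulr_ge0// ltW.
  rewrite /phi !mul1r !mulr0 !expR0 mul1r mulr1 => h.
  have {h} : expR (d^-1 * t) * B t <= K * expR ((d^-1 - c) * t) by lra.
  by rewrite mulrBl expRD mulrCA ler_pM2l// expR_gt0.
have C1d : 0 <= C1 / (1 - c * d) by rewrite ltW// divr_gt0.
move=> t t0; rewrite ler_norml lerNl; apply/andP; split.
  apply: (up (fun x => - A x) (fun x => - A1 x)) => //.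
  - move=> x; apply: is_derive_eq.
    ring.
  - by rewrite /K; have := ler_norm (- A 0); rewrite normrN; lra.
  - by move=> s /hA1; rewrite ler_norml => /andP[]; lra.
apply: (up A A1) => //.
- by rewrite /K; have := ler_norm (A 0); lra.
- by move=> s /hA1; rewrite ler_norml => /andP[].
Qed.

End OdeKernel.

(** * Existence of the fundamental solution *)

Section Construction.
Variable R : realType.
Implicit Types (A B f : R -> R) (ds : seq R) (c d t x : R).
Local Notation mu := (@lebesgue_measure R).

Lemma continuous_antiderivative f : continuous f ->
  exists F, forall x, is_derive x 1 F (f x).
Proof.
move=> cf.
have fint a b : mu.-integrable `]a, b]%classic (EFin \o f).
  apply: (@integrableS _ _ _ mu `[a, b]%classic) => //.
    by apply: subset_itv; rewrite bnd_simp.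
  apply: continuous_compact_integrable; first exact: segment_compact.
  exact: continuous_subspaceT.
(* Normalizing at 0 makes the value independent of the lower endpoint [- N] (shown in [HE]), so [N]
   may grow with [x]. *)
pose H N x : R := (\int[mu]_(t in `]- N, x]) f t - \int[mu]_(t in `]- N, 0]) f t)%R.
have HE N M x : 0 < M -> M <= N -> - M < x -> H N x = H M x.
  move=> M0 MN Mx; rewrite /H.
  have h y : - M <= y -> (\int[mu]_(t in `]- M, y]) f t =
      \int[mu]_(t in `]- N, y]) f t - \int[mu]_(t in `]- N, - M]) f t)%R.
    by move=> My; rewrite Rintegral_itvB// bnd_simp lerN2.
  rewrite h ?ltW// h ?oppr_le0 1?ltW//; ring.
exists (fun x => H (`|x| + 1) x) => x.
have Hd : is_derive x 1 (H (`|x| + 2)) (f x).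
  have Nx : - (`|x| + 2) < x by have := ler_norm (- x); rewrite normrN; lra.
  have [] := @continuous_FTC1 _ f (BRight (- (`|x| + 2))) x (x + 1) _ _ _ (cf x).
  - by rewrite ltrDl.
  - exact: fint.
  - done.
  move=> dF FE.
  have dI : is_derive x 1 (fun y => \int[mu]_(t in `]- (`|x| + 2), y]) f t)%R (f x).
    by rewrite -FE derive1E; exact/derivableP.
  by apply: is_derive_eq; rewrite subr0.
apply: near_eq_is_derive Hd.
near=> y.
have yx : `|x - y| < 1 by near: y; apply: nbhsx_ballx.
apply: HE.
- by rewrite ltr_wpDl.
- have := ler_normB x (x - y); rewrite opprB addrC subrK; lra.
- by have := ler_norm (- y); rewrite normrN; lra.
Unshelve. all: by end_near. Qed.

(** Absence of resonance: as [d] is not in [ds], the operator [1 + d D] is onto [Ker ds] from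
    [Ker ds] itself. *)
Lemma Ker_solve ds d A : all (fun e => e != 0) ds -> d != 0 -> d \notin ds -> Ker ds A ->
  exists2 v, Ker ds v & forall x, is_derive x 1 v ((A x - v x) / d).
Proof.
move=> nz d0; elim: ds A nz => [|e ds ih] A /=.
  move=> _ _ A0; exists (fun=> 0) => // x.
  by rewrite A0 subrr mul0r; exact: is_derive_cst.
move=> /andP[e0 nz]; rewrite inE negb_or => /andP[de dnot] [A1 dA kA1].
have [v kv dv] := ih _ nz dnot kA1.

(* Partial fractions: write [1 + e D = (e/d) (1 + d D) + (1 - e/d)], apply it to [A], use
   [A1 = (1 + d D) v] and solve for [A]. *)
exists (fun x => (1 - d / e)^-1 * A x + (- (d / e) / (1 - d / e)) * v x).
  exists v => // x; apply: is_derive_eq (is_derive_lin _ _ (dA x) (dv x)) _.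
  field; rewrite d0 e0 subr_eq0 eq_sym de ?andbT//.
move=> x; apply: is_derive_eq (is_derive_lin _ _ (dA x) (dv x)) _.
field; rewrite d0 e0 subr_eq0 eq_sym de ?andbT//.
Qed.

(** Variation of constants: [e^(x/d) v] is an antiderivative of [e^(x/d) A / d], and its constant of
    integration sets the value at 0. *)
Lemma ode_solve d A c : d != 0 -> continuous A ->
  exists2 v, v 0 = c & forall x, is_derive x 1 v ((A x - v x) / d).
Proof.
move=> d0 cA.
have [|F dF] := @continuous_antiderivative (fun t => expR (d^-1 * t) * A t / d).
  move=> t; apply: cvgM; last exact: cvg_cst.
  apply: cvgM; last exact: cA.
  exact: is_derive_continuous (is_derive_expM _ _).
exists (fun x => 1 * (expR (- d^-1 * x) * (F x + (c - F 0) * 1))).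
  by rewrite mulr0 expR0; ring.
move=> x.
have dFc : is_derive x 1 (fun x => 1 * F x + (c - F 0) * 1) (1 * (expR (d^-1 * x) * A x / d) + (c - F 0) * 0).
  exact: is_derive_lin.
have {}dFc : is_derive x 1 (fun x => F x + (c - F 0) * 1) (expR (d^-1 * x) * A x / d).
  move: dFc; rewrite mul1r mulr0 addr0.
  by under [X in is_derive _ _ X _]eq_fun do rewrite mul1r.
apply: is_derive_eq (is_derive_expMA 1 (- d^-1) dFc) _.
rewrite mulNr expRN; field.
by rewrite d0 gt_eqF ?expR_gt0.
Qed.

Definition pos ds := [seq d <- ds | 0 < d].
Definition neg ds := [seq d <- ds | d < 0].

Definition nonzeros ds := all (fun d => d != 0) ds.

Lemma nonzeros_pos ds : nonzeros ds -> nonzeros (pos ds).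
Proof. by move=> h; apply/allP => d; rewrite mem_filter => /andP[_ /(allP h)]. Qed.

Lemma nonzeros_neg ds : nonzeros ds -> nonzeros (neg ds).
Proof. by move=> h; apply/allP => d; rewrite mem_filter => /andP[_ /(allP h)]. Qed.

Lemma pos_notin_neg ds d : d \in pos ds -> d \notin neg ds.
Proof. by rewrite !mem_filter => /andP[d0 _]; rewrite ltNge ltW. Qed.

(* [A] on the right and [B] on the left half-line form the fundamental solution
   of prod_d (1 + d D). *)
Fixpoint fundamental ds A B : Prop :=
  match ds with
  | [::] => (forall x, A x = 0) /\ (forall x, B x = 0)
  | d :: ds' => [/\ Ker (pos ds) A, Ker (neg ds) B,
      d * (A 0 - B 0) = (ds' == [::])%:R &
      exists A1 B1, [/\ forall x, is_derive x 1 A ((A1 x - A x) / d),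
                       forall x, is_derive x 1 B ((B1 x - B x) / d) &
                       fundamental ds' A1 B1]]
  end.

Lemma fundamental_pos ds A B : fundamental ds A B -> Ker (pos ds) A.
Proof. by case: ds => [[]//|d ds []]. Qed.

Lemma fundamental_neg ds A B : fundamental ds A B -> Ker (neg ds) B.
Proof. by case: ds => [[]//|d ds []]. Qed.

Lemma fundamental_exists ds : nonzeros ds -> exists A B, fundamental ds A B.
Proof.
elim: ds => [_|d ds ih /= /andP[d0 nz]]; first by exists (fun=> 0), (fun=> 0).
have [A1 [B1 f1]] := ih nz.
have kA := fundamental_pos f1; have kB := fundamental_neg f1.
have [dp|dn|de] := ltgtP 0 d; last by rewrite -de eqxx in d0.
- have [B kB' dB] : exists2 v, Ker (neg ds) v & forall x, is_derive x 1 v ((B1 x - v x) / d).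
    apply: Ker_solve => //; first exact: nonzeros_neg.
    by rewrite mem_filter ltNge ltW.
  have [A A0 dA] := @ode_solve d A1 (B 0 + (ds == [::])%:R / d) d0 (Ker_continuous kA).
  exists A, B; split.
  + by exists A1.
  + exact: kB'.
  + by rewrite A0; field.
  + by exists A1, B1.
- have [A kA' dA] : exists2 v, Ker (pos ds) v & forall x, is_derive x 1 v ((A1 x - v x) / d).
    apply: Ker_solve => //; first exact: nonzeros_pos.
    by rewrite mem_filter ltNge ltW.
  have [B B0 dB] := @ode_solve d B1 (A 0 - (ds == [::])%:R / d) d0 (Ker_continuous kB).
  exists A, B; split.
  + exact: kA'.
  + by exists B1.
  + by rewrite B0; field.
  + by exists A1, B1.
Qed.

(** Zero halves would stay zero along the chain, down to the last factor, whose jump at 0 is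
    nonzero. *)
Lemma fundamental_neq0 ds A B : nonzeros ds -> ds != [::] -> fundamental ds A B ->
  ~ ((forall x, A x = 0) /\ (forall x, B x = 0)).
Proof.
elim: ds A B => [//|d ds ih] A B /= /andP[d0 nz] _ [_ _ E [A1 [B1 [dA dB f1]]]] [A0 B0].
have [ds0|ds0] := eqVneq ds [::].
  by move: E; rewrite A0 B0 subrr mulr0 ds0 eqxx => /esym/eqP; rewrite oner_eq0.

have h A' A1' : (forall x, is_derive x 1 A' ((A1' x - A' x) / d)) -> (forall x, A' x = 0) -> forall x, A1' x = 0.
  move=> dA' A'0 x; have := dA' x.
  rewrite (_ : A' = fun=> 0); last exact/funext.
  move=> h; have := @derive_val _ _ _ _ _ _ _ h.
  rewrite derive_cst subr0 => /esym/eqP.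
  by rewrite mulf_eq0 invr_eq0 (negPf d0) orbF => /eqP.
by apply: (ih _ _ nz ds0 f1); split; [exact: h dA A0|exact: h dB B0].
Qed.

End Construction.

(** * Integrals over half-lines of exponentially decaying functions *)

Section HalfLineIntegrals.
Variable R : realType.
Implicit Types (A B f F : R -> R) (ds : seq R) (c d t x : R).
Local Notation mu := (@lebesgue_measure R).

Lemma continuous_measurableS (D : set R) f : measurable D -> continuous f ->
  measurable_fun D f.
Proof.
by move=> mD cf; apply: measurable_funTS; exact: continuous_measurable_fun.
Qed.

Lemma expR_cvg0 c : 0 < c -> expR (- (c * x)) @[x --> +oo] --> 0.
Proof.
move=> c0; apply: (@cvg_comp _ _ _ (fun x => c * x) (fun y => expR (- y)) _ (pinfty_nbhs R)).
  by apply: gt0_cvgMry => //; exact: cvg_id.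
exact: cvgr_expR.
Qed.

Lemma continuous_expRN c C : continuous (fun x => C * expR (- (c * x))).
Proof.
move=> x; apply: cvgM; first exact: cvg_cst.
have := is_derive_expM (- c) x.
rewrite (_ : (fun t => expR (- c * t)) = (fun t => expR (- (c * t)))).
  exact: is_derive_continuous.
by apply/funext => t; rewrite mulNr.
Qed.

Lemma integral_expRN c C : 0 < c -> 0 <= C ->
  (\int[mu]_(x in `[0%R, +oo[) (C * expR (- (c * x)))%:E = (C / c)%:E)%E.
Proof.
move=> c0 C0; pose F x := (- (C / c)) * expR (- c * x).
have dF x : is_derive x 1 F (C * expR (- (c * x))).
  have hE := is_derive_expM (- c) x.
  apply: is_derive_eq; rewrite /GRing.scale/= [- c * x]mulNr.
  by field; rewrite gt_eqF.
rewrite (@ge0_continuous_FTC2y _ (fun x => C * expR (- (c * x))) F 0 0).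
- by rewrite /F mulr0 expR0 mulr1 -EFinB sub0r opprK.
- by move=> x _; rewrite mulr_ge0// expR_ge0.
- by apply: continuous_subspaceT; exact: continuous_expRN.
- rewrite -(mulr0 (- (C / c))); apply: cvgM; first exact: cvg_cst.
  by under eq_fun do rewrite mulNr; exact: expR_cvg0.
- by move=> x _; exact: (@ex_derive _ _ _ _ _ _ _ (dF x)).
- by apply: cvg_at_right_filter; exact: is_derive_continuous (dF 0).
- by move=> x _; rewrite derive1E (@derive_val _ _ _ _ _ _ _ (dF x)).
Qed.

Lemma integrable_expRN c C : 0 < c -> 0 <= C ->
  mu.-integrable `[0, +oo[ (EFin \o (fun x => C * expR (- (c * x)))).
Proof.
move=> c0 C0; apply/integrableP; split.
  by apply/measurable_EFinP; apply: continuous_measurableS => //; exact: continuous_expRN.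
under eq_integral => x _.
  rewrite /= ger0_norm; last by rewrite mulr_ge0// expR_ge0.
  over.
by rewrite integral_expRN// ltry.
Qed.

Lemma integrable_decay f c C : continuous f -> 0 < c -> 0 <= C ->
  (forall t, 0 <= t -> `|f t| <= C * expR (- (c * t))) ->
  mu.-integrable `[0, +oo[ (EFin \o f).
Proof.
move=> cf c0 C0 hf; apply: le_integrable (integrable_expRN c0 C0) => //.
  by apply/measurable_EFinP; exact: continuous_measurableS.
move=> x /=; rewrite in_itv/= andbT => x0.
by rewrite lee_fin [leRHS]ger0_norm ?hf// mulr_ge0// expR_ge0.
Qed.

Lemma decay_cvg0 f c C : (forall t, 0 <= t -> `|f t| <= C * expR (- (c * t))) -> 0 < c ->
  f x @[x --> +oo] --> 0.
Proof.
move=> hf c0; apply/cvgr0Pnorm_lt => e e0.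
have h : C * expR (- (c * x)) @[x --> +oo] --> 0.
  by rewrite -(mulr0 C); apply: cvgM; [exact: cvg_cst|exact: expR_cvg0].
have := h => /cvgr0Pnorm_lt/(_ _ e0) h1.
near=> x; apply: le_lt_trans (hf _ _) _; first by near: x; exact: nbhs_pinfty_ge.
apply: le_lt_trans (ler_norm _) _; near: x; exact: h1.
Unshelve. all: by end_near. Qed.

(** The fundamental theorem on a half-line is applied to a nonnegative integrand: the majorant
    [C e^(-c x)] is added to [f], and its known integral is cancelled afterwards. *)
Lemma FTC_decay f F c C : continuous f -> (forall x, is_derive x 1 F (f x)) ->
  0 < c -> 0 <= C -> (forall t, 0 <= t -> `|f t| <= C * expR (- (c * t))) ->
  F x @[x --> +oo] --> 0 ->
  (\int[mu]_(x in `[0%R, +oo[) f x = - F 0)%R.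
Proof.
move=> cf dF c0 C0 hf F0.
have fi := integrable_decay cf c0 C0 hf.
have ei := integrable_expRN c0 C0.
pose E x := C * expR (- (c * x)).
have cE : continuous E by exact: continuous_expRN.
have iE : (\int[mu]_(x in `[0%R, +oo[) E x = C / c)%R.
  by rewrite /Rintegral integral_expRN.
pose G x := F x + (- (C / c)) * expR (- c * x).
have dG x : is_derive x 1 G (f x + E x).
  have hE := is_derive_expM (- c) x.
  apply: is_derive_eq; rewrite /GRing.scale/= /E [- c * x]mulNr.
  by field; rewrite gt_eqF.
have := @Rintegral_ge0_continuous_FTC2y _ (fun x => f x + E x) G 0 0.
rewrite RintegralD// iE => h.
apply: (addIr (C / c)); rewrite h.
- by rewrite /G mulr0 expR0; ring.
- by move=> x /hf; rewrite ler_norml => /andP[+ _]; rewrite /E; lra.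
- apply: continuous_subspaceT => x; apply: cvgD; [exact: cf|exact: cE].
- rewrite -(addr0 0) -[in X in _ + X](mulr0 (- (C / c))).
  apply: cvgD => //; apply: cvgM; first exact: cvg_cst.
  by under eq_fun do rewrite mulNr; exact: expR_cvg0.
- by move=> x _; exact: (@ex_derive _ _ _ _ _ _ _ (dG x)).
- by apply: cvg_at_right_filter; exact: is_derive_continuous (dG 0).
- by move=> x _; rewrite derive1E (@derive_val _ _ _ _ _ _ _ (dG x)).
Qed.

(** The reflection formula holds for nonnegative functions; it is applied to [|f|] and to [f + |f|],
    and the results are subtracted. *)
Lemma integral_flip f : continuous f -> mu.-integrable `[0, +oo[ (EFin \o (f \o -%R)) ->
  mu.-integrable `]-oo, 0] (EFin \o f) /\
  (\int[mu]_(x in `]-oo, 0%R]) f x = \int[mu]_(x in `[0%R, +oo[) f (- x))%R.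
Proof.
move=> cf fi.
have flip (h : R -> R) : continuous h -> (forall x, 0 <= h x) ->
    (\int[mu]_(x in `]-oo, 0%R]) (h x)%:E = \int[mu]_(x in `[0%R, +oo[) (h (- x))%:E)%E.
  move=> ch h0; have := @ge0_integration_by_substitutionNy _ h 0.
  by rewrite oppr0; apply => // ; exact: continuous_subspaceT.
have cn : continuous (fun x => `|f x|).
  by move=> x; apply: cvg_norm; exact: cf.
have ni : mu.-integrable `[0, +oo[ (EFin \o (fun x => `|f (- x)|)).
  exact: integrable_norm fi.
have fi' : mu.-integrable `]-oo, 0] (EFin \o f).
  apply/integrableP; split; first by apply/measurable_EFinP; exact: continuous_measurableS.
  under eq_integral do rewrite /= .
  rewrite flip//.
  by move/integrableP : fi => [].
split => //.
have ni' : mu.-integrable `]-oo, 0] (EFin \o (fun x => `|f x|)).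
  exact: integrable_norm fi'.
have E1 : (\int[mu]_(x in `]-oo, 0%R]) `|f x| = \int[mu]_(x in `[0%R, +oo[) `|f (- x)|)%R.
  by rewrite /Rintegral flip.
have E2 : (\int[mu]_(x in `]-oo, 0%R]) (f x + `|f x|) =
    \int[mu]_(x in `[0%R, +oo[) (f (- x) + `|f (- x)|))%R.
  rewrite /Rintegral (flip (fun x => f x + `|f x|))//.
    by move=> x; apply: cvgD; [exact: cf|exact: cn].
  by move=> x; have := ler_norm (- f x); rewrite normrN; lra.
by move: E2; rewrite !RintegralD// E1 => /addIr.
Qed.

End HalfLineIntegrals.

(** * Fourier transform of the fundamental solution *)

Section FourierFundamental.
Variable R : realType.
Implicit Types (A B f F h : R -> R) (ds : seq R) (c d t x w : R).
Local Notation mu := (@lebesgue_measure R).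

Definition decays f :=
  exists c C : R, [/\ 0 < c, 0 < C & forall t, 0 <= t -> `|f t| <= C * expR (- (c * t))].

Lemma decays_comb A B f a b : decays A -> decays B -> 0 <= a -> 0 <= b ->
  (forall t, 0 <= t -> `|f t| <= a * `|A t| + b * `|B t|) -> decays f.
Proof.
move=> [c1 [C1 [c10 C10 hA]]] [c2 [C2 [c20 C20 hB]]] a0 b0 hf.
exists (Num.min c1 c2), (a * C1 + b * C2 + 1); split.
- by rewrite lt_min c10.
- by rewrite ltr_wpDl// addr_ge0// mulr_ge0// ltW.
move=> t t0; apply: le_trans (hf _ t0) _.
have e1 : expR (- (c1 * t)) <= expR (- (Num.min c1 c2 * t)).
  by rewrite ler_expR lerN2 ler_wpM2r// ge_min lexx.
have e2 : expR (- (c2 * t)) <= expR (- (Num.min c1 c2 * t)).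
  by rewrite ler_expR lerN2 ler_wpM2r// ge_min lexx orbT.
have h1 : a * `|A t| <= a * C1 * expR (- (Num.min c1 c2 * t)).
  rewrite -mulrA ler_wpM2l//; apply: le_trans (hA _ t0) _.
  by rewrite ler_pM2l.
have h2 : b * `|B t| <= b * C2 * expR (- (Num.min c1 c2 * t)).
  rewrite -mulrA ler_wpM2l//; apply: le_trans (hB _ t0) _.
  by rewrite ler_pM2l.
have := expR_ge0 (- (Num.min c1 c2 * t)).
rewrite !mulrDl mul1r; lra.
Qed.

Lemma decaysM A h : decays A -> (forall x, `|h x| <= 1) -> decays (fun x => A x * h x).
Proof.
move=> dA h1; apply: (decays_comb dA dA ler01 (lexx 0)) => t _.
by rewrite mul0r addr0 mul1r normrM ler_piMr.
Qed.

Lemma decays_integrable f : continuous f -> decays f -> mu.-integrable `[0, +oo[ (EFin \o f).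
Proof. by move=> cf [c [C [c0 C0 hf]]]; exact: integrable_decay cf c0 (ltW C0) hf. Qed.

Lemma FTC_right f F : continuous f -> (forall x, is_derive x 1 F (f x)) ->
  decays f -> decays F -> (\int[mu]_(x in `[0%R, +oo[) f x = - F 0)%R.
Proof.
move=> cf dF [c [C [c0 C0 hf]]] [c' [C' [c0' C0' hF]]].
exact: (FTC_decay cf dF c0 (ltW C0) hf (decay_cvg0 hF c0')).
Qed.

Lemma FTC_left f F : continuous f -> (forall x, is_derive x 1 F (f x)) ->
  decays (f \o -%R) -> decays (F \o -%R) -> (\int[mu]_(x in `]-oo, 0%R]) f x = F 0)%R.
Proof.
move=> cf dF df dF'.
have cf' : continuous (f \o -%R).
  by move=> x; apply: continuous_comp; [exact: opp_continuous|exact: cf].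
have [_ ->] := integral_flip cf (decays_integrable cf' df).
have dF2 (x : R) : is_derive x 1 (fun x => - F (- x)) (f (- x)).
  have := @is_derive_affine _ F (-1) x 0 (f (- x)).
  rewrite addr0 mulN1r => /(_ (dF _)) h.
  have h2 : is_derive x 1 (fun t => F (- t)) (- f (- x)).
    move: h; rewrite mulN1r; congr (is_derive _ _ _ _).
    by apply/funext => t; rewrite mulN1r addr0.
  by apply: is_derive_eq; rewrite opprK.
have dF3 : decays (fun x => - F (- x)).
  have [c [C [c0 C0 hF]]] := dF'; exists c, C; split => // t t0.
  by rewrite normrN; exact: hF.
have := FTC_right cf' dF2 df dF3.
by rewrite oppr0 opprK.
Qed.

Definition splice A B x := if x < 0 then B x else A x.

Lemma splice_integral A B h : continuous A -> continuous B -> continuous h ->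
  (forall x, `|h x| <= 1) -> decays A -> decays (B \o -%R) ->
  mu.-integrable setT (EFin \o (fun x => splice A B x * h x)) /\
  (\int[mu]_x (splice A B x * h x) =
    \int[mu]_(x in `]-oo, 0%R]) (B x * h x) + \int[mu]_(x in `[0%R, +oo[) (A x * h x))%R.
Proof.
move=> cA cB ch h1 dA dB.
have cAh : continuous (fun x => A x * h x) by move=> x; apply: cvgM; [exact: cA|exact: ch].
have cBh : continuous (fun x => B x * h x) by move=> x; apply: cvgM; [exact: cB|exact: ch].
have iA : mu.-integrable `[0, +oo[ (EFin \o (fun x => A x * h x)).
  by apply: decays_integrable => //; exact: decaysM.
have iB : mu.-integrable `]-oo, 0] (EFin \o (fun x => B x * h x)).
  apply: (integral_flip cBh _).1; apply: decays_integrable.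
    by move=> x; apply: continuous_comp; [exact: opp_continuous|exact: cBh].
  by apply: (decaysM dB (h := h \o -%R)) => x; exact: h1.
have iB' : mu.-integrable `]-oo, 0[ (EFin \o (fun x => B x * h x)).
  apply: integrableS iB => //; apply: subset_itvl; by rewrite bnd_simp.
have E : (fun x => splice A B x * h x) = (fun x => ((fun x => B x * h x) \_ `]-oo, 0[) x +
     ((fun x => A x * h x) \_ `[0, +oo[) x).
  apply/funext => x; rewrite /splice /patch !mem_setE !in_itv/= andbT.
  by case: ltP => _; rewrite ?addr0 ?add0r.
have jB : mu.-integrable setT (EFin \o ((fun x => B x * h x) \_ `]-oo, 0[)).
  by rewrite -restrict_EFin; apply/(integrable_mkcond _ _).1.
have jA : mu.-integrable setT (EFin \o ((fun x => A x * h x) \_ `[0, +oo[)).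
  by rewrite -restrict_EFin; apply/(integrable_mkcond _ _).1.
rewrite E; split; first exact: (integrableD measurableT jB jA).
by rewrite RintegralD// -!Rintegral_mkcond Rintegral_itv_bndo_bndc.
Qed.

Definition Tc A B w := (\int[mu]_x (splice A B x * cos (w * x)))%R.
Definition Ts A B w := (\int[mu]_x (splice A B x * sin (w * x)))%R.

Lemma normr_cos_le1 x : `|cos x| <= 1.
Proof. by rewrite ler_norml cos_geN1 cos_le1. Qed.

Lemma normr_sin_le1 x : `|sin x| <= 1.
Proof. by rewrite ler_norml sin_geN1 sin_le1. Qed.

Lemma is_derive_cosM w x : is_derive x 1 (fun t => cos (w * t)) (- (w * sin (w * x))).
Proof.
have := @is_derive_affine _ cos w x 0 (- sin (w * x)).
rewrite addr0 mulrN => /(_ (is_derive_cos _)).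
by under eq_fun do rewrite addr0.
Qed.

Lemma is_derive_sinM w x : is_derive x 1 (fun t => sin (w * t)) (w * cos (w * x)).
Proof.
have := @is_derive_affine _ sin w x 0 (cos (w * x)).
rewrite addr0 => /(_ (is_derive_sin _)).
by under eq_fun do rewrite addr0.
Qed.

Lemma cont_cosM w : continuous (fun x => cos (w * x)).
Proof. by move=> x; exact: is_derive_continuous (is_derive_cosM w x). Qed.

Lemma cont_sinM w : continuous (fun x => sin (w * x)).
Proof. by move=> x; exact: is_derive_continuous (is_derive_sinM w x). Qed.

Definition sides A B := [/\ continuous A, continuous B, decays A & decays (B \o -%R)].

Lemma sides_lin A B A1 B1 a b : sides A B -> sides A1 B1 ->
  sides (fun x => a * A x + b * A1 x) (fun x => a * B x + b * B1 x).
Proof.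
move=> [cA cB dA dB] [cA1 cB1 dA1 dB1].
have nle (u v : R) : `|a * u + b * v| <= `|a| * `|u| + `|b| * `|v|.
  by rewrite -!normrM ler_normD.
split.
- move=> x; apply: cvgD; apply: cvgM; [exact: cvg_cst|exact: cA|exact: cvg_cst|exact: cA1].
- move=> x; apply: cvgD; apply: cvgM; [exact: cvg_cst|exact: cB|exact: cvg_cst|exact: cB1].
- by apply: (decays_comb dA dA1 (normr_ge0 a) (normr_ge0 b)) => t _; exact: nle.
- by apply: (decays_comb dB dB1 (normr_ge0 a) (normr_ge0 b)) => t _; exact: nle.
Qed.

(* Integration by parts over both half-lines; the jump of the glued function
   at [0] survives as the boundary term. *)
Lemma splice_ibp A B A1 B1 d h h' w : d != 0 -> sides A B -> sides A1 B1 ->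
  (forall x, is_derive x 1 A ((A1 x - A x) / d)) ->
  (forall x, is_derive x 1 B ((B1 x - B x) / d)) ->
  continuous h -> continuous h' -> (forall x, `|h x| <= 1) -> (forall x, `|h' x| <= 1) ->
  (forall x, is_derive x 1 h (w * h' x)) ->
  \int[mu]_x (splice A1 B1 x * h x) - \int[mu]_x (splice A B x * h x) +
    d * w * \int[mu]_x (splice A B x * h' x) = - (d * (A 0 - B 0) * h 0).
Proof.
move=> d0 sAB sAB1 dA dB ch ch' h1 h1' dh.
have [cA cB eA eB] := sAB; have [cA1 cB1 eA1 eB1] := sAB1.
pose fA x := 1 * (A1 x * h x) + (-1) * (A x * h x) + (d * w) * (A x * h' x).
pose fB x := 1 * (B1 x * h x) + (-1) * (B x * h x) + (d * w) * (B x * h' x).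
have cM u v : continuous u -> continuous v -> continuous (fun x : R => (u x : R) * v x).
  by move=> cu cv x; apply: cvgM; [exact: cu|exact: cv].
have dM u v : decays u -> (forall x, `|v x| <= 1) -> decays (fun x => u x * v x).
  exact: decaysM.
have s1 : sides (fun x => A1 x * h x) (fun x => B1 x * h x).
  split; [exact: cM|exact: cM|exact: dM|].
  by apply: (dM (B1 \o -%R) (h \o -%R)) => // x; exact: h1.
have s2 : sides (fun x => A x * h x) (fun x => B x * h x).
  split; [exact: cM|exact: cM|exact: dM|].
  by apply: (dM (B \o -%R) (h \o -%R)) => // x; exact: h1.
have s3 : sides (fun x => A x * h' x) (fun x => B x * h' x).
  split; [exact: cM|exact: cM|exact: dM|].
  by apply: (dM (B \o -%R) (h' \o -%R)) => // x; exact: h1'.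
have s4 : sides fA fB.
  have := sides_lin 1 (d * w) (sides_lin 1 (-1) s1 s2) s3.
  rewrite /fA /fB; congr sides; apply/funext => x; by rewrite mul1r.
have [cfA cfB efA efB] := s4; have [_ _ eAh eBh] := s2.
have sd : sides (fun x => d * (A x * h x)) (fun x => d * (B x * h x)).
  have := sides_lin d 0 s2 s2; congr sides; apply/funext => x; by rewrite mul0r addr0.
have [_ _ edA edB] := sd.
have IA : (\int[mu]_(x in `[0%R, +oo[) fA x = - (d * (A 0 * h 0)))%R.
  apply: (@FTC_right fA (fun x => d * (A x * h x))) => // x.
  have hA := dA x; have hh := dh x.
  by apply: is_derive_eq; rewrite /GRing.scale/= /fA; field.
have IB : (\int[mu]_(x in `]-oo, 0%R]) fB x = d * (B 0 * h 0))%R.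
  apply: (@FTC_left fB (fun x => d * (B x * h x))) => // x.
  have hB := dB x; have hh := dh x.
  by apply: is_derive_eq; rewrite /GRing.scale/= /fB; field.
have [i1 _] := splice_integral cA1 cB1 ch h1 eA1 eB1.
have [i2 _] := splice_integral cA cB ch h1 eA eB.
have [i3 _] := splice_integral cA cB ch' h1' eA eB.
have c1 : continuous (cst 1 : R -> R) by move=> x; exact: cvg_cst.
have n1 (x : R) : `|1 : R| <= 1 by rewrite normr1.
have [i4 E4] := splice_integral cfA cfB c1 n1 efA efB.
have E : \int[mu]_x (splice fA fB x * 1) = \int[mu]_x (splice A1 B1 x * h x)
   - \int[mu]_x (splice A B x * h x) + d * w * \int[mu]_x (splice A B x * h' x).
  rewrite -RintegralZl// -RintegralB// -RintegralD//.
  - apply: eq_Rintegral => x _; rewrite /splice /fA /fB; case: ifP => _; ring.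
  - exact: (integrableB measurableT i1 i2).
  - exact: (integrableZl measurableT (d * w) i3).
rewrite -E E4.
under eq_Rintegral do rewrite mulr1.
rewrite IB; under eq_Rintegral do rewrite mulr1.
by rewrite IA; ring.
Qed.

Lemma fundamental_sides ds A B : nonzeros ds -> fundamental ds A B -> sides A B.
Proof.
move=> nz f; have kA := fundamental_pos f; have kB := fundamental_neg f.
split; [exact: Ker_continuous kA|exact: Ker_continuous kB| |].
  by apply: Ker_decay kA; apply/allP => d; rewrite mem_filter => /andP[].
have kB' : Ker [seq - d | d <- neg ds] (B \o -%R).
  by apply: Ker_eq (Ker_flip 0 kB) => x /=; rewrite sub0r.
apply: Ker_decay kB'; apply/allP => d /mapP[e]; rewrite mem_filter => /andP[e0 _] ->.
by rewrite oppr_gt0.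
Qed.

Local Notation C := R[i].

(** By parts, multiplying the transform by [1 + Complex 0 (d * w)] yields the transform of the tail
    of the chain plus the jump at 0. The jump is 0 except at the last factor, where it contributes
    the 1; the empty list stands for the zero function, which explains the right-hand side. *)
Lemma fundamental_fourier ds A B w : nonzeros ds -> fundamental ds A B ->
  Complex (Tc A B w) (- Ts A B w) * \prod_(d <- ds) (1 + Complex 0 (d * w))
    = (ds != [::])%:R :> C.
Proof.
elim: ds A B => [|d ds ih] A B.
  move=> _ [A0 B0]; rewrite big_nil mulr1 /Tc /Ts.
  have E h : (\int[mu]_x (splice A B x * h x) = 0)%R.
    under eq_Rintegral do rewrite /splice A0 B0 if_same mul0r.
    by rewrite /Rintegral integral0.
  by rewrite !E oppr0.
move=> /= /andP[d0 nz] f0; have [_ _ jump [A1 [B1 [dA dB f1]]]] := f0.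
have sAB : sides A B by apply: (@fundamental_sides (d :: ds)) => //=; rewrite d0.
have sAB1 := fundamental_sides nz f1.
have ns : continuous (fun x => - sin (w * x)) by move=> x; apply: cvgN; exact: cont_sinM.
have dc (x : R) : is_derive x 1 (fun t => cos (w * t)) (w * - sin (w * x)).
  by rewrite mulrN; exact: is_derive_cosM.
have ns1 x : `|- sin (w * x)| <= 1 by rewrite normrN normr_sin_le1.
have Ec : Tc A1 B1 w - Tc A B w - d * w * Ts A B w = - (d * (A 0 - B 0)).
  have := splice_ibp d0 sAB sAB1 dA dB (@cont_cosM w) ns (fun x => normr_cos_le1 _) ns1 dc.
  rewrite mulr0 cos0 mulr1 => <-.
  rewrite -/(Tc _ _ _) -/(Tc _ _ _); congr (_ + _).
  rewrite -mulrN; congr (_ * _).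
  have [cA cB eA eB] := sAB.
  have [i2 _] := splice_integral cA cB (@cont_sinM w) (fun x => normr_sin_le1 _) eA eB.
  rewrite -mulN1r /Ts -RintegralZl//.
  by apply: eq_Rintegral => x _; ring.
have Es : Ts A1 B1 w - Ts A B w + d * w * Tc A B w = 0.
  have := splice_ibp d0 sAB sAB1 dA dB (@cont_sinM w) (@cont_cosM w)
    (fun x => normr_sin_le1 _) (fun x => normr_cos_le1 _) (is_derive_sinM w).
  by rewrite mulr0 sin0 mulr0 oppr0.
rewrite big_cons mulrA.
have -> : Complex (Tc A B w) (- Ts A B w) * (1 + Complex 0 (d * w)) =
   Complex (Tc A1 B1 w) (- Ts A1 B1 w) + (ds == [::])%:R :> C.
  have -> : (ds == [::])%:R = Complex ((ds == [::])%:R) 0 :> C by case: eqP.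
  rewrite -jump; apply/eqP; rewrite eq_complex /=; apply/andP; split; apply/eqP; lra.
rewrite mulrDl (ih _ _ nz f1).
by case: ds {ih nz f0 jump f1} => [|? ?]; rewrite ?big_nil/= ?mulr1 ?add0r// mul0r addr0.
Qed.

End FourierFundamental.

(** * Injectivity of the Fourier transform on continuous integrable functions *)

Section FourierUniqueness.
Variable R : realType.
Local Notation mu := (@lebesgue_measure R).

Lemma bernoulli_ge (t : R) k : 0 <= t -> 1 + k%:R * t <= (1 + t) ^+ k.
Proof.
move=> t0; elim: k => [|k ih]; first by rewrite mul0r addr0 expr0.
rewrite exprS; apply: le_trans (_ : (1 + t) * (1 + k%:R * t) <= _).
  rewrite -natr1; have : 0 <= k%:R * t * t by rewrite !mulr_ge0.
  lra.
by rewrite ler_wpM2l// addr_ge0.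
Qed.

Lemma bernoulli_le (u : R) k : 0 <= u <= 1 -> 1 - k%:R * u <= (1 - u) ^+ k.
Proof.
move=> /andP[u0 u1]; elim: k => [|k ih]; first by rewrite mul0r subr0 expr0.
rewrite exprS; apply: le_trans (_ : (1 - u) * (1 - k%:R * u) <= _).
  rewrite -natr1; have : 0 <= k%:R * u * u by rewrite !mulr_ge0.
  lra.
by rewrite ler_wpM2l// subr_ge0.
Qed.

Lemma expr_onem_le (t : R) k : 0 <= t <= 1 -> (1 - t) ^+ k <= (1 + k%:R * t)^-1.
Proof.
move=> /andP[t0 t1]; have kt : 0 <= k%:R * t by rewrite mulr_ge0.
rewrite -[leRHS]mul1r ler_pdivlMr ?ltr_wpDr//.
apply: le_trans (_ : (1 - t) ^+ k * (1 + t) ^+ k <= _).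
  by rewrite ler_wpM2l ?exprn_ge0 ?subr_ge0// bernoulli_ge.
rewrite -exprMn exprn_ile1// ?mulr_ge0 ?subr_ge0 ?addr_ge0//.
have : 0 <= t * t by rewrite mulr_ge0.
lra.
Qed.

Lemma sin_ge_half : exists2 e : R, 0 < e & forall s, 0 <= s < e -> s / 2 <= sin s.
Proof.
have : \forall s \near (0 : R), 2^-1 <= cos s.
  have : cos s @[s --> (0 : R)] --> cos 0 by exact: continuous_cos.
  rewrite cos0 => /cvgrPdist_lt /(_ 2^-1) => /(_ _)/wrap[]; first by lra.
  apply: filterS => s; rewrite ltr_norml => /andP[_]; lra.
move=> /nbhs_ballP[e /= e0 he]; exists e => // s /andP[s0 se].
have [->|sn] := eqVneq s 0; first by rewrite mul0r sin0.
have sp : 0 < s by rewrite lt_neqAle eq_sym sn.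
have [|c] := @MVT R sin cos 0 s sp (fun x _ => is_derive_sin x).
  by apply: continuous_subspaceT; exact: continuous_sin.
rewrite in_itv/= => /andP[c0 cs]; rewrite sin0 !subr0 => ->.
rewrite mulrC ler_wpM2r//; apply: he.
by rewrite /ball/= sub0r normrN gtr0_norm// (lt_trans cs).
Qed.

(** The polynomial of elementary proofs of the Stone-Weierstrass theorem: it behaves like
    [exp (- (2 y)^k)], hence is close to 1 for [y < 1/2] and to 0 for [y > 1/2]. *)
Definition bump (k : nat) (y : R) := (1 - y ^+ k) ^+ (2 ^ k).

Lemma bump_itv k y : 0 <= y <= 1 -> 0 <= bump k y <= 1.
Proof.
move=> /andP[y0 y1]; have : 0 <= y ^+ k <= 1 by rewrite exprn_ge0// exprn_ile1.
by move=> /andP[h0 h1]; rewrite exprn_ge0 ?exprn_ile1 ?subr_ge0// gerBl.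
Qed.

(** By Bernoulli the left side is at most [2^k y^k], which is [(1 - s)^k] because [2 y = 1 - s]. *)
Lemma bump_small k (s : R) : 0 <= s <= 1 -> 1 - bump k ((1 - s) / 2) <= (1 + k%:R * s)^-1.
Proof.
move=> /andP[s0 s1]; apply: le_trans (expr_onem_le k _); last by rewrite s0.
have y0 : 0 <= (1 - s) / 2 by lra.
have y1 : (1 - s) / 2 <= 1 by lra.
have := @bernoulli_le (((1 - s) / 2) ^+ k) (2 ^ k) _.
rewrite exprn_ge0// exprn_ile1// => /(_ isT).
rewrite expr_div_n natrX mulrCA mulfV ?mulr1 ?expf_neq0 ?pnatr_eq0//.
by rewrite /bump expr_div_n; lra.
Qed.

(** The bound is [1 / (1 + 2^k y^k)] with [2^k y^k = (1 + s)^k], which is at least [k s]. *)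
Lemma bump_large k (s : R) : 0 <= s <= 1 -> bump k ((1 + s) / 2) <= (1 + k%:R * s)^-1.
Proof.
move=> /andP[s0 s1].
have y0 : 0 <= (1 + s) / 2 by lra.
have y1 : (1 + s) / 2 <= 1 by lra.
apply: le_trans (expr_onem_le (2 ^ k) _) _; first by rewrite exprn_ge0// exprn_ile1.
have h0 : 0 <= k%:R * s by rewrite mulr_ge0.
rewrite expr_div_n natrX mulrCA mulfV ?mulr1 ?expf_neq0 ?pnatr_eq0//.
rewrite lef_pV2 ?posrE; last 2 first.
- by rewrite ltr_wpDr// exprn_ge0// addr_ge0.
- by rewrite ltr_wpDr.
apply: le_trans (bernoulli_ge k s0) _; by rewrite lerDr.
Qed.

Lemma bump_mono k (y y' : R) : 0 <= y -> y <= y' -> y' <= 1 -> bump k y' <= bump k y.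
Proof.
move=> y0 yy' y1; apply: lerXn2r; rewrite ?nnegrE ?subr_ge0 ?exprn_ile1//.
- exact: le_trans yy'.
- exact: le_trans y1.
- by rewrite lerD2l lerN2 lerXn2r// nnegrE (le_trans y0).
Qed.

(** A trigonometric polynomial tending to the indicator of [x > b]. Its period grows with [n], so
    that eventually [sin] sees the sign of [x - b]; the argument of [sin] shrinks like
    [1 / (n + 1)], and the exponent [(n + 1)^2] outweighs this, leaving an error of order
    [1 / (n + 1)]. *)
Definition step_kernel (b : R) (n : nat) (x : R) :=
  bump (n.+1 ^ 2) ((1 - sin ((x - b) / n.+1%:R)) / 2).

Lemma step_kernel_cvg b x : x != b ->
  step_kernel b n x @[n --> \oo] --> ((b < x)%R%:R : R).
Proof.
move=> xb; have [e e0 he] := sin_ge_half.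
pose eta := `|x - b| / 2.
have eta0 : 0 < eta by rewrite divr_gt0// normr_gt0 subr_eq0.
have hc : (eta^-1 * harmonic n) @[n --> \oo] --> 0.
  by rewrite -(mulr0 eta^-1); apply: cvgM; [exact: cvg_cst|exact: cvg_harmonic].
have hb n : (1 + (n.+1 ^ 2)%N%:R * (`|x - b| / n.+1%:R / 2))^-1 <= eta^-1 * harmonic n.
  have n0 : 0 < n.+1%:R :> R by rewrite ltr0n.
  rewrite /harmonic/= -invfM lef_pV2 ?posrE; last 2 first.
  - by rewrite ltr_wpDr// mulr_ge0// ?divr_ge0.
  - by rewrite mulr_gt0.
  rewrite natrX [X in _ <= 1 + X](_ : _ = eta * n.+1%:R); last first.
    by rewrite /eta; field; rewrite gt_eqF.
  by rewrite lerDr.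
have small : \forall n \near \oo, `|x - b| / n.+1%:R < Num.min e 1.
  have : (`|x - b| * harmonic n) @[n --> \oo] --> 0.
    by rewrite -(mulr0 `|x - b|); apply: cvgM; [exact: cvg_cst|exact: cvg_harmonic].
  move=> /cvgr0Pnorm_lt /(_ (Num.min e 1)); rewrite lt_min e0 ltr01 => /(_ isT).
  apply: filterS => n; rewrite /harmonic/= => h.
  by apply: le_lt_trans h; exact: ler_norm.
apply/cvgrPdist_lt => z z0.
have := hc => /cvgr0Pnorm_lt/(_ _ z0) hz.
near=> n.
have n0 : 0 < n.+1%:R :> R by rewrite ltr0n.
have : `|x - b| / n.+1%:R < Num.min e 1 by near: n; exact: small.
rewrite lt_min => /andP[se s1].
have hzn : eta^-1 * harmonic n < z.
  apply: le_lt_trans (ler_norm _) _; near: n; exact: hz.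
apply: le_lt_trans (le_trans _ (hb n)) hzn.
pose s := `|x - b| / n.+1%:R.
have s0 : 0 <= s by rewrite divr_ge0// ltW.
have hs : s / 2 <= sin s by apply: he; rewrite s0.
rewrite -/s in s1.
have y01 : 0 <= (1 - sin ((x - b) / n.+1%:R)) / 2 <= 1.
  have := sin_geN1 ((x - b) / n.+1%:R); have := sin_le1 ((x - b) / n.+1%:R); lra.
have /andP[k0 k1] := bump_itv (n.+1 ^ 2) y01.
move: xb; rewrite neq_lt => /orP[xb|bx].
- have E : `|x - b| = b - x by rewrite ltr0_norm ?opprB// subr_lt0.
  rewrite ltNge (ltW xb)/= sub0r normrN ger0_norm// /step_kernel.
  apply: le_trans (@bump_large _ (`|x - b| / n.+1%:R / 2) _); last by rewrite -/s; lra.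
  have Es : (x - b) / n.+1%:R = - s by rewrite /s E -(opprB b x) mulNr.
  move: y01; rewrite Es sinN -/s => /andP[y0 y1].
  by apply: bump_mono => //; lra.
- have E : `|x - b| = x - b by rewrite gtr0_norm// subr_gt0.
  rewrite bx ger0_norm ?subr_ge0// /step_kernel.
  apply: le_trans (@bump_small _ (`|x - b| / n.+1%:R / 2) _); last by rewrite -/s; lra.
  have Es : (x - b) / n.+1%:R = s by rewrite /s E.
  move: y01; rewrite Es -/s => /andP[y0 y1].
  by rewrite lerD2l lerN2; apply: bump_mono => //; lra.
Unshelve. all: by end_near. Qed.

Variable f : R -> R.
Hypothesis fi : mu.-integrable setT (EFin \o f).
Hypothesis cf : continuous f.
Hypothesis fcos : forall w, (\int[mu]_x (f x * cos (w * x)) = 0)%R.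
Hypothesis fsin : forall w, (\int[mu]_x (f x * sin (w * x)) = 0)%R.

Let integrable_mul (h : R -> R) M : continuous h -> (forall x, `|h x| <= M) ->
  mu.-integrable setT (EFin \o (fun x => f x * h x)).
Proof.
move=> ch hM; have M0 : 0 <= M by exact: le_trans (normr_ge0 _) (hM 0).
have := integrableZl measurableT M fi; apply: le_integrable => //.
  apply/measurable_EFinP; apply: continuous_measurableS => //.
  by move=> x; apply: cvgM; [exact: cf|exact: ch].
move=> x _ /=; rewrite lee_fin !normrM (ger0_norm M0) mulrC.
by rewrite ler_wpM2r.
Qed.

(** Multipliers [h] for which [f h] still has zero transform. The free phase [p] makes this class
    stable under products with cosines, by the product-to-sum formula, and so leads from constants
    to all trigonometric polynomials. *)
Definition orth (h : R -> R) := [/\ continuous h, exists M, forall x, `|h x| <= M &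
  forall w p, (\int[mu]_x (f x * (h x * cos (w * x + p))) = 0)%R].

Let cosA w p : continuous (fun x : R => cos (w * x + p)).
Proof.
move=> x; have := @is_derive_affine _ cos w x p _ (is_derive_cos _).
exact: is_derive_continuous.
Qed.

Let integrable_orth h w p : orth h ->
  mu.-integrable setT (EFin \o (fun x => f x * (h x * cos (w * x + p)))).
Proof.
move=> [ch [M hM] _]; apply: (@integrable_mul (fun x => h x * cos (w * x + p)) M).
  by move=> x; apply: cvgM; [exact: ch|exact: cosA].
by move=> x; rewrite normrM (le_trans _ (hM x))// ler_piMr// normr_cos_le1.
Qed.

Let orth1 : orth (cst 1).
Proof.
split.
- by move=> x; exact: cvg_cst.
- by exists 1 => x; rewrite normr1.
move=> w p.
transitivity (\int[mu]_x (cos p * (f x * cos (w * x)) + (- sin p) * (f x * sin (w * x)))).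
  by apply: eq_Rintegral => x _; rewrite mul1r cosD; ring.
have i1 : mu.-integrable setT (EFin \o (fun x => f x * cos (w * x))).
  by apply: (integrable_mul (M := 1)); [exact: cont_cosM|move=> x; exact: normr_cos_le1].
have i2 : mu.-integrable setT (EFin \o (fun x => f x * sin (w * x))).
  by apply: (integrable_mul (M := 1)); [exact: cont_sinM|move=> x; exact: normr_sin_le1].
rewrite RintegralD//; last 2 first.
- exact: (integrableZl measurableT (cos p) i1).
- exact: (integrableZl measurableT (- sin p) i2).
by rewrite !RintegralZl// fcos fsin !mulr0 addr0.
Qed.

Let orth_lin h k a b : orth h -> orth k -> orth (fun x => a * h x + b * k x).
Proof.
move=> oh ok; have [ch [M hM] eh] := oh; have [ck [N kN] ek] := ok; split.
- move=> x; apply: cvgD; apply: cvgM; [exact: cvg_cst|exact: ch|exact: cvg_cst|exact: ck].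
- exists (`|a| * M + `|b| * N) => x.
  apply: le_trans (ler_normD _ _) _; rewrite !normrM.
  by apply: lerD; apply: ler_wpM2l.
move=> w p.
transitivity (\int[mu]_x (a * (f x * (h x * cos (w * x + p))) + b * (f x * (k x * cos (w * x + p))))).
  by apply: eq_Rintegral => x _; ring.
rewrite RintegralD//; last 2 first.
- exact: (integrableZl measurableT a (integrable_orth _ _ oh)).
- exact: (integrableZl measurableT b (integrable_orth _ _ ok)).
by rewrite !RintegralZl// ?eh ?ek ?mulr0 ?addr0//; exact: integrable_orth.
Qed.

Let orth_cos h v q : orth h -> orth (fun x => h x * cos (v * x + q)).
Proof.
move=> oh; have [ch [M hM] eh] := oh; split.
- by move=> x; apply: cvgM; [exact: ch|exact: cosA].
- by exists M => x; rewrite normrM (le_trans _ (hM x))// ler_piMr// normr_cos_le1.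
move=> w p.
transitivity (\int[mu]_x (2^-1 * (f x * (h x * cos ((v + w) * x + (q + p)))) +
                          2^-1 * (f x * (h x * cos ((v - w) * x + (q - p)))))).
  apply: eq_Rintegral => x _.
  rewrite (_ : (v + w) * x + (q + p) = (v * x + q) + (w * x + p)); last by ring.
  rewrite (_ : (v - w) * x + (q - p) = (v * x + q) - (w * x + p)); last by ring.
  by rewrite (cosD (v * x + q) (w * x + p)) (cosB (v * x + q) (w * x + p)); field.
rewrite RintegralD//; last 2 first.
- exact: (integrableZl measurableT _ (integrable_orth _ _ oh)).
- exact: (integrableZl measurableT _ (integrable_orth _ _ oh)).
by rewrite !RintegralZl// ?eh ?mulr0 ?addr0//; exact: integrable_orth.
Qed.

Let orth_eq h k : orth h -> h =1 k -> orth k.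
Proof. by move=> oh /funext <-. Qed.

Let phase b n (x : R) := (1 - sin ((x - b) / n.+1%:R)) / 2.

Let phaseE b n x :
  phase b n x = 2^-1 - 2^-1 * cos (n.+1%:R^-1 * x + (- b / n.+1%:R - pi / 2)).
Proof.
have -> : n.+1%:R^-1 * x + (- b / n.+1%:R - pi / 2) = (x - b) / n.+1%:R - pi / 2.
  by field.
by rewrite cosB cos_pihalf sin_pihalf /phase mulr0 mulr1 add0r; lra.
Qed.

Let orth_phase b n h k : orth h -> orth (fun x => phase b n x ^+ k * h x).
Proof.
move=> oh; elim: k => [|k ih]; first by apply: orth_eq oh _ => x; rewrite mul1r.
apply: (orth_eq (orth_lin 2^-1 (- 2^-1) ih
  (orth_cos (n.+1%:R^-1) (- b / n.+1%:R - pi / 2) ih))) => x.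
by rewrite exprS; set Y := phase b n x ^+ k; rewrite phaseE; ring.
Qed.

(** The kernel is a polynomial in [phase], and [phase] is a constant minus a multiple of a
    cosine. *)
Lemma orth_step_kernel b n : orth (step_kernel b n).
Proof.
rewrite /step_kernel /bump; set k := (_ ^ 2)%N; set j := (2 ^ k)%N.
elim: j => [|j ih]; first by apply: orth_eq orth1 _ => x.
apply: (orth_eq (orth_lin 1 (-1) ih (orth_phase b n k ih))) => x.
by rewrite exprS -/(phase _ _ _); ring.
Qed.

(** Dominated convergence along [step_kernel b], with dominating function [|f|]; the point [b],
    where the limit is not the indicator, is a null set. *)
Lemma integral_ray_eq0 b : (\int[mu]_(x in `]b, +oo[) f x = 0)%R.
Proof.
pose fn n x := (f x * step_kernel b n x)%:E.
pose fl x := (f x * (b < x)%R%:R)%:E.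
have cn n : continuous (step_kernel b n) by have [] := orth_step_kernel b n.
have y01 n (x : R) : 0 <= (1 - sin ((x - b) / n.+1%:R)) / 2 <= 1.
  have := sin_geN1 ((x - b) / n.+1%:R); have := sin_le1 ((x - b) / n.+1%:R); lra.
have flE : fl = (EFin \o f) \_ `]b, +oo[.
  apply/funext => x; rewrite /fl /patch mem_setE in_itv/= andbT.
  by case: ifP; rewrite ?mulr1 ?mulr0.
have mfl : measurable_fun setT fl.
  rewrite flE; apply/(measurable_restrictT _ _).1 => //.
  by apply: measurable_funTS; exact: measurable_int fi.
have [] := @dominated_convergence _ _ R mu setT measurableT fn fl (fun x => `|f x|%:E).
- move=> n; apply/measurable_EFinP; apply: continuous_measurableS => //.
  by move=> x; apply: cvgM; [exact: cf|exact: cn].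
- exact: mfl.
- exists [set b]; split => //; first exact: lebesgue_measure_set1.
  move=> x /= h; apply: contrapT => /eqP xb; apply: h => _.
  apply: cvg_EFin; first exact: nearW.
  by apply: cvgM; [exact: cvg_cst|exact: step_kernel_cvg].
- exact: integrable_norm fi.
- apply: aeW => x n _; rewrite lee_fin normrM ler_piMr//.
  by have /andP[k0 k1] := bump_itv (n.+1 ^ 2) (y01 n x); rewrite ger0_norm.
move=> _ _ h.
have E n : (\int[mu]_(x in setT) fn n x = 0)%E.
  have [_ _ /(_ 0 0)] := orth_step_kernel b n.
  under eq_Rintegral do rewrite mul0r addr0 cos0 mulr1.
  rewrite /Rintegral => h0.
  rewrite -[LHS]fineK ?h0//; apply: integrable_fin_num => //.
  apply: (@integrable_mul (step_kernel b n) 1) => // x.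
  by have /andP[k0 k1] := bump_itv (n.+1 ^ 2) (y01 n x); rewrite ger0_norm.
have {h} := cvg_lim (@ereal_hausdorff R) h.
under eq_fun do rewrite E.
rewrite lim_cst//.
rewrite flE -integral_mkcond /Rintegral => <-//.
Qed.

(** Integrals over []x - 1, y]] are differences of ray integrals, hence 0; by continuity [f x] is
    their derivative at [y = x]. *)
Lemma fourier_inj x : f x = 0.
Proof.
have iray b : mu.-integrable `]b, +oo[ (EFin \o f) by exact: integrableS fi.
have Z y : x - 1 < y -> (\int[mu]_(t in `](x - 1)%R, y]) f t = 0)%R.
  move=> xy; have := @Rintegral_itvB _ f (BRight (x - 1)) +oo%O y (iray _).
  rewrite !integral_ray_eq0 bnd_simp => /(_ (ltW xy) isT).
  by move/eqP; rewrite sub0r oppr_eq0 => /eqP.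
have [] := @continuous_FTC1 _ f (BRight (x - 1)) x (x + 1) _ _ _ (@cf x).
- by rewrite ltrDl.
- by apply: integrableS fi.
- have h : x - 1 < x by rewrite ltrBlDr ltrDl.
  exact: h.
move=> dF <-; rewrite derive1E.
rewrite (@near_eq_derive _ _ _ _ (cst 0)) ?derive_cst//.
near=> y; apply: Z.
have : `|x - y| < 1 by near: y; apply: nbhsx_ballx.
by have := ler_norm (x - y); lra.
Unshelve. all: by end_near. Qed.

End FourierUniqueness.

(** * Identification of the window with the fundamental solution *)

Section Structure.
Variable R : realType.
Implicit Types (A B : R -> R) (ds : seq R).
Local Notation mu := (@lebesgue_measure R).
Local Notation C := R[i].

Lemma splice_continuous A B : continuous A -> continuous B -> A 0 = B 0 ->
  continuous (splice A B).
Proof.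
move=> cA cB AB.
(* The two arguments are the maximum and the minimum of [x] and 0, so the case distinction becomes a
   composition of continuous maps. *)
have -> : splice A B = (fun x : R => A ((x + `|x|) / 2) + B ((x - `|x|) / 2) - A 0).
  apply/funext => x; rewrite /splice; case: ltP => x0.
    rewrite ltr0_norm// subrr mul0r opprK.
    have -> : (x + x) / 2 = x by lra.
    by rewrite addrC addKr.
  rewrite ger0_norm// subrr mul0r -AB addrK.
  by congr A; lra.
have cn : continuous (fun x : R => `|x|) by exact: norm_continuous.
move=> x; apply: cvgD; last exact: cvg_cst; apply: cvgD.
- apply: (@continuous_comp _ _ _ (fun x : R => (x + `|x|) / 2) A); last exact: cA.
  apply: cvgM; last exact: cvg_cst.
  by apply: cvgD; [exact: cvg_id|exact: cn].
- apply: (@continuous_comp _ _ _ (fun x : R => (x - `|x|) / 2) B); last exact: cB.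
  apply: cvgM; last exact: cvg_cst.
  by apply: cvgB; [exact: cvg_id|exact: cn].
Qed.

Lemma fundamental_splice_continuous ds A B : nonzeros ds -> (1 < size ds)%N ->
  fundamental ds A B -> A 0 = B 0 /\ continuous (splice A B).
Proof.
move=> nz sz f; have [cA cB _ _] := fundamental_sides nz f.
have AB : A 0 = B 0.
  case: ds nz sz f => [//|d [|e ds]]//= /andP[d0 _] _ [_ _ /eqP].
  by rewrite mulf_eq0 (negPf d0) subr_eq0 => /eqP.
by split => //; exact: splice_continuous.
Qed.

Lemma complex_neq0_1i (y : R) : 1 + Complex 0 y != 0 :> C.
Proof. by rewrite eq_complex /= addr0 oner_eq0. Qed.

(** Both sides are continuous and integrable with equal transforms, so injectivity gives equality at
    every point, as needed for sampling. *)
Lemma tp_structure (g : R -> R) m C0 (delta : 'I_m -> R) : (2 <= m)%N ->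
  totally_positive_finite_type g C0 delta -> continuous g ->
  exists A B, fundamental (codom delta) A B /\ forall t, g t = C0 * splice A B t.
Proof.
move=> m2 [gi [C00 [d0 gF]]] cg.
have nz : nonzeros (codom delta) by apply/allP => _ /codomP[k ->].
have [A [B fAB]] := fundamental_exists nz.
exists A, B; split => // t.
have sz : (1 < size (codom delta))%N by rewrite size_codom card_ord.
have [AB cG] := fundamental_splice_continuous nz sz fAB.
have [cA cB dA dB] := fundamental_sides nz fAB.
have gi' : mu.-integrable setT (EFin \o g) by exact: gi.
have c1 : continuous (cst 1 : R -> R) by move=> x; exact: cvg_cst.
have n1 (x : R) : `|cst 1 x : R| <= 1 by rewrite normr1.
have Gi : mu.-integrable setT (EFin \o splice A B).
  have [+ _] := splice_integral cA cB c1 n1 dA dB.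
  by under [X in integrable _ _ (_ \o X)]eq_fun do rewrite mulr1.
have igc (h : R -> R) : continuous h -> (forall x, `|h x| <= 1) ->
    mu.-integrable setT (EFin \o (fun x => g x * h x)).
  move=> ch h1; apply: le_integrable gi' => //.
    apply/measurable_EFinP; apply: continuous_measurableS => //.
    by move=> x; apply: cvgM; [exact: cg|exact: ch].
  by move=> x _ /=; rewrite lee_fin normrM ler_piMr.
have key w : \int[mu]_x (g x * cos (w * x)) = C0 * Tc A B w /\
             \int[mu]_x (g x * sin (w * x)) = C0 * Ts A B w.
  have pi0 : 2 * pi != 0 :> R by rewrite gt_eqF// mulr_gt0// pi_gt0.
  have := gF (w / (2 * pi)).
  have Ef := fundamental_fourier w nz fAB.
  have E x : 2 * pi * x * (w / (2 * pi)) = w * x by rewrite mulrAC [_ * (w / _)]mulrC divfK.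
  rewrite /fourier.
  under eq_Rintegral do rewrite E.
  under [X in Complex _ (- X)]eq_Rintegral do rewrite E.
  have -> : \prod_(k < m) (1 + Complex 0 (2 * pi * delta k * (w / (2 * pi))))^-1 =
      Complex (Tc A B w) (- Ts A B w) :> C.
    rewrite prodfV.
    have -> : \prod_(k < m) (1 + Complex 0 (2 * pi * delta k * (w / (2 * pi)))) =
      \prod_(d <- codom delta) (1 + Complex 0 (d * w)) :> C.
      rewrite /codom /image_mem big_map big_enum/=; apply: eq_bigr => k _.
      by rewrite E mulrC.
    have p0 : \prod_(d <- codom delta) (1 + Complex 0 (d * w)) != 0 :> C.
      by rewrite prodf_seq_neq0; apply/allP => d _; apply/implyP => _; exact: complex_neq0_1i.
    apply: (mulIf p0); rewrite mulVf// Ef.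
    by case: (codom delta) sz.
  move=> /eqP; rewrite eq_complex /= => /andP[/eqP-> /eqP h].
  split; first by ring.
  by apply: oppr_inj; rewrite h; ring.
apply/eqP; rewrite -subr_eq0; apply/eqP.
have cGC : continuous (fun x : R => C0 * splice A B x).
  by move=> x; apply: cvgM; [exact: cvg_cst|exact: cG].
have fc : continuous (fun x : R => g x - C0 * splice A B x).
  by move=> x; apply: cvgB; [exact: cg|exact: cGC].
have fi : mu.-integrable setT (EFin \o (fun x => g x - C0 * splice A B x)).
  exact: (integrableB measurableT gi' (integrableZl measurableT C0 Gi)).
have z (h : R -> R) : continuous h -> (forall x, `|h x| <= 1) ->
    \int[mu]_x (g x * h x) = C0 * \int[mu]_x (splice A B x * h x) ->
    \int[mu]_x ((g x - C0 * splice A B x) * h x) = 0.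
  move=> ch h1 E.
  have [Gh _] := splice_integral cA cB ch h1 dA dB.
  transitivity (\int[mu]_x (g x * h x - C0 * (splice A B x * h x))).
    by apply: eq_Rintegral => x _; ring.
  rewrite RintegralB//.
  - by rewrite RintegralZl// E subrr.
  - exact: igc.
  - exact: (integrableZl measurableT C0 Gh).
apply: (fourier_inj fi fc) => w.
- by apply: z; [exact: cont_cosM|move=> x; exact: normr_cos_le1|exact: (key w).1].
- by apply: z; [exact: cont_sinM|move=> x; exact: normr_sin_le1|exact: (key w).2].
Qed.

End Structure.

(** * Sign changes and zeros under one operator [1 + d D] *)

Section SignChanges.
Variable R : realType.
Implicit Types (s u f : R -> R) (d x y : R) (n : nat) (b : bool).

(** [n] points, descending from [x], where [s] has strictly alternating signs; [b] is the sign at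
    the topmost one, [true] for negative. *)
Fixpoint alt s n b x : Prop :=
  if n is n'.+1 then exists y, [/\ y < x, 0 < (-1) ^+ b * s y & alt s n' (~~ b) y] else True.

(** [n] zeros below [x], each enclosed by points where [s] is nonzero. The [n + 1] separating points
    keep an interval of zeros from being counted more than once. *)
Fixpoint zer s n x : Prop :=
  exists y, [/\ y < x, s y != 0 &
    if n is n'.+1 then exists z, [/\ z < y, s z = 0 & zer s n' z] else True].

Lemma alt_le s n b x x' : x <= x' -> alt s n b x -> alt s n b x'.
Proof.
case: n => //= n xx' [y [yx sy a]]; exists y; split => //.
exact: lt_le_trans xx'.
Qed.

Lemma alt_drop s n b x : alt s n.+1 b x -> alt s n b x.
Proof.
elim: n b x => // n ih b x [y [yx sy a]]; exists y; split => //.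
exact: ih.
Qed.

Lemma zer_top s n x : zer s n x -> exists y, [/\ y < x, s y != 0 &
  if n is n'.+1 then exists z, [/\ z < y, s z = 0 & zer s n' z] else True].
Proof. by case: n. Qed.

Lemma signb (v : R) : v != 0 -> exists b, 0 < (-1) ^+ b * v.
Proof.
rewrite neq_lt => /orP[v0|v0]; first by exists true; rewrite expr1 mulN1r oppr_gt0.
by exists false; rewrite mul1r.
Qed.

Lemma signNb b (v : R) : (-1) ^+ (~~ b) * v = - ((-1) ^+ b * v).
Proof. by rewrite signrN mulNr. Qed.

Lemma signb_neq0 b (v : R) : 0 < (-1) ^+ b * v -> v != 0.
Proof. by apply: contraTneq => ->; rewrite mulr0 ltxx. Qed.

Lemma signb_opp b (v : R) : 0 < (-1) ^+ b * v -> 0 < (-1) ^+ (~~ b) * v -> False.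
Proof. by rewrite signNb; lra. Qed.

(** Cut the interval at an exceptional point: [u] increases over at least one of the two pieces. *)
Lemma mvt_knots u u' (K : seq R) (a b : R) : continuous u ->
  (forall x, a < x < b -> x \notin K -> is_derive x 1 u (u' x)) -> a < b -> u a < u b ->
  exists z, [/\ a < z, z < b & 0 < u' z].
Proof.
move=> cu; elim: K a b => [|k K ih] a b du ab uab.
  have dab x : x \in `]a, b[ -> is_derive x 1 u (u' x) by rewrite in_itv/= => /du; exact.
  have [|c] := @MVT R u u' a b ab dab; first exact: continuous_subspaceT.
  rewrite in_itv/= => /andP[ac cb] E; exists c; split => //.
  have : 0 < u' c * (b - a) by rewrite -E subr_gt0.
  by rewrite pmulr_lgt0// subr_gt0.
have [/andP[ak kb]|nk] := boolP (a < k < b); last first.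
  apply: ih => // x xab xK; apply: du => //; rewrite inE negb_or xK andbT.
  by apply: contraNneq nk => <-.
have [uk|uk] := ltP (u a) (u k).
  have [|//|//|z [az zk uz]] := ih a k; last by exists z; split => //; exact: lt_trans kb.
  move=> x /andP[ax xk] xK; apply: du; first by rewrite ax (lt_trans xk).
  by rewrite inE negb_or xK lt_eqF.
have [|//||z [kz zb uz]] := ih k b; last by exists z; split => //; exact: lt_trans kz.
  move=> x /andP[kx xb] xK; apply: du; first by rewrite xb (lt_trans ak).
  by rewrite inE negb_or xK gt_eqF.
exact: le_lt_trans uab.
Qed.

Section Step.
Variables (s s1 : R -> R) (d : R) (K : seq R) (S : R).
Hypothesis cs : continuous s.
Hypothesis bs : forall x, `|s x| <= S.
Hypothesis d0 : d != 0.
Hypothesis ds : forall x, x \notin K -> is_derive x 1 s ((s1 x - s x) / d).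

(** The integrating factor: [u] has the signs and zeros of [s], while off the knots its derivative
    has the sign of [s1 / d]. *)
Let u x := expR (d^-1 * x) * s x.

Let rise b x y : x < y -> (-1) ^+ b * u x < (-1) ^+ b * u y ->
  exists z, [/\ x < z, z < y & 0 < (-1) ^+ b * (s1 z / d)].
Proof.
move=> xy uxy.
pose v z := (-1) ^+ b * (expR (d^-1 * z) * s z).
have dv (z : R) : z \notin K -> is_derive z 1 v (expR (d^-1 * z) * ((-1) ^+ b * (s1 z / d))).
  move=> zK; apply: is_derive_eq (is_derive_expMA _ d^-1 (ds zK)) _.
  by field.
have cv : continuous v.
  move=> z; apply: cvgM; first exact: cvg_cst.
  apply: cvgM; last exact: cs.
  exact: is_derive_continuous (is_derive_expM _ _).
have [z [xz zy vz]] := mvt_knots cv (fun z _ => dv z) xy uxy.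
by exists z; split => //; rewrite pmulr_rgt0// expR_gt0 in vz.
Qed.

Let fall b x y : x < y -> (-1) ^+ b * u y < (-1) ^+ b * u x ->
  exists z, [/\ x < z, z < y & 0 < (-1) ^+ (~~ b) * (s1 z / d)].
Proof. by move=> xy uxy; apply: rise => //; rewrite !signNb ltrN2. Qed.

Let u_sign b x : (0 < (-1) ^+ b * u x) = (0 < (-1) ^+ b * s x).
Proof. by rewrite mulrCA pmulr_rgt0// expR_gt0. Qed.

Let u_zero b z : s z = 0 -> (-1) ^+ b * u z = 0.
Proof. by rewrite /u => ->; rewrite !mulr0. Qed.

(* [u] is bounded by [S e^(x/d)], which vanishes at the end where [x/d -> -oo]. *)
Let u_small (e : R) : 0 < e -> exists X, forall x, d^-1 * x < X -> forall b, (-1) ^+ b * u x < e.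
Proof.
move=> e0; have S0 : 0 <= S by exact: le_trans (normr_ge0 _) (bs 0).
exists (ln (e / (S + 1))) => x xX b.
apply: le_lt_trans (ler_norm _) _; rewrite !normrM normr_sign mul1r.
have eS : 0 < e / (S + 1) by rewrite divr_gt0// ltr_wpDl.
rewrite gtr0_norm ?expR_gt0//.
have : expR (d^-1 * x) < e / (S + 1) by rewrite -[ltRHS]lnK ?posrE// ltr_expR.
rewrite ltr_pdivlMr ?ltr_wpDl//; apply: le_lt_trans.
by rewrite ler_wpM2l ?expR_ge0// (le_trans (bs x))// lerDl.
Qed.

Let sgd b z : 0 < d -> 0 < (-1) ^+ b * (s1 z / d) -> 0 < (-1) ^+ b * s1 z.
Proof. by move=> dp; rewrite mulrA pmulr_lgt0// invr_gt0. Qed.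

Let sgdN b z : d < 0 -> 0 < (-1) ^+ b * (s1 z / d) -> 0 < (-1) ^+ (~~ b) * s1 z.
Proof.
move=> dn; rewrite signNb mulrA => h.
have : (-1) ^+ b * s1 z / d * d < 0 by rewrite nmulr_llt0.
by rewrite divfK// oppr_gt0.
Qed.

(** For [d > 0] the function [u] tends to 0 at minus infinity, which acts as one more zero, and
    zeros arbitrarily far right ([e]) supply another. Between zeros [u] leaves 0 and returns, so
    [s1] takes both signs. *)
Lemma zer_alt_pos n x (e : bool) : 0 < d -> (e -> forall y, exists2 v, y < v & s v = 0) ->
  zer s n x -> exists b x', alt s1 (n.+1 + e) b x'.
Proof.
move=> dp zr.
have P m y b : 0 < (-1) ^+ b * s y ->
    (if m is m'.+1 then exists z, [/\ z < y, s z = 0 & zer s m' z] else True) ->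
    alt s1 m.+1 b y.
  elim: m y b => [|m ih] y b sy.
    move=> _; have := sy; rewrite -u_sign => /u_small[X hX].
    (* A point left of [y], so far out that [u] is smaller there than at [y]; it plays the zero at
       minus infinity. *)
    pose w := Num.min (d * (X - 1)) (y - 1).
    have wy : w < y by rewrite /w gt_min; apply/orP; right; lra.
    have wX : d^-1 * w < X.
      rewrite mulrC ltr_pdivrMr// mulrC; apply: le_lt_trans (_ : d * (X - 1) < _).
        by rewrite /w ge_min lexx.
      by rewrite ltr_pM2l//; lra.
    have [z [wz zy /(sgd dp) sz]] := rise wy (hX _ wX b).
    by exists z.
  move=> [z0 [z0y sz0 z]].
  have [l [z0l ly /(sgd dp) sl]] : exists l, [/\ z0 < l, l < y & 0 < (-1) ^+ b * (s1 l / d)].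
    by apply: rise => //; rewrite u_zero// u_sign.
  have [y' [y'z0 sy' rest]] := zer_top z.
  have [b' sb'] := signb sy'.
  have A := ih _ _ sb' rest.
  (* If [s] changes sign across [z0], the point [l] continues the alternation. If not, [u] also
     returns to 0 between [y'] and [z0], which gives a point [r] of opposite sign and one
     alternation more than claimed. *)
  have [bb|bb] := eqVneq b' b; last first.
    have {}bb : b' = ~~ b by move: bb; case: (b); case: (b').
    by rewrite bb in A; exists l; split => //; apply: alt_le A; rewrite ltW// (lt_trans y'z0).
  rewrite bb in A sb'; have [r [y'r rz0 /(sgd dp) sr]] : exists r, [/\ y' < r, r < z0 & 0 < (-1) ^+ (~~ b) * (s1 r / d)]
    by apply: fall => //; rewrite u_zero// u_sign.
  apply: alt_drop; exists l; split => //; exists r; split => //; [exact: lt_trans z0l|].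
  by rewrite negbK; apply: alt_le A; exact: ltW.
move=> zx.
have [y [b [sy rest]]] : exists y b, 0 < (-1) ^+ b * s y /\
    (if n is m'.+1 then exists z, [/\ z < y, s z = 0 & zer s m' z] else True).
  by have [y [_ sy rest]] := zer_top zx; have [b sb] := signb sy; exists y, b.
have A := P _ _ _ sy rest.
case: e zr => zr; last by exists b, y; rewrite addn0.
have [v yv sv] := zr isT y.
have [r [yr rv /(sgd dp) sr]] : exists r, [/\ y < r, r < v & 0 < (-1) ^+ (~~ b) * (s1 r / d)].
  by apply: fall => //; rewrite u_zero// u_sign.
exists (~~ b), v; rewrite addn1; exists r; split => //.
by rewrite negbK; apply: alt_le A; exact: ltW.
Qed.

(** Now [u] tends to 0 at plus infinity. As alternations are listed from the top, the induction
    carries a point [w] above [y] where [u] is smaller than at [y]; the extra zeros [e] enter at the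
    bottom. *)
Lemma zer_alt_neg n x (e : bool) : d < 0 -> (e -> forall y, exists2 v, v < y & s v = 0) ->
  zer s n x -> exists b x', alt s1 (n.+1 + e) b x'.
Proof.
move=> dn zl.
have P m y b w : 0 < (-1) ^+ b * s y -> y < w -> (-1) ^+ b * u w < (-1) ^+ b * u y ->
    (if m is m'.+1 then exists z, [/\ z < y, s z = 0 & zer s m' z] else True) ->
    alt s1 (m.+1 + e) b w.
  elim: m y b w => [|m ih] y b w sy yw uw.
    move=> _; have [r [yr rw /(sgdN dn)]] := fall yw uw; rewrite negbK => sr.
    exists r; split => //; case: e zl => // zl.
    have [v vy sv] := zl isT y.
    have [l [vl ly /(sgdN dn) sl]] : exists l, [/\ v < l, l < y & 0 < (-1) ^+ b * (s1 l / d)].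
      by apply: rise => //; rewrite u_zero// u_sign.
    by exists l; split => //; exact: lt_trans yr.
  move=> [z0 [z0y sz0 z]].
  have [r [yr rw /(sgdN dn)]] := fall yw uw; rewrite negbK => sr.
  have [y' [y'z0 sy' rest]] := zer_top z.
  have [b' sb'] := signb sy'.
  have A : alt s1 (m.+1 + e) b' z0 by apply: (ih y' b' z0 sb' y'z0 _ rest); rewrite u_zero// u_sign.
  have [bb|bb] := eqVneq b' b; last first.
    have {}bb : b' = ~~ b by move: bb; case: (b); case: (b').
    by rewrite bb in A; exists r; split => //; apply: alt_le A; rewrite ltW// (lt_trans z0y).
  rewrite bb in A; have [l [z0l ly /(sgdN dn) sl]] : exists l, [/\ z0 < l, l < y & 0 < (-1) ^+ b * (s1 l / d)]
    by apply: rise => //; rewrite u_zero// u_sign.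
  apply: alt_drop; exists r; split => //; exists l; split => //; [exact: lt_trans yr|].
  by rewrite negbK; apply: alt_le A; exact: ltW.
move=> zx.
have [y [b [sy rest]]] : exists y b, 0 < (-1) ^+ b * s y /\
    (if n is m'.+1 then exists z, [/\ z < y, s z = 0 & zer s m' z] else True).
  by have [y [_ sy rest]] := zer_top zx; have [b sb] := signb sy; exists y, b.
have := sy; rewrite -u_sign => /u_small[X hX].
pose w := Num.max (d * (X - 1)) (y + 1).
have yw : y < w by rewrite /w lt_max; apply/orP; right; lra.
have wX : d^-1 * w < X.
  rewrite mulrC ltr_ndivrMr// mulrC; apply: lt_le_trans (_ : d * (X - 1) <= _).
    by rewrite ltr_nM2l//; lra.
  by rewrite /w le_max lexx.
by exists b, w; exact: P sy yw (hX _ wX b) rest.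
Qed.

End Step.

Lemma alt_zer s n b x : continuous s -> alt s n.+1 b x -> zer s n x.
Proof.
move=> cs; elim: n b x => [|n ih] b x.
  by move=> [y [yx sy _]]; exists y; split => //; exact: signb_neq0 sy.
move=> [y [yx sy [y' [y'y sy' a]]]].
have : exists2 z, z \in `[y', y] & s z = 0.
  apply: IVT; [exact: ltW|exact: continuous_subspaceT|].
  move: sy sy'; rewrite signNb ge_min le_max.
  by case: b {a} => /=; rewrite ?expr1 ?expr0 ?mulN1r ?mul1r => h1 h2; apply/andP; split; apply/orP; lra.
move=> [z]; rewrite in_itv/= => /andP[y'z zy] sz.
have sy'0 := signb_neq0 sy'; have sy0 := signb_neq0 sy.
have y'z' : y' < z by rewrite lt_neqAle y'z andbT; apply: contra_neq sy'0 => ->.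
have zy' : z < y by rewrite lt_neqAle zy andbT; apply: contra_neq sy0 => <-.
exists y; split => //; exists z; split => //.
by apply: (ih (~~ b)); exists y'.
Qed.

(** The sign depends on [J] alone, so the monotone [J] must change its value between any two
    alternating points; all these values lie between [lo] and [hi]. *)
Lemma alt_steps f (J : R -> nat) (lo hi : nat) n b x :
  {homo J : x y / x <= y >-> (x <= y)%N} ->
  (forall y y' (c : bool), J y = J y' -> 0 < (-1) ^+ c * f y -> 0 < (-1) ^+ c * f y') ->
  (forall y, f y != 0 -> (lo <= J y <= hi)%N) ->
  alt f n.+1 b x -> (n + lo <= hi)%N.
Proof.
move=> Jm Jf Jb.
have P m y (c : bool) : 0 < (-1) ^+ c * f y -> alt f m (~~ c) y -> (m + lo <= J y)%N.
  elim: m y c => [|m ih] y c fy.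
    by have /andP[] := Jb _ (signb_neq0 fy).
  move=> [y' [y'y fy' a]].
  have h := ih _ _ fy' a.
  rewrite addSn ltn_neqAle (leq_trans h (Jm _ _ (ltW y'y))) andbT.
  apply/eqP => E.
  have EJ : J y' = J y by apply/eqP; rewrite eqn_leq (Jm _ _ (ltW y'y))/= -E.
  exact: signb_opp fy (Jf _ _ _ EJ fy').
move=> [y [_ fy a]].
have /andP[_] := Jb _ (signb_neq0 fy).
exact: leq_trans (P _ _ _ fy a).
Qed.

End SignChanges.

(** * Exponential splines and the case of a single factor *)

Section Splines.
Variable R : realType.
Implicit Types (A B : R -> R) (ds : seq R) (c : nat -> R) (d x y kap : R) (n N : nat) (b : bool).
Variable h : R.
Hypothesis h0 : 0 < h.

Definition grid kap (k : nat) : R := kap + k%:R * h.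

Definition exp_spline A B N c kap x := \sum_(k < N) c k * splice A B (x - grid kap k).

Lemma le_knot kap k l : (grid kap k <= grid kap l) = (k <= l)%N.
Proof. by rewrite /grid lerD2l ler_pM2r// ler_nat. Qed.

Lemma lt_knot kap k l : (grid kap k < grid kap l) = (k < l)%N.
Proof. by rewrite /grid ltrD2l ltr_pM2r// ltr_nat. Qed.

Lemma splice_is_derive A B A1 B1 d : (forall x, is_derive x 1 A ((A1 x - A x) / d)) ->
  (forall x, is_derive x 1 B ((B1 x - B x) / d)) -> forall x, x != 0 ->
  is_derive x 1 (splice A B) ((splice A1 B1 x - splice A B x) / d).
Proof.
move=> dA dB x; rewrite neq_lt => /orP[x0|x0].
  rewrite {2 3}/splice x0; apply: near_eq_is_derive (dB x).
  near=> y; rewrite /splice ifT//; near: y.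
  exact: lt_nbhsl.
rewrite {2 3}/splice ltNge (ltW x0)/=; apply: near_eq_is_derive (dA x).
near=> y; rewrite /splice ifF//; apply/negbTE; rewrite -leNgt; apply: ltW; near: y.
exact: lt_nbhsr.
Unshelve. all: by end_near. Qed.

Lemma spline_is_derive A B A1 B1 d N c kap : (forall x, is_derive x 1 A ((A1 x - A x) / d)) ->
  (forall x, is_derive x 1 B ((B1 x - B x) / d)) ->
  forall x, x \notin [seq grid kap k | k <- iota 0 N] ->
  is_derive x 1 (exp_spline A B N c kap) ((exp_spline A1 B1 N c kap x - exp_spline A B N c kap x) / d).
Proof.
move=> dA dB x; elim: N => [|N ih] xK.
  have -> : exp_spline A B 0 c kap = fun=> 0 by apply/funext => y; rewrite /exp_spline big_ord0.
  by rewrite /exp_spline !big_ord0 subrr mul0r; exact: is_derive_cst.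
have E A' B' y : exp_spline A' B' N.+1 c kap y =
    1 * exp_spline A' B' N c kap y + c N * splice A' B' (y - grid kap N).
  by rewrite /exp_spline big_ord_recr/= mul1r.
have -> : exp_spline A B N.+1 c kap = (fun y => 1 * exp_spline A B N c kap y + c N * splice A B (y - grid kap N)).
  by apply/funext => y; rewrite E.
have xN : x - grid kap N != 0.
  rewrite subr_eq0; apply: contraNneq xK => ->; apply: map_f.
  by rewrite mem_iota add0n leq0n ltnSn.
have xK' : x \notin [seq grid kap k | k <- iota 0 N].
  by apply: contra xK => /mapP[k]; rewrite mem_iota => /andP[_ kN] ->; apply: map_f; rewrite mem_iota; lia.
have hs : is_derive x 1 (fun y => splice A B (y - grid kap N))
    ((splice A1 B1 (x - grid kap N) - splice A B (x - grid kap N)) / d).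
  have := @is_derive_affine _ (splice A B) 1 x (- grid kap N)
    ((splice A1 B1 (x - grid kap N) - splice A B (x - grid kap N)) / d).
  rewrite !mul1r => /(_ (splice_is_derive dA dB xN)).
  by under eq_fun do rewrite mul1r.
apply: is_derive_eq (is_derive_lin 1 (c N) (ih xK') hs) _.
rewrite !E; ring.
Qed.

Lemma spline_continuous A B N c kap : continuous (splice A B) -> continuous (exp_spline A B N c kap).
Proof.
move=> cG; elim: N => [|N ih].
  have -> : exp_spline A B 0 c kap = fun=> 0 by apply/funext => y; rewrite /exp_spline big_ord0.
  by move=> x; exact: cvg_cst.
have -> : exp_spline A B N.+1 c kap = (fun y => exp_spline A B N c kap y + c N * splice A B (y - grid kap N)).
  by apply/funext => y; rewrite /exp_spline big_ord_recr.
move=> x; apply: cvgD; first exact: ih.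
apply: cvgM; first exact: cvg_cst.
apply: (@continuous_comp _ _ _ (fun y : R => y - grid kap N) (splice A B)); last exact: cG.
by apply: cvgB; [exact: cvg_id|exact: cvg_cst].
Qed.

Lemma splice_bounded A B : sides A B -> exists S : R, forall x, `|splice A B x| <= S.
Proof.
move=> [_ _ [c1 [C1 [c10 C10 hA]]] [c2 [C2 [c20 C20 hB]]]].
exists (C1 + C2) => x; rewrite /splice; case: ltP => x0.
  have := hB (- x); rewrite oppr_ge0 /= opprK => /(_ (ltW x0)) h1.
  apply: le_trans h1 _; apply: le_trans (_ : C2 <= _); last by rewrite lerDr ltW.
  by rewrite ler_piMr ?(ltW C20)// -expR0 ler_expR mulrN opprK pmulr_rle0// ltW.
apply: le_trans (hA _ x0) _; apply: le_trans (_ : C1 <= _); last by rewrite lerDl ltW.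
by rewrite ler_piMr ?(ltW C10)// -expR0 ler_expR oppr_le0 mulr_ge0// ltW.
Qed.

Lemma spline_bounded A B N c kap : sides A B -> exists S : R, forall x, `|exp_spline A B N c kap x| <= S.
Proof.
move=> /splice_bounded[S hS]; exists (\sum_(k < N) `|c k| * S) => x.
apply: le_trans (ler_norm_sum _ _ _) _; apply: ler_sum => k _.
by rewrite normrM ler_wpM2l.
Qed.

Lemma knot_count kap N : exists J : R -> nat,
  forall x, (J x <= N)%N /\ forall k, (k < N)%N -> (grid kap k <= x) = (k < J x)%N.
Proof.
suff /choice[J hJ] : forall x, exists j, (j <= N)%N /\ forall k, (k < N)%N -> (grid kap k <= x) = (k < j)%N.
  by exists J.
move=> x; elim: N => [|N [j [jN hj]]]; first by exists 0%N.
have [Nx|xN] := leP (grid kap N) x.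
  exists N.+1; split => // k kN; rewrite kN.
  by apply: le_trans Nx; rewrite le_knot.
exists j; split; first exact: leqW.
move=> k; rewrite ltnS leq_eqVlt => /orP[/eqP->|]; last exact: hj.
by rewrite leNgt xN ltnNge jN.
Qed.

Lemma knot_count_homo kap N (J : R -> nat) :
  (forall x, (J x <= N)%N /\ forall k, (k < N)%N -> (grid kap k <= x) = (k < J x)%N) ->
  {homo J : x y / x <= y >-> (x <= y)%N}.
Proof.
move=> hJ x y xy; rewrite leqNgt; apply/negP => Jyx.
have [Jx ex] := hJ x; have [_ ey] := hJ y.
have kN : (J y < N)%N by exact: leq_trans Jyx Jx.
have : grid kap (J y) <= y by apply: le_trans xy; rewrite ex.
by rewrite ey// ltnn.
Qed.

Section Order1.
Variables (d : R) (A B : R -> R) (N : nat) (c : nat -> R) (kap : R).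
Hypothesis d0 : d != 0.
Hypothesis fAB : fundamental [:: d] A B.
Variable J : R -> nat.
Hypothesis hJ : forall x, (J x <= N)%N /\ forall k, (k < N)%N -> (grid kap k <= x) = (k < J x)%N.

(** The constant value of [d e^(x/d)] times the spline on the piece with [j] knots at or below [x].
    For [d > 0] only the knots already passed contribute, for [d < 0] only those still ahead, with
    the minus sign of the jump. *)
Let W (j : nat) := if 0 < d then \sum_(k < N | (k < j)%N) c k * expR (grid kap k / d)
         else - \sum_(k < N | (j <= k)%N) c k * expR (grid kap k / d).

Let splineE x : exp_spline A B N c kap x = expR (- (x / d)) / d * W (J x).
Proof.
have [_ hk] := hJ x.
have [kA kB jump [A1 [B1 [dA dB [A10 B10]]]]] := fAB.
have eA := ode_hom d0 (_ : forall x, is_derive x 1 A (- A x / d)).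
have {}eA : forall x, A x = A 0 * expR (- (x / d)).
  by apply: eA => y; have := dA y; rewrite A10 sub0r.
have eB := ode_hom d0 (_ : forall x, is_derive x 1 B (- B x / d)).
have {}eB : forall x, B x = B 0 * expR (- (x / d)).
  by apply: eB => y; have := dB y; rewrite B10 sub0r.
have ex k : expR (- ((x - grid kap k) / d)) = expR (- (x / d)) * expR (grid kap k / d).
  by rewrite -expRD mulrBl opprB addrC.
have lt k : (k < N)%N -> (x - grid kap k < 0) = ~~ (k < J x)%N.
  by move=> kN; rewrite subr_lt0 ltNge hk.
rewrite /W /exp_spline; have [dp|dn] := ltP 0 d.
  have B0 y : B y = 0 by move: kB; rewrite /neg /= ltNge (ltW dp).
  have A0 : A 0 = d^-1.
    by move: jump; rewrite B0 subr0 eqxx => /(canRL (mulKf d0)); rewrite mulr1.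
  rewrite [in RHS]big_mkcond/= mulr_sumr; apply: eq_bigr => k _.
  rewrite /splice lt//; case: ifP => kJ; first by rewrite B0 !mulr0 ifN// mulr0.
  by move/negbFE : kJ => ->; rewrite eA A0 ex; ring.
have A0 y : A y = 0 by move: kA; rewrite /pos /= ltNge dn.
have B0 : B 0 = - d^-1.
  move: jump; rewrite A0 sub0r eqxx => /(canRL (mulKf d0)); rewrite mulr1.
  by move/(canRL opprK).
rewrite [in RHS]big_mkcond/= mulrN -mulNr mulr_sumr; apply: eq_bigr => k _.
rewrite /splice lt// -leqNgt; case: ifP => kJ; last by rewrite A0 !mulr0.
by rewrite eB B0 ex; ring.
Qed.

(** The sign is constant on each of the [N + 1] pieces. The leftmost piece ([d > 0]) or the
    rightmost one ([d < 0]) is zero, and [eR], respectively [eL], makes the piece at the other end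
    zero as well. *)
Lemma order1_alt_bound (eL eR : bool) n b x :
  (eL -> exists X, forall x, x < X -> exp_spline A B N c kap x = 0) ->
  (eR -> exists X, forall x, X < x -> exp_spline A B N c kap x = 0) ->
  alt (exp_spline A B N c kap) n.+1 b x ->
  (n.+1 + eR * size (pos [:: d]) + eL * size (neg [:: d]) <= N)%N.
Proof.
move=> hL hR a.
have e0 y : expR (- (y / d)) / d != 0 by rewrite mulf_neq0 ?invr_neq0// gt_eqF ?expR_gt0.
have JN y : (J y <= N)%N by have [] := hJ y.
have sW y : exp_spline A B N c kap y = 0 -> W (J y) = 0.
  by rewrite splineE => /eqP; rewrite mulf_eq0 (negPf (e0 y))/= => /eqP.
have WR : eR -> W N = 0.
  move=> /hR[X hX]; have -> : N = J (Num.max X (grid kap N) + 1).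
    set y := _ + 1; apply/eqP; rewrite eqn_leq JN andbT leqNgt; apply/negP => JyN.
    have [_ /(_ _ JyN)] := hJ y; rewrite ltnn => /negbT; rewrite -ltNge => yk.
    have : grid kap (J y) < y.
      apply: lt_le_trans (_ : grid kap N <= _); first by rewrite lt_knot.
      have : grid kap N <= Num.max X (grid kap N) by rewrite le_max lexx orbT.
      by rewrite /y; lra.
    by move: yk; lra.
  apply: sW; apply: hX; have : X <= Num.max X (grid kap N) by rewrite le_max lexx.
  by lra.
have WL : eL -> W 0 = 0.
  move=> /hL[X hX]; have -> : 0%N = J (Num.min X (grid kap 0) - 1).
    set y := _ - 1; apply/eqP; rewrite eqn_leq leq0n leqNgt; apply/negP => Jy0.
    have N0 : (0 < N)%N by exact: leq_trans Jy0 (JN _).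
    have [_ /(_ _ N0)] := hJ y; rewrite Jy0 => yk.
    have : Num.min X (grid kap 0) <= grid kap 0 by rewrite ge_min lexx orbT.
    by move: yk; rewrite /y; lra.
  apply: sW; apply: hX; have : Num.min X (grid kap 0) <= X by rewrite ge_min lexx.
  by lra.
have Jf y y' (e : bool) : J y = J y' -> 0 < (-1) ^+ e * exp_spline A B N c kap y ->
    0 < (-1) ^+ e * exp_spline A B N c kap y'.
  move=> E; rewrite !splineE -E !mulrA !(mulrC ((-1) ^+ e)) -!mulrA.
  by rewrite (pmulr_rgt0 _ (expR_gt0 _)) (pmulr_rgt0 _ (expR_gt0 (- (y' / d)))). 
have nz j y : exp_spline A B N c kap y != 0 -> W j = 0 -> J y != j.
  by move=> + Wj; apply: contra_neq => E; rewrite splineE E Wj mulr0.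
have Jm := knot_count_homo hJ.
have [dp|dn] := ltP 0 d.
  have W0 : W 0 = 0 by rewrite /W dp big1// => k; rewrite ltn0.
  have := @alt_steps _ _ J 1 (N - eR) n b x Jm Jf _ a.
  rewrite /pos /neg /= dp ltNge (ltW dp)/= muln0 muln1 addn0.
  have N1 : (eR <= N)%N.
    by case: a => y [_ /signb_neq0 sy _]; have := nz _ _ sy W0; have := JN y; case: (eR) => //; lia.
  move=> H; have : (n + 1 <= N - eR)%N; last by lia.
  apply: H => y sy; have h1 := nz _ _ sy W0; rewrite lt0n h1/=.
  case: eR WR {hR N1} => [/(_ isT) WN|_]; last by rewrite subn0 JN.
  by have := nz _ _ sy WN; have := JN y; lia.
have dn' : d < 0 by rewrite lt_neqAle d0.
have WN : W N = 0 by rewrite /W ltNge dn/= big1 ?oppr0// => k; rewrite leqNgt ltn_ord.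
have := @alt_steps _ _ J eL N.-1 n b x Jm Jf _ a.
rewrite /pos /neg /= dn' ltNge dn/= muln0 muln1 addn0.
move=> H; have Hy y : exp_spline A B N c kap y != 0 -> (eL <= J y <= N.-1)%N.
  move=> sy; have := nz _ _ sy WN; have := JN y => h1 h2.
  have : (eL <= J y)%N.
    case: eL WL {hL H} => [/(_ isT) W0|//]; by have := nz _ _ sy W0; lia.
  by lia.
have := H Hy.
have : (0 < N)%N.
  by case: a => y [_ /signb_neq0 sy _]; have := nz _ _ sy WN; have := JN y; lia.
lia.
Qed.

End Order1.

End Splines.

(** * Bounds on the zeros of exponential splines *)

Section Interpolation.
Variable R : realType.
Implicit Types (A B : R -> R) (ds : seq R) (c : nat -> R) (d x y kap : R) (n N : nat) (b : bool).
Variable h : R.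
Hypothesis h0 : 0 < h.
Local Notation knot := (grid h).
Local Notation spline := (exp_spline h).

Definition vanishes_left (s : R -> R) := exists X, forall x, x < X -> s x = 0.
Definition vanishes_right (s : R -> R) := exists X, forall x, X < x -> s x = 0.

Section BoundStep.
Variables (d : R) (ds : seq R) (N : nat) (c : nat -> R) (kap : R) (eL eR : bool).
Hypothesis nz : nonzeros (d :: ds).
Hypothesis dsn : ds != [::].
Hypothesis ih : forall A B n b x, fundamental ds A B ->
  (eL -> vanishes_left (spline A B N c kap)) ->
  (eR -> vanishes_right (spline A B N c kap)) ->
  alt (spline A B N c kap) n.+1 b x ->
  (n.+1 + eR * size (pos ds) + eL * size (neg ds) <= N)%N.

(** From [n] zeros the next spline gets [n + 1] alternations, and one more if the spline vanishes on
    the side belonging to the sign of [d]. This extra alternation is the unit by which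
    [eR * size (pos _)] or [eL * size (neg _)] grows. *)
Lemma zer_bound_step A B n x : fundamental (d :: ds) A B ->
  (eL -> vanishes_left (spline A B N c kap)) ->
  (eR -> vanishes_right (spline A B N c kap)) ->
  zer (spline A B N c kap) n x ->
  (n.+1 + eR * size (pos (d :: ds)) + eL * size (neg (d :: ds)) <= N)%N.
Proof.
move=> f hL hR Z.
have d0 : d != 0 by case/andP: nz.
have sz : (1 < size (d :: ds))%N by case: (ds) dsn.
have [_ cG] := fundamental_splice_continuous nz sz f.
have sAB := fundamental_sides nz f.
have [_ _ _ [A1 [B1 [dA dB f1]]]] := f.
have cs := @spline_continuous R h A B N c kap cG.
have [S bs] := @spline_bounded R h A B N c kap sAB.
have der := @spline_is_derive R h h0 A B A1 B1 d N c kap dA dB.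
(* Off the knots, [s = 0] near a point gives [s1 = s + d s' = 0] there, so vanishing ends pass to
   the next spline. *)
have s1_0 y l r : l < y -> y < r -> (forall t, l < t < r -> spline A B N c kap t = 0) ->
    y \notin [seq knot kap k | k <- iota 0 N] -> spline A1 B1 N c kap y = 0.
  move=> ly yr hs yK; have dy := der _ yK.
  have dy0 : is_derive y 1 (spline A B N c kap) 0.
    apply: near_eq_is_derive (is_derive_cst 0 y 1).
    near=> t; rewrite hs//; apply/andP; split; near: t; [exact: lt_nbhsr|exact: lt_nbhsl].
  have := @derive_val _ _ _ _ _ _ _ dy.
  rewrite (@derive_val _ _ _ _ _ _ _ dy0) hs ?ly// subr0 => /esym/eqP.
  by rewrite mulf_eq0 invr_eq0 (negPf d0) orbF => /eqP.
have hL1 : eL -> vanishes_left (spline A1 B1 N c kap).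
  move=> /hL[X hX]; exists (Num.min X (knot kap 0)) => y; rewrite lt_min => /andP[yX yk].
  apply: (s1_0 y (y - 1) X) => //; first by lra.
    by move=> t /andP[_]; exact: hX.
  by apply/mapP => -[k _ E]; move: yk; rewrite E lt_knot.
have hR1 : eR -> vanishes_right (spline A1 B1 N c kap).
  move=> /hR[X hX]; exists (Num.max X (knot kap N)) => y; rewrite gt_max => /andP[yX yk].
  apply: (s1_0 y X (y + 1)) => //; first by lra.
    by move=> t /andP[+ _]; exact: hX.
  by apply/mapP => -[k]; rewrite mem_iota => /andP[_ kN] E; move: yk; rewrite E lt_knot//; lia.
have [dp|dn] := ltP 0 d.
  have zr : eR -> forall y, exists2 v, y < v & spline A B N c kap v = 0.
    move=> /hR[X hX] y; exists (Num.max X y + 1).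
      by rewrite (@le_lt_trans _ _ (Num.max X y)) ?le_max ?lexx ?orbT ?ltrDl.
    by apply: hX; rewrite (@le_lt_trans _ _ (Num.max X y)) ?le_max ?lexx ?ltrDl.
  have [b' [x' a1]] := zer_alt_pos cs bs d0 der dp zr Z.
  rewrite addSn in a1.
  have := ih f1 hL1 hR1 a1.
  rewrite /pos /neg /= dp ltNge (ltW dp)/= -/(pos ds) -/(neg ds); case: (eR); lia.
have dn' : d < 0 by rewrite lt_neqAle d0.
have zl : eL -> forall y, exists2 v, v < y & spline A B N c kap v = 0.
  move=> /hL[X hX] y; exists (Num.min X y - 1).
    by rewrite (@lt_le_trans _ _ (Num.min X y)) ?ge_min ?lexx ?orbT ?ltrBlDr ?ltrDl.
  by apply: hX; rewrite (@lt_le_trans _ _ (Num.min X y)) ?ge_min ?lexx ?ltrBlDr ?ltrDl.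
have [b' [x' a1]] := zer_alt_neg cs bs d0 der dn' zl Z.
rewrite addSn in a1.
have := ih f1 hL1 hR1 a1.
rewrite /pos /neg /= dn' ltNge dn/= -/(pos ds) -/(neg ds); case: (eL); lia.
Unshelve. all: by end_near. Qed.

End BoundStep.

Lemma spline_alt_bound ds A B N c kap (eL eR : bool) n b x :
  nonzeros ds -> ds != [::] -> fundamental ds A B ->
  (eL -> vanishes_left (spline A B N c kap)) ->
  (eR -> vanishes_right (spline A B N c kap)) ->
  alt (spline A B N c kap) n.+1 b x ->
  (n.+1 + eR * size (pos ds) + eL * size (neg ds) <= N)%N.
Proof.
elim: ds A B n b x => [//|d ds ih] A B n b x nz _ f hL hR a.
have /andP[d0 nzd] := nz.
have [dse|dsn] := eqVneq ds [::].
  have [J hJ] := knot_count h0 kap N.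
  by rewrite dse in f *; exact: (order1_alt_bound h0 d0 f hJ hL hR a).
have sz : (1 < size (d :: ds))%N by case: (ds) dsn.
have [_ cG] := fundamental_splice_continuous nz sz f.
have cs := @spline_continuous R h A B N c kap cG.
apply: (zer_bound_step nz dsn _ f hL hR (alt_zer cs a)) => A' B' n' b' x' f'.
exact: ih.
Qed.

Lemma spline_zer_bound ds A B N c kap (eL eR : bool) n x :
  nonzeros ds -> (1 < size ds)%N -> fundamental ds A B ->
  (eL -> vanishes_left (spline A B N c kap)) ->
  (eR -> vanishes_right (spline A B N c kap)) ->
  zer (spline A B N c kap) n x ->
  (n.+1 + eR * size (pos ds) + eL * size (neg ds) <= N)%N.
Proof.
case: ds => [//|d ds] nz sz f hL hR Z.
have dsn : ds != [::] by case: (ds) sz.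
apply: (zer_bound_step nz dsn _ f hL hR Z) => A' B' n' b' x' f'.
by apply: spline_alt_bound => //; case/andP: nz.
Qed.

Variables (al x0 : R).
Hypothesis al0 : 0 < al.
Hypothesis alh : al < h.

Definition sample (i : int) : R := x0 + al * i%:~R.

(** Turns vanishing at consecutive samples into separated zeros; the separators exist because [s] is
    not identically zero on any subinterval. *)
Lemma zer_samples (s : R -> R) (l r : R) (i0 : int) n : l < r ->
  (forall j, (j < n)%N -> l < sample (i0 + j%:Z) < r /\ s (sample (i0 + j%:Z)) = 0) ->
  (forall u v, l <= u -> u < v -> v <= r -> exists2 y, u < y < v & s y != 0) ->
  zer s n r.
Proof.
move=> lr hz hs.
suff P m v : (m <= n)%N -> v <= r -> (if m is m'.+1 then sample (i0 + m'%:Z) < v else l < v) -> zer s m v.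
  apply: P => //; case: (n) hz => // n' hz.
  by have [/andP[]] := hz n' (ltnSn _).
elim: m v => [|m ih] v mn vr hv.
  by have [y /andP[ly yv] sy] := hs l v (lexx _) hv vr; exists y.
have [/andP[lm mr] sm] := hz m mn.
have [y /andP[my yv] sy] := hs _ v (ltW lm) hv vr.
exists y; split => //; exists (sample (i0 + m%:Z)); split => //.
apply: ih; [exact: ltnW|exact: ltW|].
case: m {mn hv sm my} lm mr => [//|m'] _ _.
by rewrite /sample ltrD2l ltr_pM2l// ltr_int; lia.
Qed.

(** The first sample beyond [l h] is at most [al] away, so sample number [j] is at most [(j + 1) al]
    beyond, which is less than [(r - l) h] because [al < h]. *)
Lemma sample_count (l r : int) : l < r -> exists i0 : int,
  forall j, (j < absz (r - l))%N -> l%:~R * h < sample (i0 + j%:Z) < r%:~R * h.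
Proof.
move=> lr; exists (Num.floor ((l%:~R * h - x0) / al) + 1) => j jn.
set fl := Num.floor _.
have hf1 : fl%:~R * al <= l%:~R * h - x0.
  by rewrite -ler_pdivlMr// floor_le_tmp.
have hf2 : l%:~R * h - x0 < (fl + 1)%:~R * al.
  by rewrite -ltr_pdivrMr// floorD1_gt.
rewrite /sample; apply/andP; split.
  rewrite intrD mulrDr.
  have : 0 <= al * j%:~R by rewrite mulr_ge0// ?ltW// ler0z.
  move: hf2; lra.
have jr : (j.+1%:R : R) <= (r - l)%:~R.
  have : (j.+1%:Z <= r - l)%R by lia.
  by rewrite -(ler_int R).
have : (j.+1%:R : R) * al < (r - l)%:~R * h.
  apply: lt_le_trans (_ : j.+1%:R * h <= _); first by rewrite ltr_pM2l// ltr0n.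
  by rewrite ler_pM2r.
have -> : (fl + 1 + j%:Z)%:~R = fl%:~R + j.+1%:R :> R.
  by rewrite !intrD -addrA -natr1 [_ + 1]addrC.
rewrite intrD intrN mulrDr mulrDl mulNr; move: hf1; set F := fl%:~R; set J := j.+1%:R.
rewrite (mulrC F) (mulrC J); lra.
Qed.

End Interpolation.

Lemma size_pos_neg (R : realType) (es : seq R) : nonzeros es -> (size (pos es) + size (neg es) = size es)%N.
Proof.
elim: es => //= d es ih /andP[d0 /ih <-]; rewrite /pos /neg /=.
by case: ltgtP d0 => //= _ _; lia.
Qed.

(** With [u = p] and [v = q]: an end where the spline vanishes trims the window to the knots but is
    credited with [p] or [q] zeros. Unless nothing was trimmed, samples and credits together reach
    [N]. *)
Lemma window_count (k k1 k2 : int) (N u v : nat) (eL eR : bool) (lo := k1 + u%:Z - 1)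
  (hi := k2 - v%:Z + 1) (l := if eL then Num.max k lo else lo)
  (r := if eR then Num.min (k + N%:Z - 1) hi else hi) :
  k1 <= k -> k + N%:Z - 1 <= k2 -> (0 < N)%N -> (0 < u + v)%N ->
  ~~ ((l == lo) && (r == hi)) -> N%:Z <= Num.max (r - l) 0 + (eR * u + eL * v)%N%:Z.
Proof.
rewrite /l /r {l r}; case: eL; case: eR => /=; rewrite ?eqxx ?mul1n ?mul0n ?addn0 ?add0n //= /lo /hi; lia.
Qed.

(** * A spline within the window is determined by its samples *)

Section Injectivity.
Variable R : realType.
Variables (h : R) (h0 : 0 < h).
Variables (ds : seq R) (A B : R -> R).
Hypothesis nz : nonzeros ds.
Hypothesis sz : (1 < size ds)%N.
Hypothesis fAB : fundamental ds A B.
Local Notation knot := (grid h).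
Local Notation spline := (exp_spline h A B).
Local Notation p := (size (pos ds)).
Local Notation q := (size (neg ds)).

Let kA := fundamental_pos fAB.
Let kB := fundamental_neg fAB.

Lemma spline_split N c kap j x : (j <= N)%N ->
  spline N c kap x = spline j c kap x + spline (N - j) (fun k => c (j + k)%N) (knot kap j) x.
Proof.
move=> jN; rewrite /exp_spline -[in LHS](subnKC jN) big_split_ord/=; congr (_ + _).
apply: eq_bigr => k _; congr (_ * splice _ _ (_ - _)).
by rewrite /grid natrD; ring.
Qed.

Lemma spline_right N c kap x : (forall k, (k < N)%N -> knot kap k <= x) ->
  spline N c kap x = \sum_(k < N) c k * A (x - knot kap k).
Proof.
by move=> hx; apply: eq_bigr => k _; rewrite /splice ltNge subr_ge0 hx.
Qed.

Lemma spline_left N c kap x : (forall k, (k < N)%N -> x < knot kap k) ->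
  spline N c kap x = \sum_(k < N) c k * B (x - knot kap k).
Proof.
by move=> hx; apply: eq_bigr => k _; rewrite /splice subr_lt0 hx.
Qed.

Lemma Ker_sumA N (c : nat -> R) kap : Ker (pos ds) (fun x => \sum_(k < N) c k * A (x - knot kap k)).
Proof. by apply: Ker_sum => k _; apply: KerZ; exact: Ker_shift. Qed.

Lemma Ker_sumB N (c : nat -> R) kap : Ker (neg ds) (fun x => \sum_(k < N) c k * B (x - knot kap k)).
Proof. by apply: Ker_sum => k _; apply: KerZ; exact: Ker_shift. Qed.

(** Right of its knots the spline coincides with an element of [Ker (pos ds)], and such an element
    is zero once it vanishes on an interval. *)
Lemma right_zero N c kap l r : l < r -> (forall k, (k < N)%N -> knot kap k <= l) ->
  (forall x, l < x < r -> spline N c kap x = 0) ->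
  forall x, (forall k, (k < N)%N -> knot kap k <= x) -> spline N c kap x = 0.
Proof.
move=> lr hl hs x hx; rewrite spline_right//.
apply: (Ker_zero_itv (nonzeros_pos nz) (Ker_sumA N c kap) lr) => y /andP[ly yr].
rewrite -spline_right ?hs ?ly// => k kN.
by rewrite (le_trans (hl _ kN))// ltW.
Qed.

Lemma left_zero N c kap l r : l < r -> (forall k, (k < N)%N -> r <= knot kap k) ->
  (forall x, l < x < r -> spline N c kap x = 0) ->
  forall x, (forall k, (k < N)%N -> x < knot kap k) -> spline N c kap x = 0.
Proof.
move=> lr hr hs x hx; rewrite spline_left//.
apply: (Ker_zero_itv (nonzeros_neg nz) (Ker_sumB N c kap) lr) => y /andP[ly yr].
rewrite -spline_left ?hs ?ly// => k kN.
by rewrite (lt_le_trans yr)// hr.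
Qed.

(* Between two knots the spline is the sum of an element of [Ker (pos ds)] and one
   of [Ker (neg ds)], and these spaces meet trivially. *)
Lemma split_zero N c kap j l r : (j <= N)%N -> l < r ->
  (forall k, (k < j)%N -> knot kap k <= l) -> (forall k, (j <= k)%N -> r <= knot kap k) ->
  (forall x, l < x < r -> spline N c kap x = 0) ->
  (forall x, (forall k, (k < j)%N -> knot kap k <= x) -> spline j c kap x = 0) /\
  (forall x, x < knot kap j ->
     spline (N - j) (fun k => c (j + k)%N) (knot kap j) x = 0).
Proof.
move=> jN lr hl hr hs.
pose c' k := c (j + k)%N.
have knotD k : knot (knot kap j) k = knot kap (j + k)%N.
  by rewrite /grid natrD; ring.
have hx' x : x < knot kap j -> forall k, (k < N - j)%N -> x < knot (knot kap j) k.
  by move=> xj k _; rewrite knotD (lt_le_trans xj)// le_knot// leq_addr.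
have E x : l < x < r -> \sum_(k < j) c k * A (x - knot kap k) =
    \sum_(k < N - j) (- c' k) * B (x - knot (knot kap j) k).
  move=> /andP[lx xr]; rewrite -spline_right; last first.
    by move=> k kj; rewrite (le_trans (hl _ kj))// ltW.
  have := hs x; rewrite lx xr (spline_split _ _ _ jN) => /(_ isT).
  rewrite (spline_left (N := N - j)); last first.
    by apply: hx'; rewrite (lt_le_trans xr)// hr.
  move/eqP; rewrite addr_eq0 => /eqP ->; rewrite -sumrN; apply: eq_bigr => k _.
  by rewrite mulNr.
have [A0 B0] := Ker_agree (nonzeros_pos nz) (nonzeros_neg nz) (@pos_notin_neg _ ds)
  (Ker_sumA j c kap) (Ker_sumB (N - j) (fun k => - c' k) (knot kap j)) lr E.
split=> x hx; first by rewrite spline_right.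
rewrite spline_left; last exact: hx'.
apply: oppr_inj; rewrite oppr0 -[RHS](B0 x) -sumrN.
by apply: eq_bigr => k _; rewrite mulNr.
Qed.

Variables (al x0 : R).
Hypothesis al0 : 0 < al.
Hypothesis alh : al < h.
Variables (k1 k2 i0 : int).
Hypothesis full : forall j, (j < (absz (k2 - k1)).+2)%N ->
  (k1 + p%:Z - 1)%:~R * h < sample al x0 (i0 + j%:Z) < (k2 - q%:Z + 1)%:~R * h.

Lemma knot_int (k : int) n : knot (k%:~R * h) n = (k + n%:Z)%:~R * h.
Proof. by rewrite /grid intrD mulrDl. Qed.

(** Strong induction on the number of knots. A nonzero spline that does not split would have at
    least [N] zeros, credits included, while [spline_zer_bound] allows at most [N - 1]. *)
Lemma spline_inj N (c : nat -> R) (k : int) : k1 <= k -> k + N%:Z - 1 <= k2 ->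
  (forall i, (k1 + p%:Z - 1)%:~R * h < sample al x0 i < (k2 - q%:Z + 1)%:~R * h ->
     spline N c (k%:~R * h) (sample al x0 i) = 0) ->
  forall n, (n < N)%N -> c n = 0.
Proof.
move: N c k; elim/ltn_ind => N ih c k k1k kk2 hz.
have [->//|N0] := posnP N.
apply: contrapT => /existsNP[n0 /not_implyP[n0N /eqP cn0]].
set kap := k%:~R * h in hz.
pose s := spline N c kap.
have szp := size_pos_neg nz.
pose eL := `[< forall x, x < knot kap 0 -> s x = 0 >].
pose eR := `[< forall x, knot kap N.-1 < x -> s x = 0 >].
(* If the spline vanished between knots [j - 1] and [j], each of the two parts would be zero on the
   other's side; both then vanish at all samples and the induction hypothesis kills every
   coefficient. *)
have nosplit j l r : (0 < j < N)%N -> l < r -> (forall k, (k < j)%N -> knot kap k <= l) ->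
    (forall k, (j <= k)%N -> r <= knot kap k) -> (forall x, l < x < r -> s x = 0) -> False.
  move=> /andP[j0 jN] lr hl hr hs.
  have [zL zR] := split_zero (ltnW jN) lr hl hr hs.
  have sp := spline_split c kap _ (ltnW jN).
  have jj : knot kap j.-1 < knot kap j by rewrite lt_knot// prednK.
  have cL n : (n < j)%N -> c n = 0.
    apply: (ih j jN c k k1k); first by clear -kk2 jN; lia.
    move=> i hi; have := hz i hi; rewrite sp.
    have [ij|ji] := ltP (sample al x0 i) (knot kap j); first by rewrite zR// addr0.
    by move=> _; apply: zL => k' k'j; apply: le_trans ji; rewrite le_knot// ltnW.
  have cR n : (n < N - j)%N -> c (j + n)%N = 0.
    apply: (ih (N - j)%N _ (fun n => c (j + n)%N) (k + j%:Z)).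
    - by clear -j0 jN; lia.
    - by clear -k1k; lia.
    - by clear -kk2 jN; lia.
    move=> i hi; have := hz i hi; rewrite sp -knot_int.
    have [ij|ji] := ltP (sample al x0 i) (knot kap j); first by move=> _; exact: zR.
    by rewrite zL ?add0r// => k' k'j; apply: le_trans ji; rewrite le_knot// ltnW.
  case: (ltnP n0 j) => hj; first by rewrite cL// eqxx in cn0.
  by move: cn0; rewrite -(subnKC hj) cR ?eqxx// ltn_sub2r// (leq_ltn_trans hj).
(* An interval of zeros reaching outside the knots would force [eL] or [eR], against the side
   conditions; one inside the knots is excluded by [nosplit]. *)
have NV l r : l < r -> (eL -> knot kap 0 <= l) -> (eR -> r <= knot kap N.-1) ->
    exists2 y, l < y < r & s y != 0.
  move=> lr hL hR; apply: contrapT => nex.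
  have hs y : l < y < r -> s y = 0.
    by move=> lyr; apply: contrapT => /eqP sy; apply: nex; exists y.
  have [l0|l0] := ltP l (knot kap 0).
    have : eL; last by move/hL; rewrite leNgt l0.
    apply/asboolP => x x0'; apply: (@left_zero N c kap l (Num.min r (knot kap 0))).
    - by rewrite lt_min lr.
    - by move=> k' k'N; rewrite ge_min le_knot// orbT.
    - by move=> y /andP[ly]; rewrite lt_min => /andP[yr _]; apply: hs; rewrite ly.
    - by move=> k' k'N; rewrite (lt_le_trans x0')// le_knot.
  have [rN|rN] := ltP (knot kap N.-1) r.
    have : eR; last by move/hR; rewrite leNgt rN.
    apply/asboolP => x xN'; apply: (@right_zero N c kap (Num.max l (knot kap N.-1)) r).
    - by rewrite gt_max lr.
    - by move=> k' k'N; rewrite le_max le_knot// -ltnS prednK// k'N orbT.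
    - by move=> y /andP[]; rewrite gt_max => /andP[ly _] yr; apply: hs; rewrite ly.
    - by move=> k' k'N; rewrite (le_trans _ (ltW xN'))// le_knot// -ltnS prednK.
  have [J hJ] := knot_count h0 kap N.
  have [JN Jk] := hJ l.
  have J0 : (0 < J l)%N by rewrite -Jk.
  have JlN : (J l < N)%N.
    rewrite ltn_neqAle JN andbT; apply/eqP => JE.
    by have := Jk N.-1; rewrite JE ltn_predL N0 => /(_ isT); rewrite leNgt (lt_le_trans lr rN).
  have lJ : l < knot kap (J l) by rewrite ltNge Jk// ltnn.
  apply: (nosplit (J l) l (Num.min r (knot kap (J l)))).
  - by rewrite J0.
  - by rewrite lt_min lr.
  - by move=> k' k'J; rewrite Jk// (ltn_trans k'J).
  - by move=> k' k'J; rewrite ge_min le_knot// k'J orbT.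
  - by move=> y /andP[ly]; rewrite lt_min => /andP[yr _]; apply: hs; rewrite ly.
have k0 : knot kap 0 = k%:~R * h by rewrite /grid mul0r addr0.
have kN : knot kap N.-1 = (k + N%:Z - 1)%:~R * h.
  by rewrite knot_int; congr (_%:~R * h); clear -N0; lia.
(* The delicate case is one knot with both ends vanishing: [s] is a multiple of the fundamental
   solution, which would then be zero. *)
have nonzero : exists y, s y != 0.
  have [eLT|/asboolPn/existsNP[x /not_implyP[_ /eqP sx]]] := boolP eL; last by exists x.
  have [eRT|/asboolPn/existsNP[x /not_implyP[_ /eqP sx]]] := boolP eR; last by exists x.
  have [N1|N1] := ltnP 1 N.
    have [|//|//|y _ sy] := NV (knot kap 0) (knot kap N.-1); last by exists y.
    by rewrite lt_knot// ltn_predRL.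
  have NE : N = 1%N by apply/eqP; rewrite eqn_leq N1.
  have n00 : n0 = 0%N by move: n0N; rewrite NE ltnS leqn0 => /eqP.
  have sE x : s x = c 0%N * splice A B (x - knot kap 0).
    by rewrite /s /exp_spline NE big_ord1.
  move: cn0; rewrite n00 => c0; exfalso.
  have ds0 : ds != [::] by case: (ds) sz.
  apply: (fundamental_neq0 nz ds0 fAB); split.
    apply: (Ker_zero_itv (nonzeros_pos nz) kA (l := 0) (r := 1)) => // x /andP[x0' _].
    have /asboolP/(_ (x + knot kap 0)) := eRT.
    rewrite NE sE addrK /splice (ltNge x 0) (ltW x0')/= ltrDr x0' => /(_ isT)/eqP.
    by rewrite mulf_eq0 (negPf c0) => /eqP.
  apply: (Ker_zero_itv (nonzeros_neg nz) kB (l := -1) (r := 0)); first by rewrite ltrN10.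
  move=> x /andP[_ x0'].
  have /asboolP/(_ (x + knot kap 0)) := eLT.
  rewrite sE addrK /splice x0' gtrDr x0' => /(_ isT)/eqP.
  by rewrite mulf_eq0 (negPf c0) => /eqP.
pose lo : int := k1 + p%:Z - 1; pose hi : int := k2 - q%:Z + 1.
pose l : int := if eL then Num.max k lo else lo.
pose r : int := if eR then Num.min (k + N%:Z - 1) hi else hi.
have NVw u v : l%:~R * h <= u -> u < v -> v <= r%:~R * h -> exists2 y, u < y < v & s y != 0.
  move=> lu uv vr; apply: NV => //.
    move=> eLT; apply: le_trans lu; rewrite k0 ler_pM2r// ler_int /l eLT le_max lexx//.
  move=> eRT; apply: le_trans vr _; rewrite kN ler_pM2r// ler_int /r eRT ge_min lexx//.
have hzw i : l%:~R * h < sample al x0 i < r%:~R * h -> s (sample al x0 i) = 0.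
  move=> /andP[li ir]; apply: hz; apply/andP; split.
    apply: le_lt_trans li; rewrite ler_pM2r// ler_int /l -/lo; case: (eL) => //.
    by rewrite le_max lexx orbT.
  apply: lt_le_trans ir _; rewrite ler_pM2r// ler_int /r -/hi; case: (eR) => //.
  by rewrite ge_min lexx orbT.
(* An untrimmed window has [k2 - k1 + 2 > N] samples by [full]; a trimmed one is handled by
   [window_count]. If trimming leaves nothing, the credits alone reach [N] and one nonzero value
   suffices. *)
have [Z [x [hZ hN]]] : exists Z x, zer s Z x /\ (N <= Z + eR * p + eL * q)%N.
  have [/andP[/eqP ll /eqP rr]|nfull] := boolP ((l == lo) && (r == hi)).
    exists (absz (k2 - k1)).+2, (r%:~R * h); split; last by clear -k1k kk2; lia.
    apply: (zer_samples h0 (x0 := x0) al0 alh (l := l%:~R * h) (i0 := i0)) => //.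
      by rewrite ll rr; have /andP := full (ltn0Sn _); case=> h1 h2; exact: lt_trans h2.
    move=> j jn; have hj := full jn; split; first by rewrite ll rr; exact: hj.
    by apply: hzw; rewrite ll rr; exact: hj.
  have pq0 : (0 < p + q)%N by rewrite szp; apply: leq_trans sz.
  have bound : (N%:Z <= Num.max (r - l) 0 + (eR * p + eL * q)%N%:Z)%R.
    exact: window_count nfull.
  have [lr|rl] := ltP l r.
    have [i1 hi1] := sample_count h0 x0 al0 alh lr.
    exists (absz (r - l)), (r%:~R * h); split; last by move: bound; clear -lr; lia.
    apply: (zer_samples h0 (x0 := x0) al0 alh (l := l%:~R * h) (i0 := i1)) => //.
      by rewrite ltr_pM2r// ltr_int.
    by move=> j jn; have hj := hi1 j jn; split => //; exact: (hzw _ hj).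
  have [y sy] := nonzero; exists 0%N, (y + 1); split.
    by exists y; split => //; rewrite ltrDl.
  by move: bound; clear -rl; lia.
have hL : eL -> vanishes_left s by move=> /asboolP hs; exists (knot kap 0).
have hR : eR -> vanishes_right s by move=> /asboolP hs; exists (knot kap N.-1).
have := spline_zer_bound h0 nz sz fAB hL hR hZ.
by clear -hN; lia.
Qed.

End Injectivity.

(** * Extension of biorthogonality to all shifts *)

Section Biorthogonality.
Variable R : realType.
Variables (h : R) (h0 : 0 < h).
Variables (ds : seq R) (A B : R -> R).
Hypothesis nz : nonzeros ds.
Hypothesis fAB : fundamental ds A B.
Local Notation p := (size (pos ds)).
Local Notation q := (size (neg ds)).

Let kA := fundamental_pos fAB.
Let kB := fundamental_neg fAB.

Lemma nonzeros_opp (es : seq R) : nonzeros es -> nonzeros [seq - d | d <- es].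
Proof. by move=> hz; apply/allP => _ /mapP[d /(allP hz) d0 ->]; rewrite oppr_eq0. Qed.

(* Left of the sampling window only the right half [A] of the window function is
   seen, which lies in a [p]-dimensional space; hence [p] vanishing moments
   propagate to all earlier shifts. Symmetrically on the right. *)
Lemma biorth_extend n (t w : 'I_n -> R) (k1 k2 : int) (e : R) :
  let lo := k1 + p%:Z - 1 in let hi := k2 - q%:Z + 1 in
  (forall i, lo%:~R * h < t i < hi%:~R * h) -> lo < 0 -> 0 < hi ->
  (forall k, k1 <= k <= k2 ->
     \sum_i w i * splice A B (t i - k%:~R * h) = e * (k == 0)%:R) ->
  forall k : int, \sum_i w i * splice A B (t i - k%:~R * h) = e * (k == 0)%:R.
Proof.
move=> lo hi ht lo0 hi0 hk k.
have [k1k|kk1] := leP k1 k; last first.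
  have klo (j : int) : j <= lo -> \sum_i w i * splice A B (t i - j%:~R * h) =
      \sum_i w i * A (t i - j%:~R * h).
    move=> jlo; apply: eq_bigr => i _; rewrite /splice ifF//.
    have /andP[+ _] := ht i; have : j%:~R * h <= lo%:~R * h by rewrite ler_pM2r// ler_int.
    by move=> h1 h2; apply/negbTE; rewrite -leNgt subr_ge0 (le_trans h1)// ltW.
  have kF : Ker [seq - d | d <- pos ds] (fun y => \sum_i w i * A (t i - y)).
    by apply: Ker_sum => i _; apply: KerZ; exact: Ker_flip.
  have k0 : k < 0 by move: kk1 lo0; rewrite /lo; clear; lia.
  rewrite klo; last by move: kk1; rewrite /lo; clear; lia.
  rewrite lt_eqF// mulr0.
  apply: (@Ker_zeros _ _ _ (fun j => (k1 + j%:Z)%:~R * h) (nonzeros_opp (nonzeros_pos nz)) kF).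
    by move=> i _; rewrite ltr_pM2r// ltr_int; clear; lia.
  move=> j; rewrite size_map => jp'; have jp : (j < p)%N := jp'.
  rewrite -klo; last by move: jp; rewrite /lo; clear; lia.
  have j0 : k1 + j%:Z < 0 by move: jp lo0; rewrite /lo; clear; lia.
  rewrite hk ?lt_eqF ?mulr0//.
  by move: j0 lo0 hi0; rewrite /lo /hi; clear; lia.
have [kk2|k2k] := leP k k2; first by rewrite hk// k1k.
have khi (j : int) : hi <= j -> \sum_i w i * splice A B (t i - j%:~R * h) =
    \sum_i w i * B (t i - j%:~R * h).
  move=> jhi; apply: eq_bigr => i _; rewrite /splice ifT//.
  have /andP[_ +] := ht i; have : hi%:~R * h <= j%:~R * h by rewrite ler_pM2r// ler_int.
  by move=> h1 h2; rewrite subr_lt0 (lt_le_trans h2).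
have kF : Ker [seq - d | d <- neg ds] (fun y => \sum_i w i * B (t i - y)).
  by apply: Ker_sum => i _; apply: KerZ; exact: Ker_flip.
have k0 : 0 < k by move: k2k hi0; rewrite /hi; clear; lia.
rewrite khi; last by move: k2k; rewrite /hi; clear; lia.
rewrite gt_eqF// mulr0.
apply: (@Ker_zeros _ _ _ (fun j => (hi + j%:Z)%:~R * h) (nonzeros_opp (nonzeros_neg nz)) kF).
  by move=> i _; rewrite ltr_pM2r// ltr_int; clear; lia.
move=> j; rewrite size_map => jq'; have jq : (j < q)%N := jq'.
rewrite -khi; last by clear; lia.
have j0 : 0 < hi + j%:Z by move: hi0; clear; lia.
rewrite hk ?gt_eqF ?mulr0//.
by move: jq j0 lo0 hi0; rewrite /lo /hi; clear; lia.
Qed.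

End Biorthogonality.

(** * The matrix of the algorithm and its left inverses *)

Section AlgorithmMatrix.
Variable R : realType.
Variables (g : R -> R) (m : nat) (C0 : R) (delta : 'I_m -> R) (a M L : nat).
Hypothesis m2 : (2 <= m)%N.
Hypothesis tp : totally_positive_finite_type g C0 delta.
Hypothesis cg : continuous g.
Hypothesis a0 : (0 < a)%N.
Hypothesis aM : (a < M)%N.
Local Notation al := (a%:R : R).
Local Notation be := (1 / M%:R : R).
Local Notation p := (npos delta).
Local Notation q := (nneg delta).
Local Notation k1 := (alg_k1 p al be L).
Local Notation k2 := (alg_k2 q al be L).
Local Notation i1 := (alg_i1 p al be L).
Local Notation i2 := (alg_i2 q al be L).
Local Notation nI := (alg_nI p q al be L).
Local Notation nK := (alg_nK p q al be L).
Local Notation P := (alg_P g p q al be L).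
Local Notation k0 := (alg_k0 p q al be L).
Local Notation h := (M%:R : R).

Let al0 : 0 < al. Proof. by rewrite ltr0n. Qed.
Let h0 : 0 < h. Proof. by rewrite ltr0n (leq_trans a0)// ltnW. Qed.
Let alh : al < h. Proof. by rewrite ltr_nat. Qed.

Lemma npos_size : npos delta = size (pos (codom delta)).
Proof.
rewrite /npos /pos size_filter /codom /image_mem count_map cardE size_filter /=.
by rewrite enumT.
Qed.

Lemma nneg_size : nneg delta = size (neg (codom delta)).
Proof.
rewrite /nneg /neg size_filter /codom /image_mem count_map cardE size_filter /=.
by rewrite enumT.
Qed.

Let nz : nonzeros (codom delta).
Proof. by have [_ [_ [d0 _]]] := tp; apply/allP => _ /codomP[k ->]. Qed.

Let pq : (p + q = m)%N.
Proof. by rewrite npos_size nneg_size size_pos_neg// size_codom card_ord. Qed.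

Let lo := k1 + p%:Z - 1.
Let hi := k2 - q%:Z + 1.

(** As [1 / (1 - al be) = h / (h - al)], the floor gives [h < (r + 1) (h - al)], which rearranges to
    the claim. *)
Lemma alg_r_spec : 0 <= alg_r al be /\ (alg_r al be + 1)%:~R * al < (alg_r al be)%:~R * h.
Proof.
have rho : 1 - al * be = (h - al) / h by rewrite mul1r; field; rewrite gt_eqF.
have hal : 0 < h - al by rewrite subr_gt0.
have e : 1 / (1 - al * be) = h / (h - al) by rewrite rho mul1r invf_div.
split; first by rewrite /alg_r floor_ge_int e divr_ge0// ltW.
have := floorD1_gt (1 / (1 - al * be)); rewrite -/(alg_r al be) e.
rewrite ltr_pdivrMr// intrD; lra.
Qed.

Let beV : be^-1 = h.
Proof. by rewrite mul1r invrK. Qed.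

Let lo0 : lo < 0.
Proof.
have [r0 _] := alg_r_spec; rewrite /lo /alg_k1; move: r0; set r := alg_r _ _ => r0.
have : 0 <= r * p%:Z by rewrite mulr_ge0.
by clear; lia.
Qed.

Let hi0 : 0 < hi.
Proof.
have [r0 _] := alg_r_spec; rewrite /hi /alg_k2; move: r0; set r := alg_r _ _ => r0.
have : 0 <= r * q%:Z by rewrite mulr_ge0.
by clear; lia.
Qed.

Lemma alg_window x i : (lo%:~R * h < sample al x i < hi%:~R * h) = (i1 x <= i <= i2 x).
Proof.
have e (k : int) : k%:~R / (al * be) - x / al = (k%:~R * h - x) / al.
  by field; rewrite !gt_eqF.
rewrite /alg_i1 /alg_i2 !e; congr (_ && _).
  by rewrite lezD1 floor_lt_int ltr_pdivrMr// /sample ltrBlDr (mulrC al) [_ + x]addrC.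
by rewrite lerBrDr lezD1 ceil_gt_int ltr_pdivlMr// /sample ltrBrDr (mulrC al) [_ + x]addrC.
Qed.

(** The sample number [j] is at most [(j + 1) al] beyond the left end of the window. Here
    [j + 1 <= (r + 1) m + 2 L + 2], the window has length [(r m + 2 L + 2) h], and [alg_r_spec]
    compares the two. *)
Lemma alg_full x j : (j < (absz (k2 - k1)).+2)%N ->
  lo%:~R * h < sample al x (i1 x + j%:Z) < hi%:~R * h.
Proof.
move=> jN; have [r0 hr] := alg_r_spec.
have e (k : int) : k%:~R / (al * be) - x / al = (k%:~R * h - x) / al.
  by field; rewrite !gt_eqF.
have f1 : lo%:~R * h - x < (i1 x)%:~R * al.
  by rewrite /alg_i1 e -ltr_pdivrMr// floorD1_gt.
have f2 : (i1 x - 1)%:~R * al <= lo%:~R * h - x.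
  by rewrite /alg_i1 e addrK -ler_pdivlMr// floor_le_tmp.
have j0 : (0 : R) <= j%:R * al by rewrite mulr_ge0.
have js : sample al x (i1 x + j%:Z) = x + (i1 x)%:~R * al + j%:R * al.
  by rewrite /sample intrD mulrDr mulrC [al * j%:~R]mulrC addrA.
rewrite js; apply/andP; split; first by move: f1 j0; lra.
set r := alg_r al be in r0 hr.
have pqz : m%:Z = p%:Z + q%:Z by rewrite -PoszD pq.
have E : k2 - k1 = (r + 1) * m%:Z + 2 * L%:Z.
  by rewrite /alg_k1 /alg_k2 -/r pqz; ring.
have hiE : hi - lo = r * m%:Z + 2 * L%:Z + 2.
  by rewrite /hi /lo /alg_k1 /alg_k2 -/r pqz; ring.
have rm0 : 0 <= (r + 1) * m%:Z by rewrite mulr_ge0// addr_ge0.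
have jle : (j%:Z <= (r + 1) * m%:Z + 2 * L%:Z + 1)%R.
  by move: jN; rewrite E; move: rm0; clear; lia.
have jleR : (j%:R : R) + 1 <= (r + 1)%:~R * m%:R + 2 * L%:R + 2.
  have : (j%:Z + 1)%:~R <= ((r + 1) * m%:Z + 2 * L%:Z + 2)%:~R :> R.
    by rewrite ler_int; move: jle; clear; lia.
  by rewrite !(intrD, intrM).
have key : ((j%:R : R) + 1) * al < (hi - lo)%:~R * h.
  apply: le_lt_trans (_ : ((r + 1)%:~R * m%:R + 2 * L%:R + 2) * al < _).
    by rewrite ler_wpM2r// ltW.
  have -> : (hi - lo)%:~R = r%:~R * m%:R + 2 * L%:R + 2 :> R.
    by rewrite hiE !(intrD, intrM).
  have h1 : (r + 1)%:~R * al * m%:R < r%:~R * h * m%:R :> R.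
    by rewrite ltr_pM2r// ltr0n ltnW.
  have h2 : L%:R * al <= L%:R * h :> R by rewrite ler_wpM2l// ltW.
  by move: h1 h2 alh; rewrite intrD; lra.
have key' : (j%:R + 1) * al < hi%:~R * h - lo%:~R * h.
  by move: key; rewrite intrD intrN mulrBl.
have f2' : (i1 x)%:~R * al - al <= lo%:~R * h - x.
  have E' : (i1 x)%:~R = (i1 x - 1)%:~R + 1 :> R.
    by rewrite -[X in _ = _ + X]/(1%:~R) -intrD subrK.
  by rewrite E'; move: f2; set I1 := (i1 x - 1)%:~R; set Z := _ - x; lra.
move: key' f2'; rewrite mulrDl mul1r.
by set u := lo%:~R * h; set v := hi%:~R * h; set y := _ * al; set z := (i1 x)%:~R * al; lra.
Qed.

Lemma alg_nKE : nK%:Z = k2 - k1 + 1 /\ 0 <= k2 - k1 /\ k1 <= 0 <= k2.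
Proof.
have h1 : k1 <= 0 by move: lo0; rewrite /lo; clear -pq; lia.
have h2 : 0 <= k2 by move: hi0; rewrite /hi; clear -pq; lia.
by rewrite /alg_nK; move: h1 h2; clear; lia.
Qed.

Lemma alg_i12 x : i1 x <= i2 x.
Proof. by have := alg_full x (ltn0Sn _); rewrite alg_window addr0 => /andP[/le_trans]; apply. Qed.

(** Each column of [X] is the coefficient vector of a spline with knots at [k1 h, ..., k2 h], and
    the rows of [P x] evaluate it, up to the factor [C0], at the samples in the window. *)
Lemma alg_P_inj x n (X : 'M[R]_(nK, n)) : P x *m X = 0 -> X = 0.
Proof.
move=> PX; have [A [B [fAB gE]]] := tp_structure m2 tp cg.
have [_ [C00 _]] := tp.
have sz : (1 < size (codom delta))%N by rewrite size_codom card_ord.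
have [nKE [k12 _]] := alg_nKE.
apply/matrixP => k j; rewrite mxE.
pose c (n : nat) := if insub n is Some k then X k j else 0.
have ck (k' : 'I_nK) : c k' = X k' j by rewrite /c valK.
rewrite -ck.
have fl j' : (j' < (absz (k2 - k1)).+2)%N ->
    (k1 + (size (pos (codom delta)))%:Z - 1)%:~R * h < sample al x (i1 x + j'%:Z) <
    (k2 - (size (neg (codom delta)))%:Z + 1)%:~R * h.
  by rewrite -npos_size -nneg_size; exact: alg_full.
apply: (@spline_inj R h h0 (codom delta) A B nz sz fAB al x al0 alh _ _ (i1 x) fl nK c k1) => //.
  by move: nKE; clear; lia.
move=> i; rewrite -npos_size -nneg_size => hi'.
have := hi'; rewrite -/lo -/hi alg_window => /andP[h1 h2].
have iI : (absz (i - i1 x) < nI x)%N by rewrite /alg_nI; move: h1 h2; clear; lia.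
have := congr1 (fun Y : 'M[R]_(nI x, n) => Y (Ordinal iI) j) PX.
rewrite !mxE => E; apply: (mulfI (lt0r_neq0 C00)); rewrite mulr0 -[RHS]E.
rewrite /exp_spline mulr_sumr; apply: eq_bigr => k' _.
rewrite mxE gE ck /= [in RHS]mulrC mulrCA; congr (_ * (_ * splice _ _ _)).
have -> : i1 x + (absz (i - i1 x))%:Z = i by move: h1; clear; lia.
by rewrite /sample (knot_int _ k1 k') beV.
Qed.

Lemma alg_left_inverse x : exists Q : 'M[R]_(nK, nI x), Q *m P x = 1%:M.
Proof.
have /row_freeP[Q hQ] : row_free (P x)^T.
  apply: inj_row_free => v hv; apply: trmx_inj; rewrite trmx0.
  by apply: (@alg_P_inj x); rewrite -[P x]trmxK -trmx_mul hv trmx0.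
by exists Q^T; apply: trmx_inj; rewrite trmx_mul trmxK trmx1.
Qed.

(** [P Q P = P] says [P (Q P - 1) = 0], and [P] is injective. *)
Lemma MP_left_inverse x (Q : 'M[R]_(nK, nI x)) : is_MP_pinv (P x) Q -> Q *m P x = 1%:M.
Proof.
move=> [PQP _ _ _]; apply/eqP; rewrite -subr_eq0; apply/eqP.
by apply: (@alg_P_inj x); rewrite mulmxBr mulmx1 mulmxA PQP subrr.
Qed.

(** Row [k0] of [Q P = 1] covers the shifts [k1..k2], and [biorth_extend] the others; its constant
    is [C0^-1] because [g] is [C0] times the spliced solution. *)
Lemma alg_biorth x (Q : 'M[R]_(nK, nI x)) (k : int) : Q *m P x = 1%:M ->
  \sum_(i < nI x) Q k0 i * g (x + al * (i1 x + i%:Z)%:~R - k%:~R * h) = (k == 0)%:R.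
Proof.
move=> QP; have [A [B [fAB gE]]] := tp_structure m2 tp cg.
have [_ [C00 _]] := tp.
have [nKE [k12 /andP[k10 k20]]] := alg_nKE.
under eq_bigr do rewrite gE mulrCA.
rewrite -mulr_sumr; apply: (mulfI (invr_neq0 (lt0r_neq0 C00))).
rewrite mulKf ?lt0r_neq0//.
have W := @biorth_extend R h h0 (codom delta) A B nz fAB (nI x)
  (fun i => x + al * (i1 x + i%:Z)%:~R) (fun i => Q k0 i) k1 k2 C0^-1.
rewrite -npos_size -nneg_size -/lo -/hi in W.
apply: W => //.
  move=> i; have := alg_window x (i1 x + i%:Z); rewrite /sample => ->.
  have := ltn_ord i; rewrite {2}/alg_nI; have := alg_i12 x; clear; lia.
move=> k' /andP[k1k kk2].
have kI : (absz (k' - k1) < nK)%N by move: nKE k1k kk2; clear; lia.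
have := congr1 (fun Y : 'M[R]_(nK) => Y k0 (Ordinal kI)) QP.
rewrite !mxE => E.
have -> : (k' == 0) = (k0 == Ordinal kI).
  rewrite -val_eqE /= inordK; last by rewrite -ltnS; move: nKE k10 k20; rewrite /alg_nK; clear; lia.
  by move: k1k k10; clear; lia.
rewrite -E mulr_sumr; apply: eq_bigr => i _.
rewrite mxE gE /= mulrCA mulKf ?lt0r_neq0//; congr (_ * splice _ _ (_ - _)).
have -> : k1 + (absz (k' - k1))%:Z = k' by move: k1k; clear; lia.
by rewrite beV.
Qed.

End AlgorithmMatrix.

(** * Periodization and its biorthogonality relation *)

Section Periodization.
Variable R : realType.
Local Notation C := R[i].

Definition win (V : nmodType) (F : int -> V) (lo : int) (n : nat) : V :=
  \sum_(j < n) F (lo + j%:Z).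

Lemma win_cat (V : nmodType) (F : int -> V) lo m n :
  win F lo (m + n) = win F lo m + win F (lo + m%:Z) n.
Proof.
rewrite /win big_split_ord/=; congr (_ + _).
by apply: eq_bigr => j _; rewrite PoszD addrA.
Qed.

Lemma win1 (V : nmodType) (F : int -> V) lo : win F lo 1 = F lo.
Proof. by rewrite /win big_ord1 addr0. Qed.

Lemma win0 (V : nmodType) (F : int -> V) lo n :
  (forall i, lo <= i -> i < lo + n%:Z -> F i = 0) -> win F lo n = 0.
Proof.
move=> h; rewrite /win big1// => j _; apply: h; first by rewrite lerDl.
by rewrite ltrD2l ltz_nat.
Qed.

Lemma eq_win (V : nmodType) (F G : int -> V) lo n :
  (forall i, lo <= i -> i < lo + n%:Z -> F i = G i) -> win F lo n = win G lo n.
Proof.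
move=> h; apply: eq_bigr => j _; apply: h; first by rewrite lerDl.
by rewrite ltrD2l ltz_nat.
Qed.

Lemma win_shift (V : nmodType) (F : int -> V) lo n d :
  win (fun i => F (i + d)) lo n = win F (lo + d) n.
Proof. by apply: eq_bigr => j _; rewrite addrAC. Qed.

Lemma win_hull (V : nmodType) (F : int -> V) lo n lo' n' :
  (forall i, ~~ (lo <= i < lo + n%:Z) -> F i = 0) ->
  lo' <= lo -> lo + n%:Z <= lo' + n'%:Z -> win F lo' n' = win F lo n.
Proof.
move=> h l1 l2.
have -> : n' = (absz (lo - lo')%R + (n + absz (lo' + n'%:Z - lo - n%:Z)%R))%N.
  by move: l1 l2; clear; lia.
rewrite win_cat win0 ?add0r; last first.
  by move=> i h1 h2; apply: h; move: l1 h1 h2; clear; lia.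
have -> : lo' + (absz (lo - lo'))%:Z = lo by move: l1; clear; lia.
rewrite win_cat [X in _ + X]win0 ?addr0// => i h1 h2.
by apply: h; move: h1; clear; lia.
Qed.

(** Division by [b] with the remainder running downwards, to match the indices [v b - k] that arise
    from translating by [- k a]. *)
Lemma win_mul (V : nmodType) (F : int -> V) lo b n :
  win F lo (n * b) = \sum_(v < n) \sum_(k < b) F (lo + (v * b)%N%:Z + (b.-1 - k)%N%:Z).
Proof.
elim: n => [|n ih]; first by rewrite mul0n /win !big_ord0.
rewrite mulSnr win_cat ih big_ord_recr/=; congr (_ + _).
rewrite /win (reindex_inj rev_ord_inj)/=; apply: eq_bigr => k _.
congr (F (_ + _)); congr Posz; have := ltn_ord k; clear; lia.
Qed.

Lemma cvg_sum_ord n (F : 'I_n -> nat -> R) (l : 'I_n -> R) :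
  (forall i, F i @ \oo --> l i) -> (fun N => \sum_i F i N) @ \oo --> \sum_i l i.
Proof.
elim: n F l => [|n ih] F l h.
  rewrite big_ord0 (_ : (fun N => _) = cst 0); first exact: cvg_cst.
  by apply/funext => N; rewrite big_ord0.
rewrite big_ord_recr/= (_ : (fun N => \sum_i F i N) =
  (fun N => \sum_(i < n) F (widen_ord (leqnSn n) i) N + F ord_max N)); last first.
  by apply/funext => N; rewrite big_ord_recr.
by apply: cvgD; [apply: (ih (fun i => F (widen_ord (leqnSn n) i)))|].
Qed.

Definition psum (K : nat) (f : R -> R) (t : int) (N : nat) : R :=
  win (fun v => f (t + v * K%:Z)%:~R) (1 - N%:Z) (N + N).

Lemma psumE K f (n : nat) N : \sum_(k < N) (f (n%:R - (k%:R * K%:R)) + f (n%:R + ((k.+1)%:R * K%:R)))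
  = psum K f n%:Z N.
Proof.
elim: N => [|N ih]; first by rewrite /psum /win !big_ord0.
rewrite big_ord_recr/= ih /psum.
rewrite (_ : N.+1 + N.+1 = 1 + ((N + N) + 1))%N; last by lia.
rewrite !win_cat (_ : 1 - N.+1%:Z + 1%N%:Z = 1 - N%:Z); last by lia.
rewrite !win1 addrCA; congr (_ + _).
by congr (f _ + f _); rewrite !(intrD, intrM, intrN)/= ?natrD -?natr1 ?addr0; ring.
Qed.

(* Enough to make the periodization converge and be periodic on integers. *)
Definition periodizable (K : nat) (f : R -> R) :=
  (forall t, cvgn (psum K f t)) /\
  (forall t, (fun N : nat => f (t + N%:Z * K%:Z)%:~R) @ \oo --> (0 : R)) /\
  (forall t, (fun N : nat => f (t - N%:Z * K%:Z)%:~R) @ \oo --> (0 : R)).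

Definition per (K : nat) f (t : int) : R := limn (psum K f t).

Lemma PKSE K f (n : 'I_K) : PKS K f n = (per K f n%:Z)%:C%C.
Proof.
rewrite /PKS /per (_ : (fun N => _) = psum K f n%:Z)//.
by apply/funext => N; exact: psumE.
Qed.

Lemma psum_shift K f t N :
  psum K f (t + K%:Z) N + f (t + K%:Z - N%:Z * K%:Z)%:~R =
  psum K f t N + f (t + K%:Z + N%:Z * K%:Z)%:~R.
Proof.
have -> : psum K f (t + K%:Z) N = win (fun v => f (t + v * K%:Z)%:~R) (1 - N%:Z + 1) (N + N).
  rewrite -win_shift; apply: eq_win => v _ _; congr (f _%:~R); ring.
have E := win_cat (fun v => f (t + v * K%:Z)%:~R) (1 - N%:Z) 1 (N + N).
have E' := win_cat (fun v => f (t + v * K%:Z)%:~R) (1 - N%:Z) (N + N) 1.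
move: E; rewrite addnC E' !win1 => E.
rewrite addrC (_ : t + K%:Z - N%:Z * K%:Z = t + (1 - N%:Z) * K%:Z); last by ring.
rewrite -E; congr (_ + _); congr (f _%:~R).
by rewrite PoszD; ring.
Qed.

(** A shift by [K] exchanges one term at each end of the partial sum, and both terms tend to 0. *)
Lemma per_periodic K f t : periodizable K f -> per K f (t + K%:Z) = per K f t.
Proof.
move=> [cf [cp cm]].
have h : psum K f t @ \oo --> per K f (t + K%:Z).
  have -> : psum K f t = (fun N => psum K f (t + K%:Z) N + f (t + K%:Z - N%:Z * K%:Z)%:~R
      - f (t + K%:Z + N%:Z * K%:Z)%:~R).
    by apply/funext => N; rewrite psum_shift addrK.
  rewrite -[X in _ --> X]addr0 -[X in _ --> X]subr0.
  apply: cvgB; last exact: cp.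
  by apply: cvgD; [exact: cf|exact: cm].
by apply/esym/cvg_lim.
Qed.

Lemma per_periodicM K f t (v : int) : periodizable K f -> per K f (t + v * K%:Z) = per K f t.
Proof.
move=> pf; have P (n : nat) s : per K f (s + n%:Z * K%:Z) = per K f s.
  elim: n s => [|n ih] s; first by rewrite mul0r addr0.
  by rewrite -[RHS]ih -[RHS](per_periodic _ pf); congr (per K f _); rewrite -addn1 PoszD; ring.
have [v0|v0] := leP 0 v; first by have := P (absz v) t; rewrite gez0_abs.
have := P (absz v) (t + v * K%:Z); rewrite ltz0_abs// => <-; congr (per K f _); ring.
Qed.

Lemma per_finite K f t (V : nat) : (forall v : int, (V < absz v)%N -> f (t + v * K%:Z)%:~R = 0) ->
  forall W, (V < W)%N -> per K f t = psum K f t W.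
Proof.
move=> h W VW.
have E N : (V < N)%N -> psum K f t N = win (fun v => f (t + v * K%:Z)%:~R) (1 - V.+1%:Z) (V.+1 + V.+1).
  move=> VN; apply: win_hull => [i hi| |]; [apply: h|..]; move: VN; try move: hi; clear; lia.
rewrite E// /per; apply: cvg_lim => //; apply: cvg_near_cst.
by near=> N; apply/eqP; rewrite E//; near: N; exact: nbhs_infty_gt.
Unshelve. all: by end_near. Qed.

Section Duality.
Variables (a K M : nat) (g ga : R -> R).
Hypothesis a0 : (0 < a)%N.
Hypothesis M0 : (0 < M)%N.
Hypothesis K0 : (0 < K)%N.
Hypothesis aK : (a %| K)%N.
Hypothesis MK : (M %| K)%N.
Hypothesis pg : periodizable K g.
Hypothesis bi : forall t : int, exists (lo : int) (n : nat),
  (forall i, ~~ (lo <= i < lo + n%:Z) -> ga (t + i * a%:Z)%:~R = 0) /\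
  forall k : int, win (fun i => ga (t + i * a%:Z)%:~R * g (t + i * a%:Z - k * M%:Z)%:~R) lo n
     = (k == 0)%:R / M%:R.

Local Notation b := (K %/ a)%N.

Let baK : (b * a)%N = K. Proof. exact: divnK. Qed.

(** Since [K = b a], every integer is [v b - k] for exactly one [v] and one [k < b]; the sum over
    [k] and the periodization of [ga] thus merge into one sum over all [n + i a]. Unfolding the
    periodization of [g] then leaves one biorthogonality relation for each shift by a multiple of
    [K]. *)
Lemma per_duality (n n' : nat) : (n < K)%N -> (n' < K)%N -> n = n' %[mod M] ->
  \sum_(k < b) per K g (n'%:Z - (k * a)%N%:Z) * per K ga (n%:Z - (k * a)%N%:Z)
    = (n == n')%:R / M%:R.
Proof.
move=> nK n'K nn'.
have [lo [len [supp hbi]]] := bi n%:Z.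
(* Large enough that the blocks [v] from [1 - V] to [V] cover the support window of [ga], whatever
   [k < b]. *)
pose V := (absz lo + len + b + 1)%N.
have KZ : K%:Z = b%:Z * a%:Z by rewrite -PoszM baK.
have gaE (k : nat) : (k < b)%N -> per K ga (n%:Z - (k * a)%N%:Z) =
    win (fun v => ga (n%:Z - (k * a)%N%:Z + v * K%:Z)%:~R) (1 - V%:Z) (V + V).
  move=> kb; apply: (@per_finite _ _ _ (absz lo + len + b)); last by rewrite /V addn1.
  move=> v hv; have -> : n%:Z - (k * a)%N%:Z + v * K%:Z = n%:Z + (v * b%:Z - k%:Z) * a%:Z.
    by rewrite KZ PoszM; ring.
  apply: supp; apply/negP => /andP[h1 h2].
  have b1 : (0 < b)%N by exact: leq_trans kb.
  have : (absz v <= absz (v * b%:Z)%R)%N by rewrite abszM leq_pmulr.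
  by move: hv h1 h2 kb; clear; lia.
pose i0 : int := (1 - V%:Z) * b%:Z - b.-1%:Z.
have hull (F : int -> R) : (forall i, ~~ (lo <= i < lo + len%:Z) -> F i = 0) ->
    \sum_(k < b) win (fun v => F (v * b%:Z - k%:Z)) (1 - V%:Z) (V + V) = win F lo len.
  move=> hF; have b1 : (0 < b)%N by rewrite divn_gt0// dvdn_leq.
  transitivity (win F i0 ((V + V) * b)).
    rewrite win_mul /win exchange_big/=; apply: eq_bigr => v _; apply: eq_bigr => k _.
    congr F; rewrite /i0 PoszM; have := ltn_ord k => kb.
    have -> : (b.-1 - k)%N%:Z = b.-1%:Z - k%:Z by move: kb; clear; lia.
    by ring.
  have Vb : (V <= V * b)%N by rewrite leq_pmulr.
  have e1 : i0 = b%:Z - (V * b)%N%:Z - b.-1%:Z by rewrite /i0 PoszM; ring.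
  have e2 : ((V + V) * b)%N%:Z = (V * b)%N%:Z + (V * b)%N%:Z by rewrite mulnDl PoszD.
  by apply: win_hull => //; rewrite e1 ?e2; move: Vb; rewrite /V; clear -b1; lia.
have step1 : \sum_(k < b) per K g (n'%:Z - (k * a)%N%:Z) * per K ga (n%:Z - (k * a)%N%:Z) =
    win (fun i => ga (n%:Z + i * a%:Z)%:~R * per K g (n'%:Z + i * a%:Z)) lo len.
  rewrite -hull; last by move=> i /supp ->; rewrite mul0r.
  apply: eq_bigr => k _; rewrite gaE// /win mulr_sumr; apply: eq_bigr => v _.
  rewrite mulrC; congr (ga _%:~R * _).
    by rewrite KZ PoszM; ring.
  rewrite -(per_periodicM _ (1 - V%:Z + v%:Z) pg); congr (per K g _).
  by rewrite KZ PoszM; ring.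
have [j hj] : exists j : int, n'%:Z = n%:Z + j * M%:Z.
  exists ((n' %/ M)%N%:Z - (n %/ M)%N%:Z).
  rewrite {1}(divn_eq n' M) {1}(divn_eq n M) nn' !PoszD !PoszM; ring.
have [c hc] : exists c : nat, K = (c * M)%N by exists (K %/ M)%N; rewrite divnK.
rewrite step1.
(* The outer sum is finite, so it commutes with the limit defining [per K g]; the sums turn out to
   be constant in [N > 0]. *)
have lim : (fun N => win (fun i => ga (n%:Z + i * a%:Z)%:~R * psum K g (n'%:Z + i * a%:Z) N) lo len)
    @ \oo --> win (fun i => ga (n%:Z + i * a%:Z)%:~R * per K g (n'%:Z + i * a%:Z)) lo len.
  apply: (@cvg_sum_ord len (fun j N => ga (n%:Z + (lo + j%:Z) * a%:Z)%:~R *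
    psum K g (n'%:Z + (lo + j%:Z) * a%:Z) N)) => i.
  by apply: cvgM; [exact: cvg_cst|exact: (pg.1)].
have val N : (0 < N)%N ->
   win (fun i => ga (n%:Z + i * a%:Z)%:~R * psum K g (n'%:Z + i * a%:Z) N) lo len = (n == n')%:R / M%:R.
  move=> N0.
  transitivity (win (fun u : int => ((- (j + u * c%:Z)) == 0)%:R / M%:R : R) (1 - N%:Z) (N + N)).
    rewrite /win; under eq_bigr do rewrite mulr_sumr.
    rewrite exchange_big/=; apply: eq_bigr => u _.
    rewrite -hbi; apply: eq_bigr => i _; congr (_ * g _%:~R).
    by rewrite hj hc PoszM; ring.
  (* [|n' - n| < K] bounds [j], so [j + u c = 0] is possible only for [u = 0]. *)
  have jc : (absz j < c)%N.
    have : (absz (j * M%:Z)%R < K)%N.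
      have -> : j * M%:Z = n'%:Z - n%:Z by rewrite hj; ring.
      by move: nK n'K; clear; lia.
    by rewrite abszM hc ltn_mul2r M0.
  rewrite (@win_hull _ _ 0 1) => [|i hi| |]; last 3 first.
  - have -> : (- (j + i * c%:Z) == 0) = false; last by rewrite mul0r.
    apply/negbTE; rewrite oppr_eq0 addr_eq0; apply/eqP => jE.
    have i1 : (0 < absz i)%N by move: hi; clear; lia.
    by move: jc; rewrite jE abszN abszM ltnNge leq_pmull.
  - by move: N0; clear; lia.
  - by move: N0; clear; lia.
  rewrite win1 mul0r addr0 oppr_eq0; congr (_%:R / _).
  have -> : (j == 0) = (j * M%:Z == 0) by rewrite mulf_eq0 eqz_nat [M == 0%N]eqn0Ngt M0 orbF.
  have -> : j * M%:Z = n'%:Z - n%:Z by rewrite hj; ring.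
  by rewrite subr_eq0 eqz_nat eq_sym.
have h : (fun N => win (fun i => ga (n%:Z + i * a%:Z)%:~R * psum K g (n'%:Z + i * a%:Z) N) lo len)
    @ \oo --> ((n == n')%:R / M%:R : R).
  apply: cvg_near_cst; near=> N; apply: val; near: N; exact: nbhs_infty_gt.
exact: cvg_unique lim h.
Unshelve. all: by end_near. Qed.

End Duality.
End Periodization.

(** * Dual systems and modulations in finite dimension *)

Section FiniteFrames.
Variable R : realType.
Local Notation C := R[i].
Local Notation normc := ComplexField.Normc.normc.

Lemma cauchy_schwarz (I : finType) (a b : I -> R) :
  (\sum_i a i * b i) ^+ 2 <= (\sum_i a i ^+ 2) * (\sum_i b i ^+ 2).
Proof.
have : 0 <= \sum_i \sum_j (a i * b j - a j * b i) ^+ 2.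
  by apply: sumr_ge0 => i _; apply: sumr_ge0 => j _; exact: sqr_ge0.
have -> : \sum_i \sum_j (a i * b j - a j * b i) ^+ 2 =
   (\sum_i a i ^+ 2) * (\sum_i b i ^+ 2) + (\sum_i b i ^+ 2) * (\sum_i a i ^+ 2)
   - 2 * ((\sum_i a i * b i) * (\sum_i a i * b i)).
  rewrite !big_distrlr/= mulr_sumr -big_split -sumrB/=.
  apply: eq_bigr => i _; rewrite mulr_sumr -big_split -sumrB/=; apply: eq_bigr => j _; ring.
by rewrite expr2; lra.
Qed.

Lemma normc_ge0 (z : C) : 0 <= normc z.
Proof. by case: z => x y /=; exact: sqrtr_ge0. Qed.

Lemma normc_sum (I : finType) (F : I -> C) : normc (\sum_i F i) <= \sum_i normc (F i).
Proof.
elim/big_ind2: _ => [|z u w v h1 h2|//]; first by rewrite ComplexField.Normc.normc0.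
exact: le_trans (le_normcD _ _) (lerD h1 h2).
Qed.

Lemma normc_conj (z : C) : normc z^*%C = normc z.
Proof. by case: z => x y /=; rewrite sqrrN. Qed.

Lemma normc_sum_sqr (I : finType) (a b : I -> C) :
  normc (\sum_i a i * b i) ^+ 2 <= (\sum_i normc (a i) ^+ 2) * (\sum_i normc (b i) ^+ 2).
Proof.
apply: le_trans (cauchy_schwarz _ _).
rewrite lerXn2r ?nnegrE ?normc_ge0 ?sumr_ge0// => [i _|].
  by rewrite mulr_ge0 ?normc_ge0.
apply: le_trans (normc_sum _) _.
by apply: ler_sum => i _; rewrite ComplexField.Normc.normcM.
Qed.

(** The reconstruction formula in matrix form, as a resolution of the identity; conjugation shows
    that it is symmetric in [e] and [f]. *)
Definition dual_kernel K (I : finType) (e f : I -> 'I_K -> C) :=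
  forall n n' : 'I_K, \sum_i (e i n')^*%C * f i n = (n == n')%:R.

Lemma dual_kernel_sym K (I : finType) (e f : I -> 'I_K -> C) : dual_kernel e f -> dual_kernel f e.
Proof.
move=> h n n'; rewrite eq_sym -[RHS](rmorph_nat (@conjc R)) -h rmorph_sum.
by apply: eq_bigr => i _; rewrite rmorphM /= conjcK mulrC.
Qed.

Lemma dual_kernel_reconstruct K (I : finType) (e f : I -> 'I_K -> C) (u : 'I_K -> C) :
  dual_kernel e f -> u = (fun n => \sum_i inner u (e i) * f i n).
Proof.
move=> h; apply/funext => n.
under eq_bigr do rewrite /inner mulr_suml.
rewrite exchange_big/= (bigD1 n)//= [X in _ + X]big1.
  rewrite addr0; under eq_bigr do rewrite -mulrA.
  by rewrite -mulr_sumr h eqxx mulr1.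
move=> n' n'n; under eq_bigr do rewrite -mulrA.
by rewrite -mulr_sumr h eq_sym (negPf n'n) mulr0.
Qed.

(** Cauchy-Schwarz on the reconstruction formula gives the lower bound, and on the inner products
    the upper one. *)
Lemma dual_kernel_frame K (I : finType) (e f : I -> 'I_K -> C) : dual_kernel e f -> is_frame e.
Proof.
move=> h.
pose S (w : I -> 'I_K -> C) := \sum_i \sum_n normc (w i n) ^+ 2.
have S0 w : 0 <= S w by apply: sumr_ge0 => i _; apply: sumr_ge0 => n _; exact: sqr_ge0.
(* Adding 1 keeps both bounds positive even when the sums are 0. *)
exists (S f + 1)^-1, (S e + 1); split; first by rewrite invr_gt0 ltr_wpDl.
split; first by rewrite ltr_wpDl.
move=> u; pose T := \sum_i normc (inner u (e i)) ^+ 2.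
have T0 : 0 <= T by apply: sumr_ge0 => i _; exact: sqr_ge0.
have u0 : 0 <= sqnorm u by apply: sumr_ge0 => n _; exact: sqr_ge0.
apply/andP; split.
  rewrite mulrC ler_pdivrMr ?ltr_wpDl// -/T.
  apply: le_trans (_ : T * S f <= _); last by rewrite ler_wpM2l// lerDl.
  rewrite /S exchange_big/= mulr_sumr; apply: ler_sum => n _.
  rewrite {1}(dual_kernel_reconstruct u h).
  exact: (normc_sum_sqr (fun i => inner u (e i)) (fun i => f i n)).
apply: le_trans (_ : S e * sqnorm u <= _); last by rewrite ler_wpM2r// lerDl.
rewrite /S mulr_suml; apply: ler_sum => i _; rewrite mulrC.
apply: le_trans (normc_sum_sqr _ _) _.
by rewrite ler_wpM2l//; apply: ler_sum => n _; rewrite normc_conj.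
Qed.

Definition cis (x : R) : C := Complex (cos x) (sin x).

Lemma cisD x y : cis (x + y) = cis x * cis y.
Proof.
by apply/eqP; rewrite eq_complex /= cosD sinD; apply/andP; split; apply/eqP; ring.
Qed.

Lemma cis0 : cis 0 = 1.
Proof. by rewrite /cis cos0 sin0. Qed.

Lemma cisX x n : cis x ^+ n = cis (x * n%:R).
Proof.
elim: n => [|n ih]; first by rewrite mulr0 cis0.
by rewrite exprS ih -cisD -natr1; congr cis; ring.
Qed.

Lemma conj_cis x : (cis x)^*%C * cis x = 1.
Proof.
apply/eqP; rewrite eq_complex /=; have := cos2Dsin2 x => h.
by apply/andP; split; apply/eqP; [rewrite -h|]; ring.
Qed.

Lemma cis_eq1 x : 0 < x < 2 * pi -> cis x != 1.
Proof.
move=> /andP[x0 xpi]; rewrite eq_complex /= negb_and; apply/orP; left.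
have s0 : 0 < sin (x / 2) by apply: sin_gt0_pi; apply/andP; split; lra.
have -> : x = x / 2 + x / 2 by field.
rewrite cosD; apply/eqP => h; have := cos2Dsin2 (x / 2); rewrite !expr2.
have : 0 < sin (x / 2) * sin (x / 2) by rewrite mulr_gt0.
lra.
Qed.

Lemma cis_primitive M : (0 < M)%N -> M.-primitive_root (cis (2 * pi / M%:R)).
Proof.
move=> M0; have MR : (0 : R) < M%:R by rewrite ltr0n.
apply/andP; split => //; apply/forallP => i; apply/eqP; rewrite unity_rootE cisX.
have [->|iM] := eqVneq i.+1 M.
  rewrite (divfK (lt0r_neq0 MR)) (_ : 2 * pi = pi + pi :> R); last by ring.
  rewrite cisD.
  have -> : cis pi * cis pi = 1; last by rewrite eqxx.
  by rewrite /cis cospi sinpi; apply/eqP; rewrite eq_complex /=; apply/andP; split; apply/eqP; ring.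
apply/negbTE/cis_eq1; have p0 := pi_gt0 R.
have im : (i.+1%:R : R) < M%:R by rewrite ltr_nat ltn_neqAle iM ltn_ord.
apply/andP; split; first by rewrite mulr_gt0 ?divr_gt0 ?mulr_gt0.
by rewrite mulrAC ltr_pdivrMr// ltr_pM2l// mulr_gt0.
Qed.

(** A geometric sum with ratio [z = w^(n - n')], where [w] is a primitive [M]-th root of unity whose
    conjugate is its inverse. *)
Lemma modulation_sum M n n' : (0 < M)%N ->
  \sum_(l < M) (cis (2 * pi * (l%:R / M%:R) * n'%:R))^*%C * cis (2 * pi * (l%:R / M%:R) * n%:R)
    = (n == n' %[mod M])%:R * M%:R.
Proof.
move=> M0; have pr := cis_primitive M0; set w := cis (2 * pi / M%:R) in pr.
have E (l : nat) k : cis (2 * pi * (l%:R / M%:R) * k%:R) = (w ^+ k) ^+ l.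
  by rewrite -exprM cisX natrM; congr cis; ring.
pose z := (w ^+ n')^*%C * w ^+ n.
have wn k : (w ^+ k)^*%C * w ^+ k = 1 by rewrite rmorphXn /= -exprMn conj_cis expr1n.
have -> : \sum_(l < M) (cis (2 * pi * (l%:R / M%:R) * n'%:R))^*%C *
    cis (2 * pi * (l%:R / M%:R) * n%:R) = \sum_(l < M) z ^+ l.
  by apply: eq_bigr => l _; rewrite !E rmorphXn -exprMn.
have z1 : (z == 1) = (n == n' %[mod M]).
  rewrite -(eq_prim_root_expr pr); apply/eqP/eqP => [z1|E0]; last by rewrite /z E0 wn.
  by rewrite -[LHS]mul1r -(wn n') mulrAC -[X in X * _]/z z1 mul1r.
rewrite -z1; have [->|zn1] := eqVneq z 1.
  by under eq_bigr do rewrite expr1n; rewrite sumr_const card_ord mul1r.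
rewrite mul0r; apply: (mulfI (_ : z - 1 != 0)); first by rewrite subr_eq0.
rewrite mulr0 -subrX1 /z exprMn -exprM mulnC exprM (prim_expr_order pr) expr1n mulr1.
by rewrite -rmorphXn -exprM mulnC exprM (prim_expr_order pr) expr1n rmorph1 subrr.
Qed.

End FiniteFrames.

(** * From the windows on the line to the finite Gabor systems *)

Section Transfer.
Variable R : realType.
Local Notation C := R[i].

Lemma sides_splice_decay A B : sides A B ->
  exists c D : R, [/\ 0 < c, 0 < D & forall x, `|splice A B x| <= D * expR (- (c * `|x|))].
Proof.
move=> [_ _ [c1 [C1 [c10 C10 hA]]] [c2 [C2 [c20 C20 hB]]]].
exists (Num.min c1 c2), (C1 + C2); split; [by rewrite lt_min c10|by rewrite addr_gt0|].
move=> x; rewrite /splice; case: ltP => x0.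
  have := hB (- x); rewrite oppr_ge0 /= opprK (ltr0_norm x0) => /(_ (ltW x0)) h.
  apply: le_trans h _; apply: ler_pM; rewrite ?(ltW C20) ?expR_ge0 ?lerDr ?(ltW C10)//.
  by rewrite ler_expR lerN2 ler_wpM2r ?ge_min ?lexx ?orbT// oppr_ge0 ltW.
rewrite (ger0_norm x0); apply: le_trans (hA _ x0) _.
apply: ler_pM; rewrite ?(ltW C10) ?expR_ge0 ?lerDl ?(ltW C20)//.
by rewrite ler_expR lerN2 ler_wpM2r ?ge_min ?lexx.
Qed.

Lemma psum_series K (f : R -> R) t : psum K f t =
  series (fun k => f (t - k%:Z * K%:Z)%:~R + f (t + k.+1%:Z * K%:Z)%:~R).
Proof.
apply/funext => N; elim: N => [|N ih]; first by rewrite /psum /win /series /= big_ord0 big_geq.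
rewrite seriesSr -ih /psum (_ : N.+1 + N.+1 = 1 + ((N + N) + 1))%N; last by lia.
rewrite !win_cat (_ : 1 - N.+1%:Z + 1%N%:Z = 1 - N%:Z); last by lia.
rewrite !win1 addrCA; congr (_ + _).
by congr (f _%:~R + f _%:~R); rewrite -addn1 ?PoszD; ring.
Qed.

Lemma decay_periodizable K (f : R -> R) c D : (0 < K)%N -> 0 < c -> 0 < D ->
  (forall x, `|f x| <= D * expR (- (c * `|x|))) -> periodizable K f.
Proof.
move=> K0 c0 D0 hf.
pose z := expR (- (c * K%:R)).
have z0 : 0 < z by exact: expR_gt0.
have z1 : z < 1 by rewrite -expR0 ltr_expR oppr_lt0 mulr_gt0// ltr0n.
have zn : `|z| < 1 by rewrite gtr0_norm.
pose E (t : int) := D * expR (c * `|t%:~R|).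
have bnd (t : int) (s : int) : `|f (t + s * K%:Z)%:~R| <= E t * z ^+ (absz s).
  apply: le_trans (hf _) _; rewrite /E /z -mulrA ler_pM2l//.
  have -> : expR (- (c * K%:R)) ^+ absz s = expR (- (c * `|(s * K%:Z)%:~R|)).
    have -> : `|(s * K%:Z)%:~R| = (absz s)%:R * K%:R :> R.
      by rewrite intrM normrM normr_nat natr_absz intr_norm.
    elim: (absz s) => [|n ih]; first by rewrite mul0r mulr0 oppr0 expR0.
    by rewrite exprS ih -expRD; congr expR; rewrite -natr1; ring.
  rewrite -expRD ler_expR -mulrN -mulrBr ler_pM2l// intrD.
  have := ler_normB (t%:~R + (s * K%:Z)%:~R : R) t%:~R.
  by rewrite addrAC subrr add0r; lra.
have lim0 (u : nat -> R) B : (forall n, `|u n| <= B * z ^+ n) -> u @ \oo --> 0.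
  move=> hu; apply: norm_cvg0; apply: (@squeeze_cvgr _ _ _ _ (cst 0) (geometric B z)).
  - by apply: nearW => n; rewrite normr_ge0 hu.
  - exact: cvg_cst.
  - exact: cvg_geometric.
split; last first.
  split=> t; apply: (lim0 _ (E t)) => n.
    by have := bnd t n%:Z.
  by have := bnd t (- n%:Z); rewrite mulNr abszN.
move=> t; rewrite psum_series; apply: normed_cvg.
apply: (@series_le_cvg _ _ (geometric (E t + E t) z)).
- by move=> n; exact: normr_ge0.
- by move=> n; rewrite /geometric/= mulr_ge0 ?exprn_ge0 ?(ltW z0)// addr_ge0// mulr_ge0 ?expR_ge0// ltW.
- move=> n; rewrite /geometric/=; apply: le_trans (ler_normD _ _) _; rewrite mulrDl; apply: lerD.
    by have := bnd t (- n%:Z); rewrite mulNr abszN.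
  apply: le_trans (bnd t n.+1%:Z) _; rewrite ler_wpM2l//.
    by rewrite mulr_ge0 ?expR_ge0// ltW.
  by rewrite exprS ler_piMl ?exprn_ge0// ltW.
- exact: is_cvg_geometric_series.
Qed.

Lemma finite_periodizable K (f : R -> R) :
  (forall t : int, exists V : nat, forall v : int, (V < absz v)%N -> f (t + v * K%:Z)%:~R = 0) ->
  periodizable K f.
Proof.
move=> h; split.
  move=> t; have [V hV] := h t; apply/cvg_ex; exists (psum K f t V.+1).
  apply: cvg_near_cst; near=> N.
  rewrite /psum; apply: win_hull => [i hi| |]; first by apply: hV; move: hi; clear; lia.
    by have : (V < N)%N; [near: N; exact: nbhs_infty_gt|clear; lia].
  by have : (V < N)%N; [near: N; exact: nbhs_infty_gt|clear; lia].
split=> t; have [V hV] := h t; apply: cvg_near_cst; near=> N.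
  by apply: hV; rewrite /=; near: N; exact: nbhs_infty_gt.
rewrite -mulNr; apply: hV; rewrite abszN; near: N; exact: nbhs_infty_gt.
Unshelve. all: by end_near. Qed.

Lemma PKS_transl K a k (f : R -> R) (n : 'I_K) : (k * a < K)%N -> periodizable K f ->
  transl (k * a) (PKS K f) n = (per K f (n%:Z - (k * a)%N%:Z))%:C%C.
Proof.
move=> kaK pf; rewrite /transl PKSE /= (modn_small kaK); congr (_%:C%C).
rewrite -[RHS](per_periodicM _ (1 - ((n + K - k * a) %/ K)%N%:Z) pf); congr (per K f _).
have := divn_eq (n + K - k * a) K; set e := (_ %/ _)%N; set r := (_ %% _)%N.
move=> E; have : (n + K - k * a)%N%:Z = e%:Z * K%:Z + r%:Z by rewrite E PoszD PoszM.
have -> : (n + K - k * a)%N%:Z = n%:Z + K%:Z - (k * a)%N%:Z by move: kaK; clear; lia.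
by move=> E'; rewrite mulrBl mul1r; move: E'; set u := e%:Z * _; clear; lia.
Qed.

Lemma realC_conj (x : R) : (x%:C%C)^*%C = x%:C%C.
Proof. by apply/eqP; rewrite eq_complex /= oppr0 !eqxx. Qed.

Lemma realCM (x y : R) : (x * y)%:C%C = x%:C%C * y%:C%C :> C.
Proof. by rewrite rmorphM. Qed.

Lemma conjM (u v : C) : (u * v)^*%C = u^*%C * v^*%C.
Proof. by rewrite rmorphM. Qed.

(** The sum over modulations is [M] when [n] and [n'] agree modulo [M] and 0 otherwise; in the first
    case [per_duality] supplies the matching [1 / M]. *)
Lemma gabor_dual_kernel (a K M : nat) (g ga : R -> R) : (0 < a)%N -> (0 < M)%N ->
  (a %| K)%N -> (M %| K)%N -> ((0 < K)%N -> periodizable K g) -> ((0 < K)%N -> periodizable K ga) ->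
  (forall t : int, exists (lo : int) (n : nat),
    (forall i, ~~ (lo <= i < lo + n%:Z) -> ga (t + i * a%:Z)%:~R = 0) /\
    forall k : int, win (fun i => ga (t + i * a%:Z)%:~R * g (t + i * a%:Z - k * M%:Z)%:~R) lo n
       = (k == 0)%:R / M%:R) ->
  dual_kernel (gabor a M (PKS K g)) (gabor a M (PKS K ga)).
Proof.
move=> a0 M0 aK MK pg pga bi n n'.
(* An index [n] exists, so [K > 0] and the periodizations are available; for [K = 0] there is
   nothing to prove. *)
have K0 := ord_pos n; have {}pg := pg K0; have {}pga := pga K0.
have kaK (k : 'I_(K %/ a)) : (k * a < K)%N by rewrite -ltn_divRL.
pose E (l k : nat) : C := cis (2 * pi * (l%:R / M%:R) * k%:R).
have gE f (k : 'I_(K %/ a)) (l : 'I_M) (r : 'I_K) : periodizable K f ->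
    gabor a M (PKS K f) (k, l) r = (per K f (r%:Z - (k * a)%N%:Z))%:C%C * E l r.
  by move=> pf; rewrite -PKS_transl.
transitivity (\sum_(k < K %/ a) \sum_(l < M)
   ((per K g (n'%:Z - (k * a)%N%:Z) * per K ga (n%:Z - (k * a)%N%:Z))%:C%C *
     ((E l n')^*%C * E l n))).
  rewrite pair_bigA; apply: eq_bigr => -[k l] _.
  rewrite !gE// conjM realC_conj.
  transitivity ((per K g (n'%:Z - (k * a)%N%:Z) * per K ga (n%:Z - (k * a)%N%:Z))%:C%C *
    ((E l n')^*%C * E l n)) => //.
  by rewrite realCM; exact: mulrACA.
under eq_bigr do rewrite -mulr_sumr (modulation_sum R n n' M0).
rewrite -mulr_suml -rmorph_sum /=.
have [nn'|nn'] := eqVneq (n %% M)%N (n' %% M)%N; last first.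
  rewrite mul0r mulr0; case: eqVneq => // E'; by rewrite E' eqxx in nn'.
rewrite (per_duality a0 M0 K0 aK MK pg bi)//.
rewrite mul1r -val_eqE /=.
have -> : M%:R = (M%:R : R)%:C%C :> C by rewrite rmorph_nat.
rewrite -rmorphM /= divfK ?pnatr_eq0 -?lt0n//.
by rewrite rmorph_nat.
Qed.

Section Windows.
Variables (g : R -> R) (m : nat) (C0 : R) (delta : 'I_m -> R) (a K M L : nat).
Hypothesis m2 : (2 <= m)%N.
Hypothesis tp : totally_positive_finite_type g C0 delta.
Hypothesis cg : continuous g.
Hypothesis a0 : (0 < a)%N.
Hypothesis aM : (a < M)%N.
Hypothesis aK : (a %| K)%N.
Hypothesis MK : (M %| K)%N.
Local Notation al := (a%:R : R).
Local Notation be := (1 / M%:R : R).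
Local Notation p := (npos delta).
Local Notation q := (nneg delta).

(** The output of the algorithm at integer points, with any left inverse of [P] as [Q]. The
    periodization reads integer points only, and this form serves both claims of the theorem. *)
Definition left_inverse_output (ga : R -> R) := forall x : nat, (x < a)%N ->
  exists Q : 'M[R]_(alg_nK p q al be L, alg_nI p q al be L x%:R),
   [/\ Q *m alg_P g p q al be L x%:R = 1%:M,
       forall i : 'I_(alg_nI p q al be L x%:R),
         ga (x%:R + al * (alg_i1 p al be L x%:R + i%:Z)%:~R) = be * Q (alg_k0 p q al be L) i &
       forall i : int, (i < alg_i1 p al be L x%:R) || (alg_i2 q al be L x%:R < i) ->
         ga (x%:R + al * i%:~R) = 0].

Lemma output_dual_kernel ga : left_inverse_output ga ->
  dual_kernel (gabor a M (PKS K g)) (gabor a M (PKS K ga)).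
Proof.
move=> hga; have M0 : (0 < M)%N by exact: leq_trans (ltnW aM).
have [A [B [fAB gE]]] := tp_structure m2 tp cg.
have [_ [C00 [d0 _]]] := tp.
have nz : nonzeros (codom delta) by apply/allP => _ /codomP[k ->].
have W (t : int) : exists (lo : int) (n : nat),
    (forall i, ~~ (lo <= i < lo + n%:Z) -> ga (t + i * a%:Z)%:~R = 0) /\
    forall k : int, win (fun i => ga (t + i * a%:Z)%:~R * g (t + i * a%:Z - k * M%:Z)%:~R) lo n
       = (k == 0)%:R / M%:R.
  (* The relation along [t + a Z] is the one produced by the algorithm at the residue [x], with
     indices moved by the quotient [j]. *)
  pose x := absz (t %% a%:Z)%Z; pose j := (t %/ a%:Z)%Z.
  have az : a%:Z != 0 by rewrite eqz_nat -lt0n.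
  have xE : x%:Z = (t %% a%:Z)%Z by rewrite /x gez0_abs// modz_ge0.
  have xa : (x < a)%N by rewrite -ltz_nat xE ltz_pmod// ltz_nat.
  have tE : t = j * a%:Z + x%:Z by rewrite xE -divz_eq.
  have [Q [QP gaQ ga0]] := hga x xa.
  have i12 := alg_i12 L m2 tp a0 aM x%:R.
  pose i1 := alg_i1 p al be L x%:R.
  have e i : (t + i * a%:Z)%:~R = x%:R + al * (i + j)%:~R :> R.
    by rewrite tE !(intrD, intrM)/=; ring.
  exists (i1 - j), (alg_nI p q al be L x%:R); split.
    move=> i hi; rewrite e; apply: ga0; move: hi i12; rewrite /alg_nI -/i1.
    by set i2 := alg_i2 _ _ _ _ _; clear; lia.
  move=> k; rewrite -(alg_biorth m2 tp cg a0 aM k QP) /win mulr_suml.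
  apply: eq_bigr => i _; rewrite e intrD e intrN intrM.
  have -> : i1 - j + i%:Z + j = i1 + i%:Z by ring.
  by rewrite gaQ; ring.
apply: (gabor_dual_kernel a0 M0 aK MK _ _ W) => K0.
  have [c [D [c0 D0 hD]]] := sides_splice_decay (fundamental_sides nz fAB).
  apply: (@decay_periodizable K g c (C0 * D)) => //; first by rewrite mulr_gt0.
  by move=> x; rewrite gE normrM gtr0_norm// -mulrA ler_pM2l.
apply: finite_periodizable => t; have [lo [n [h _]]] := W t.
exists (absz lo + n)%N => v hv.
have -> : v * K%:Z = (v * (K %/ a)%N%:Z) * a%:Z by rewrite -mulrA -PoszM divnK.
apply: h; have b1 : (0 < K %/ a)%N by rewrite divn_gt0// dvdn_leq.
have : (absz v <= absz (v * (K %/ a)%N%:Z)%R)%N by rewrite abszM leq_pmulr.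
by move: hv; set u := v * _; clear; lia.
Qed.

Lemma left_inverse_output_exists : exists ga, left_inverse_output ga.
Proof.
pose Q x := sval (cid (alg_left_inverse L m2 tp cg a0 aM x)).
have hQ x : Q x *m alg_P g p q al be L x = 1%:M := svalP (cid (alg_left_inverse L m2 tp cg a0 aM x)).
pose w (x : R) (i : int) := if insub (absz (i - alg_i1 p al be L x)) is Some j
  then be * Q x (alg_k0 p q al be L) j else 0.
(* At an integer [y] the floor is [y] itself, and its division by [a] recovers the residue [x] and
   the index [i]. *)
pose ga (y : R) := let t := Num.floor y in let x := (absz (t %% a%:Z)%Z)%:R in
  let i := (t %/ a%:Z)%Z in if alg_i1 p al be L x <= i <= alg_i2 q al be L x then w x i else 0.
exists ga => x xa; exists (Q x%:R).
have gaE (i : int) : ga (x%:R + al * i%:~R) =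
    if alg_i1 p al be L x%:R <= i <= alg_i2 q al be L x%:R then w x%:R i else 0.
  have fE : Num.floor (x%:R + al * i%:~R) = i * a%:Z + x%:Z.
    rewrite (_ : x%:R + al * i%:~R = (i * a%:Z + x%:Z)%:~R) ?intrKfloor//.
    by rewrite intrD intrM /=; ring.
  have az : a%:Z != 0 by rewrite eqz_nat -lt0n.
  rewrite /ga fE divzMDl// modzMDl divz_small ?addr0 ?modz_small//; rewrite ?ltz_nat ?xa//.
split; first exact: hQ.
  move=> i; rewrite gaE; have i12 := alg_i12 L m2 tp a0 aM x%:R.
  have ii := ltn_ord i; rewrite {2}/alg_nI in ii.
  rewrite ifT; last first.
    by move: i12 ii; set u := alg_i1 _ _ _ _ _; set v := alg_i2 _ _ _ _ _; clear; lia.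
  rewrite /w addrAC subrr add0r /=.
  by rewrite valK.
move=> i hi; rewrite gaE ifF//; apply/negbTE; move: hi.
by rewrite negb_and -!ltNge.
Qed.

End Windows.
End Transfer.

Theorem theorem7 (R : realType) (g : R -> R) (m : nat) (C0 : R)
    (delta : 'I_m -> R) (a K M : nat) :
  (2 <= m)%N ->
  totally_positive_finite_type g C0 delta ->
  continuous g ->
  (0 < a)%N -> (0 < M)%N -> (a %| K)%N -> (M %| K)%N ->
  (a%:R / M%:R < 1 :> R) ->
  is_frame (gabor a M (PKS K g)) /\
  (forall (L : nat) (gamma : R -> R),
     algorithm_output g (npos delta) (nneg delta) a%:R (1 / M%:R) L gamma ->
     is_dual_window a M (PKS K g) (PKS K gamma)).
Proof.
move=> m2 tp cg a0 M0 aK MK aM1.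
have aM : (a < M)%N by move: aM1; rewrite ltr_pdivrMr ?ltr0n// mul1r ltr_nat.
split.
  have [ga hga] : exists ga, left_inverse_output g delta a M 0 ga.
    exact: left_inverse_output_exists m2 tp cg a0 aM.
  exact: dual_kernel_frame (output_dual_kernel m2 tp cg a0 aM aK MK hga).
move=> L ga hga.
have dk : dual_kernel (gabor a M (PKS K g)) (gabor a M (PKS K ga)).
  apply: (output_dual_kernel (L := L) m2 tp cg a0 aM aK MK) => x xa.
  have [|Q [MP [hQ h0]]] := hga x%:R; first by rewrite ler0n ltr_nat.
  by exists Q; split => //; exact: (MP_left_inverse m2 tp cg a0 aM MP).
split; first exact: dual_kernel_frame (dual_kernel_sym dk).
by move=> f; exact: dual_kernel_reconstruct.
Qed.
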